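(* Let $s\ge 0$, $m\ge s+2$ and $d\ge 2m+1$ be integers. Let $A_1\subset\mathbb{P}^m$ be a connected curvilinear zero-dimensional scheme of degree $3$ with $\dim\langle A_1\rangle=2$, and let $S\subset\mathbb{P}^m$ be a finite set such that $S\cap A_1=\emptyset$, $\sharp(S)=s$, $S$ is linearly independent and $\langle S\rangle\cap\langle A_1\rangle=\emptyset$. Set $A:=A_1\cup S$. Let $P\in\langle\nu_d(A)\rangle$ be any point such that $P\notin\langle\nu_d(A')\rangle$ for any closed subscheme $A'\subsetneq A$. Then there is a unique $P_1\in\langle\nu_d(A_1)\rangle$ such that $P\in\langle\{P_1\}\cup\nu_d(S)\rangle$, and $P_1\notin\langle\nu_d(A')\rangle$ for any closed subscheme $A'\subsetneq A_1$. Moreover $r_{m,d}(P)=s+2d-1$, every $B\in\mathcal{S}(P)$ is of the form $B=B_1\sqcup S$ with $B_1\in\mathcal{S}(P_1)$, and conversely every set $B_1\sqcup S$ with $B_1\in\mathcal{S}(P_1)$ belongs to $\mathcal{S}(P)$.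
   Context: Work over an algebraically closed field of characteristic $0$. $\nu_d:\mathbb{P}^m\to\mathbb{P}^r$, $r=\binom{m+d}{m}-1$, is the degree $d$ Veronese embedding and $\langle\ \rangle$ denotes linear span (of a set or of a closed subscheme; the span of the empty set is empty). A zero-dimensional scheme is curvilinear if its Zariski tangent space at each point has dimension at most $1$ (equivalently, it is locally contained in a smooth curve). A finite set $S\subset\mathbb{P}^m$ is linearly independent if $\dim\langle S\rangle=\sharp(S)-1$. The rank $r_{m,d}(P)$ of $P\in\mathbb{P}^r$ is the minimal cardinality of a finite set $B\subset\mathbb{P}^m$ with $P\in\langle\nu_d(B)\rangle$, and $\mathcal{S}(P)$ is the set of all finite sets $B\subset\mathbb{P}^m$ such that $P\in\langle\nu_d(B)\rangle$ and $\sharp(B)=r_{m,d}(P)$. *)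

(* Defs.v *)
From HB Require Import structures.
From mathcomp Require Import all_boot all_order all_algebra.
From mathcomp Require Import finmap boolp.
From mathcomp.multinomials Require Import mpoly.

Set Implicit Arguments.
Unset Strict Implicit.
Unset Printing Implicit Defensive.

Import GRing.Theory.
Local Open Scope ring_scope.
#[local] Obligation Tactic := idtac.

Definition subspace_prop (k : fieldType) (V : vectType k) (E : V -> Prop) :=
  E 0 /\ forall (a : k) u v, E u -> E v -> E (a *: u + v).

Lemma subspace_propP (k : fieldType) (V : vectType k) (E : V -> Prop) :
  subspace_prop E -> exists U : {vspace V}, forall v, (v \in U) = `[< E v >].
Proof.
move=> [E0 EP].
have [| |n] := @ex_maxnP
    (fun n => `[< exists U : {vspace V}, (forall v, v \in U -> E v) /\ \dim U = n >])
    (\dim {:V}).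
- by exists 0%N; apply/asboolP; exists 0%VS; split=> [v|];
    rewrite ?dimv0 // memv0 => /eqP->.
- by move=> n /asboolP[U [_ <-]]; apply/dimvS/subvf.
move=> /asboolP[U [UE dU]] nmax; exists U => v; apply/idP/asboolP; first exact: UE.
move=> Ev.
have UvE w : w \in (<[v]> + U)%VS -> E w.
  move=> /memv_addP[u /vlineP[a ->] [x xU ->]]; apply: EP => //; exact: UE.
have : (\dim (<[v]> + U) <= \dim U)%N.
  by rewrite dU; apply: nmax; apply/asboolP; exists (<[v]> + U)%VS.
move=> h; have /eqP -> : (U == <[v]> + U)%VS by rewrite eqEdim addvSr h.
by apply/memv_addP; exists v; [exact: memv_line | exists 0; rewrite ?mem0v ?addr0].
Qed.

Definition prop_vspace (k : fieldType) (V : vectType k) (E : V -> Prop)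
  (hE : subspace_prop E) : {vspace V} := sval (cid (subspace_propP hE)).

Lemma mem_prop_vspace (k : fieldType) (V : vectType k) (E : V -> Prop)
  (hE : subspace_prop E) v : (v \in prop_vspace hE) = `[< E v >].
Proof. exact: (svalP (cid (subspace_propP hE))). Qed.

(* A point of P^n is a line in k^(n+1); the linear subspaces of P^n are the
   subspaces of k^(n+1), the zero subspace being the empty one. *)
Record proj_pt (k : fieldType) (n : nat) := ProjPt {
  pline : {vspace 'rV[k]_n.+1};
  pline_dim : \dim pline == 1%N }.

HB.instance Definition _ (k : fieldType) (n : nat) :=
  [isSub for @pline k n].
HB.instance Definition _ (k : fieldType) (n : nat) :=
  [Choice of proj_pt k n by <:].

(* A choice of homogeneous coordinates. It is only used below in conditions that
   do not depend on the choice. *)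
Definition hcoord (k : fieldType) (n : nat) (p : proj_pt k n) : 'rV[k]_n.+1 :=
  vpick (pline p).

Lemma hcoord_neq0 (k : fieldType) (n : nat) (p : proj_pt k n) : hcoord p != 0.
Proof. by rewrite /hcoord vpick0 -dimv_eq0 (eqP (pline_dim p)). Qed.

Definition pdim (k : fieldType) (n : nat) (V : {vspace 'rV[k]_n.+1}) : int :=
  (\dim V)%:Z - 1.

Definition pspan (k : fieldType) (n : nat) (B : {fset proj_pt k n}) :
  {vspace 'rV[k]_n.+1} := (\sum_(p <- B) pline p)%VS.

Definition lin_indep (k : fieldType) (n : nat) (B : {fset proj_pt k n}) : Prop :=
  pdim (pspan B) = #|` B|%:Z - 1.

(* Closed subschemes of P^n correspond bijectively to the saturated homogeneous
   ideals of k[x_0, ..., x_n]; the unit ideal is the empty subscheme. *)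
Record subscheme (k : fieldType) (n : nat) := Subscheme {
  sideal :> {mpoly k[n.+1]} -> Prop;
  sideal0 : sideal 0;
  sidealD : forall f g, sideal f -> sideal g -> sideal (f + g);
  sidealM : forall f g, sideal g -> sideal (f * g);
  sideal_homog : forall t f, sideal f -> sideal (pihomog mdeg t f);
  sideal_sat : forall f,
    (forall i, exists N : nat, sideal ('X_i ^+ N * f)) -> sideal f }.

Lemma sidealP (k : fieldType) (n : nat) (Z : subscheme k n) (a : k) f g :
  Z f -> Z g -> Z (a *: f + g).
Proof. by move=> Zf Zg; apply: sidealD => //; rewrite -mul_mpolyC; apply: sidealM. Qed.

Definition subsch (k : fieldType) (n : nat) (Z1 Z2 : subscheme k n) : Prop :=
  forall f, Z2 f -> Z1 f.

Definition proper_subsch (k : fieldType) (n : nat) (Z1 Z2 : subscheme k n) : Prop :=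
  subsch Z1 Z2 /\ ~ subsch Z2 Z1.

Definition supp (k : fieldType) (n : nat) (Z : subscheme k n) (p : proj_pt k n) : Prop :=
  forall f, Z f -> f.@[hcoord p 0] = 0.

Program Definition sch_union (k : fieldType) (n : nat) (Z1 Z2 : subscheme k n) :
  subscheme k n := @Subscheme k n (fun f => Z1 f /\ Z2 f) _ _ _ _ _.
Next Obligation. by move=> k n Z1 Z2; split; apply: sideal0. Qed.
Next Obligation. by move=> k n Z1 Z2 f g [? ?] [? ?]; split; apply: sidealD. Qed.
Next Obligation. by move=> k n Z1 Z2 f g [? ?]; split; apply: sidealM. Qed.
Next Obligation. by move=> k n Z1 Z2 t f [? ?]; split; apply: sideal_homog. Qed.
Next Obligation.
by move=> k n Z1 Z2 f h; split; apply: sideal_sat => i; have [N []] := h i; exists N.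
Qed.

Lemma pihomogM (k : fieldType) (n e t : nat) (g f : {mpoly k[n]}) :
  g \is e.-homog ->
  pihomog mdeg t (g * f) = if (e <= t)%N then g * pihomog mdeg (t - e) f else 0.
Proof.
move=> hg; set K := mmeasure mdeg f.
have key j : pihomog mdeg t (g * pihomog mdeg j f) =
    if (e + j == t)%N then g * pihomog mdeg j f else 0.
  have hj : g * pihomog mdeg j f \is (e + j).-homog.
    by apply: dhomogM => //; apply: pihomogP.
  by case: eqP => [<-|/eqP ne]; [apply: pihomog_dE | apply: (pihomog_ne0 ne)].
have fE : f = \sum_(j < (maxn K t.+1)) pihomog mdeg j f.
  by apply: pihomog_partitionE; apply: leq_maxl.
rewrite [in LHS]fE mulr_sumr linear_sum /=; under eq_bigr do rewrite key.
case: leqP => [le_et|lt_te]; last first.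
  by rewrite big1 // => j _; case: eqP => // E; have := leq_addr j e; rewrite E leqNgt lt_te.
have lt : (t - e < maxn K t.+1)%N by rewrite leq_max ltnS leq_subr orbT.
rewrite (bigD1 (Ordinal lt)) //= subnKC // eqxx big1 ?addr0 // => j /eqP ne.
by case: eqP => // E; case: ne; apply: val_inj => /=; rewrite -(addKn e j); congr (_ - _)%N.
Qed.

(* The reduced subscheme supported on a finite set of points: its ideal is
   generated by the forms vanishing on the set. *)
Program Definition pts_sch (k : fieldType) (n : nat) (B : {fset proj_pt k n}) :
  subscheme k n :=
  @Subscheme k n (fun f => forall t p, p \in B ->
    (pihomog mdeg t f).@[hcoord p 0] = 0) _ _ _ _ _.
Next Obligation. by move=> k n B t p _; rewrite pihomog0 meval0. Qed.
Next Obligation.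
by move=> k n B f g hf hg t p pB; rewrite pihomogD mevalD hf // hg // addr0.
Qed.
Next Obligation.
move=> k n B f g hg t p pB.
rewrite (pihomog_partitionE (leqnn (mmeasure mdeg f))).
rewrite mulr_suml (linear_sum (pihomog mdeg t)) (raddf_sum (meval _)) big1 // => j _ /=.
rewrite (pihomogM _ _ (pihomogP _ _ _)); case: ifP => _; last by rewrite meval0.
by rewrite mevalM hg // mulr0.
Qed.
Next Obligation.
move=> k n B t f hf t' p pB; have [->|ne] := eqVneq t' t.
  by rewrite pihomog_id hf.
by rewrite (pihomog_ne0 (d := t)) ?meval0 ?pihomogP // eq_sym.
Qed.
Next Obligation.
move=> k n B f h t p pB.
have [i vi] : exists i, hcoord p 0 i != 0.
  apply/existsP; apply: contraT => /existsPn v0; case/eqP: (hcoord_neq0 p).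
  by apply/rowP => i; rewrite mxE; apply/eqP; move: (v0 i); rewrite negbK.
have [N /(_ (N + t)%N p pB)] := h i.
have hX : ('X_i : {mpoly k[n.+1]}) ^+ N \is N.-homog.
  by rewrite -[X in X.-homog]mul1n; apply: dhomogMn; rewrite dhomogX; apply/eqP/mdeg1.
rewrite (pihomogM _ _ hX) leq_addr addKn mevalM rmorphXn /= mevalXU.
by move/eqP; rewrite mulf_eq0 expf_eq0 (negbTE vi) andbF => /eqP.
Qed.

(* A hyperplane contains Z iff its equation lies in the ideal of Z. *)
Lemma lspan_subproof (k : fieldType) (n : nat) (Z : subscheme k n) :
  subspace_prop (fun v : 'rV[k]_n.+1 =>
    forall l : {mpoly k[n.+1]}, l \is 1.-homog -> Z l -> l.@[v 0] = 0).
Proof.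
have monoE (l : {mpoly k[n.+1]}) m : l \is 1.-homog -> m \in msupp l ->
    exists i, forall v : 'rV[k]_n.+1, \prod_j v 0 j ^+ m j = v 0 i.
  move=> hl /(dhomog_mf hl) /eqP; rewrite mdeg_eq1 => /existsP[i /eqP ->].
  exists i => v; rewrite (bigD1 i) //= mnm1E eqxx expr1 big1 ?mulr1 // => j ne.
  by rewrite mnm1E eq_sym (negbTE ne) expr0.
split=> [l hl _|a u v hu hv l hl Zl].
  rewrite mevalE big_seq big1 // => m ml; have [i ->] := monoE l m hl ml.
  by rewrite mxE mulr0.
have -> : l.@[(a *: u + v) 0] = a * l.@[u 0] + l.@[v 0].
  rewrite !mevalE mulr_sumr -big_split /= big_seq [RHS]big_seq.
  apply: eq_bigr => m ml; have [i E] := monoE l m hl ml.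
  by rewrite !E !mxE mulrDr mulrCA.
by rewrite (hu l) // (hv l) // mulr0 addr0.
Qed.

Definition lspan (k : fieldType) (n : nat) (Z : subscheme k n) :
  {vspace 'rV[k]_n.+1} := prop_vspace (lspan_subproof Z).

Lemma homog_part_subproof (k : fieldType) (n : nat) (Z : subscheme k n) (t : nat) :
  subspace_prop (fun f : dhomog n.+1 k t => Z (mpoly_of_dhomog f)).
Proof. by split=> [|a u v]; [apply: sideal0 | apply: sidealP]. Qed.

Definition homog_part (k : fieldType) (n : nat) (Z : subscheme k n) (t : nat) :
  {vspace dhomog n.+1 k t} := prop_vspace (homog_part_subproof Z t).

Definition hilbert (k : fieldType) (n : nat) (Z : subscheme k n) (t : nat) : nat :=
  (\dim (fullv : {vspace dhomog n.+1 k t}) - \dim (homog_part Z t))%N.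

(* Z has dimension zero (or is empty) and degree e iff its Hilbert polynomial is
   the constant e. *)
Definition zero_dim_deg (k : fieldType) (n : nat) (Z : subscheme k n) (e : nat) : Prop :=
  exists t0, forall t, (t0 <= t)%N -> hilbert Z t = e.

(* For v = hcoord p, the vectors w such that f (v + eps w) = 0 over the dual
   numbers for all f in the ideal of Z. By Euler's formula v is one of them when
   p is in Z; the Zariski tangent space of Z at p is the quotient by the line of
   v, so that its dimension is [pdim (tangent Z p)]. *)
Lemma tangent_subproof (k : fieldType) (n : nat) (Z : subscheme k n) (p : proj_pt k n) :
  subspace_prop (fun w : 'rV[k]_n.+1 =>
    forall f : {mpoly k[n.+1]}, Z f -> \sum_i (f^`M(i)).@[hcoord p 0] * w 0 i = 0).
Proof.
split=> [f _|a u v hu hv f Zf].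
  by rewrite big1 // => i _; rewrite mxE mulr0.
under eq_bigr do rewrite !mxE mulrDr mulrCA.
by rewrite big_split /= -mulr_sumr hu // hv // mulr0 addr0.
Qed.

Definition tangent (k : fieldType) (n : nat) (Z : subscheme k n) (p : proj_pt k n) :
  {vspace 'rV[k]_n.+1} := prop_vspace (tangent_subproof Z p).

Definition curvilinear (k : fieldType) (n : nat) (Z : subscheme k n) : Prop :=
  forall p, supp Z p -> (pdim (tangent Z p) <= 1)%R.

(* The Zariski closed subsets of P^n are the supports of its closed subschemes. *)
Definition connected_sch (k : fieldType) (n : nat) (Z : subscheme k n) : Prop :=
  (exists p, supp Z p) /\
  forall Z1 Z2 : subscheme k n,
    (forall p, supp Z p <-> supp Z1 p \/ supp Z2 p) ->
    (forall p, ~ (supp Z1 p /\ supp Z2 p)) ->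
    (forall p, ~ supp Z1 p) \/ (forall p, ~ supp Z2 p).

Definition vdim (m d : nat) : nat := 'C(m + d, m).-1.

(* [basis] and [s2m] enumerate the monomials of degree d; there are
   (vdim m d).+1 of them. *)
Definition vmon (m d : nat) (i : 'I_(vdim m d).+1) : 'X_{1..m.+1} :=
  nth 0%MM [seq s2m t | t : d.-tuple 'I_m.+1 <- enum (basis m.+1 d)] i.

Lemma vdimE m d : (vdim m d).+1 = 'C(d + m, d).
Proof.
rewrite /vdim prednK ?bin_gt0 ?leq_addr // -bin_sub ?leq_addr //.
by rewrite addKn addnC.
Qed.

Lemma vmonP m d (x : 'X_{1..m.+1}) : mdeg x = d -> exists i, vmon (d := d) i = x.
Proof.
move/eqP; rewrite basis_cover => xb.
have lt : (index x [seq s2m t | t : d.-tuple 'I_m.+1 <- enum (basis m.+1 d)]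
           < (vdim m d).+1)%N.
  by rewrite vdimE -(size_basis m d) index_mem.
by exists (Ordinal lt); rewrite /vmon nth_index.
Qed.

Lemma mdeg_vmon m d (i : 'I_(vdim m d).+1) : mdeg (vmon i) = d.
Proof.
by apply/eqP; rewrite basis_cover mem_nth // size_basis -vdimE.
Qed.

Definition ver_vec (k : fieldType) (m d : nat) (v : 'rV[k]_m.+1) :
  'rV[k]_(vdim m d).+1 := \row_i \prod_j v 0 j ^+ vmon i j.

Lemma ver_pt_subproof (k : fieldType) (m d : nat) (p : proj_pt k m) :
  \dim <[ver_vec d (hcoord p)]>%VS == 1%N.
Proof.
rewrite dim_vline eqb1; apply/eqP => /rowP v0.
have [j vj] : exists j, hcoord p 0 j != 0.
  apply/existsP; apply: contraT => /existsPn w0; case/eqP: (hcoord_neq0 p).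
  by apply/rowP => i; rewrite mxE; apply/eqP; move: (w0 i); rewrite negbK.
have [i Ei] := @vmonP m d (U_(j) *+ d)%MM (eq_trans (mdegMn _ _) (eq_trans (congr1 (fun x => (x * d)%N) (mdeg1 j)) (mul1n d))).
move/eqP: (v0 i); rewrite !mxE Ei prodf_seq_eq0 => /hasP[l _] /=.
rewrite mulmnE mnm1E expf_eq0; case: (eqVneq j l) => [<-|]; last by rewrite mul0n.
by rewrite (negbTE vj) andbF.
Qed.

Definition ver_pt (k : fieldType) (m d : nat) (p : proj_pt k m) :
  proj_pt k (vdim m d) := ProjPt (ver_pt_subproof d p).

Definition ver_set (k : fieldType) (m d : nat) (B : {fset proj_pt k m}) :
  {fset proj_pt k (vdim m d)} := [fset ver_pt d p | p in B]%fset.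

Definition ver_pull (k : fieldType) (m d : nat) (F : {mpoly k[(vdim m d).+1]}) :
  {mpoly k[m.+1]} := F \mPo [tuple 'X_[vmon i] | i < (vdim m d).+1].

(* The image of Z under the Veronese embedding: its ideal is generated by the
   forms on P^(vdim m d) whose pull-back lies in the ideal of Z. The definition
   passes through the homogeneous components of F because for d = 0 the pull-back
   does not preserve the grading. *)
Program Definition ver_sch (k : fieldType) (m d : nat) (Z : subscheme k m) :
  subscheme k (vdim m d) :=
  @Subscheme k (vdim m d) (fun F => forall t, Z (ver_pull (pihomog mdeg t F))) _ _ _ _ _.
Next Obligation.
by move=> k m d Z t; rewrite pihomog0 /ver_pull comp_mpoly0; apply: sideal0.
Qed.
Next Obligation.
by move=> k m d Z f g hf hg t; rewrite pihomogD /ver_pull comp_mpolyD; apply: sidealD; [apply: hf | apply: hg].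
Qed.
Next Obligation.
move=> k m d Z f g hg t.
rewrite (pihomog_partitionE (leqnn (mmeasure mdeg f))).
rewrite mulr_suml (linear_sum (pihomog mdeg t)) /ver_pull (raddf_sum (comp_mpoly _)) /=.
apply: (big_ind (fun x => Z x)); first exact: sideal0.
  by move=> x y; apply: sidealD.
move=> j _; rewrite (pihomogM _ _ (pihomogP _ _ _)).
case: ifP => _; last by rewrite comp_mpoly0; apply: sideal0.
by rewrite rmorphM; apply: sidealM; apply: hg.
Qed.
Next Obligation.
move=> k m d Z t f hf t'; have [->|ne] := eqVneq t' t.
  by rewrite pihomog_id; apply: hf.
rewrite (pihomog_ne0 (d := t)) ?pihomogP //; last by rewrite eq_sym.
by rewrite /ver_pull comp_mpoly0; apply: sideal0.
Qed.
Next Obligation.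
move=> k m d Z f h t; apply: sideal_sat => j.
have dj : mdeg (U_(j) *+ d)%MM = d by rewrite mdegMn mdeg1 mul1n.
have [i Ei] := vmonP dj.
have [N hN] := h i; exists (d * N)%N.
have hX : ('X_i : {mpoly k[(vdim m d).+1]}) ^+ N \is N.-homog.
  by rewrite -[X in X.-homog]mul1n; apply: dhomogMn; rewrite dhomogX; apply/eqP/mdeg1.
move: (hN (N + t)%N); rewrite (pihomogM _ _ hX) leq_addr addKn /ver_pull rmorphM rmorphXn /=.
by rewrite comp_mpolyXU -tnth_nth tnth_mktuple Ei -mpolyXn -exprM.
Qed.

Definition decomposes (k : fieldType) (m d : nat) (P : proj_pt k (vdim m d))
  (B : {fset proj_pt k m}) : Prop := (pline P <= pspan (ver_set d B))%VS.

Definition has_rank (k : fieldType) (m d : nat) (P : proj_pt k (vdim m d)) (r : nat) : Prop :=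
  (exists2 B : {fset proj_pt k m}, decomposes P B & #|` B| = r) /\
  (forall B : {fset proj_pt k m}, decomposes P B -> (r <= #|` B|)%N).

(* Membership of B in the set S(P) of decompositions computing the rank of P. *)
Definition rank_decomp (k : fieldType) (m d : nat) (P : proj_pt k (vdim m d))
  (B : {fset proj_pt k m}) : Prop := decomposes P B /\ has_rank P #|` B|.

(* Main.v *)
Require Import Defs.
From mathcomp Require Import all_boot all_order all_algebra.
From mathcomp Require Import finmap boolp.
From mathcomp.multinomials Require Import mpoly.
From mathcomp Require Import zify ring.
From mathcomp Require Import cyclic separable cyclotomic.

Set Implicit Arguments.
Unset Strict Implicit.
Unset Printing Implicit Defensive.

Import GRing.Theory.
Local Open Scope ring_scope.
#[local] Obligation Tactic := idtac.

(** In suitable coordinates A_1 is an arc of length three: its ideal consists of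
    the forms F with F(gamma(t)) = 0 modulo t^3, where
    gamma(t) = e0 + t e1 + t^2 e2 and e0, e1, e2 span the plane of A_1
    ([arc_ideal]). A point of the Veronese space is a functional on the forms of
    degree d; the span of nu_d(A_1) consists of the combinations a F_0 + b F_1 + c F_2
    of the first three coefficients of F(gamma(t)), and the minimality of A forces
    P = a F_0 + b F_1 + c F_2 + sum_(q in S) lam_q F(q) with c and all lam_q nonzero.
    The point P_1 is the arc part of P. It is determined by P because e0, e1, e2 and S are
    linearly independent, so that some form vanishes on A_1 and on all of S but
    one point.

    Upper bound ([arc_upper]). The coefficient of t^2 in F(e0 + t e1 + t^2 e2) is the sum of
    the coefficient of t^2 in F(e0 + t e1) and of that of t in F(e0 + t e2), so
    that the arc part of P is c times a second coefficient on one line plus a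
    first coefficient on another line through e0. Averaging over the roots of unity of order
    d-1 and d writes these as combinations of d-1 and d values of F.

    Lower bounds ([union_lower]). Comparing P with a decomposition B gives an identity
    a F_0 + b F_1 + c F_2 = sum mu_q F(q), where the points q of S with mu_q nonzero are
    those whose coefficient in B is not lam_q. Replacing F by G F, with G a product of g linear
    forms that has order at least two along gamma, leaves a relation of
    degree d-g between the values at e0 and at the remaining q. A relation of degree e
    involves at least e+2 points, and at most 2e+1 points only if they are collinear
    ([nsupp_ge_rel], [form_rel_collinear]). If no point of S occurs, these two
    facts give 2d-1 points ([arc_relation_lower]). If r > 0 points of S
    occur, they give two lines off which too few points remain for a relation, which is
    incompatible with a configuration that spans the plane of A_1 and r more
    points, unless there are at least 2d+2r points in all
    ([arc_relation_with_points]). The second case is too expensive for a minimal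
    decomposition, which therefore contains S with the coefficients lam_q, and
    what remains of it decomposes P_1.

    The normal form of A_1 comes from its coordinate ring in an affine chart. Connectedness
    and finite length leave a single support point ([supp_connected]), the
    linear forms that vanish there are nilpotent ([y_nil]), and the bound on the
    tangent space makes all coordinates polynomials in one element tau, of which exactly
    the powers 1, tau, tau^2 survive ([tangent_param], [curve_param]). *)

(** * Linear forms and relations among points *)

Section LinearForms.
Variables (k : fieldType) (n : nat).
Implicit Types (l : 'cV[k]_n) (u v : 'rV[k]_n) (U : {vspace 'rV[k]_n}).

Definition lval l v : k := (v *m l) 0 0.

Lemma lvalE l v : lval l v = \sum_j v 0 j * l j 0.
Proof. by rewrite /lval mxE. Qed.

Lemma lvalDr l u v : lval l (u + v) = lval l u + lval l v.
Proof. by rewrite /lval mulmxDl mxE. Qed.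

Lemma lvalZr l a v : lval l (a *: v) = a * lval l v.
Proof. by rewrite /lval -scalemxAl mxE. Qed.

Lemma lvalZl l a v : lval (a *: l) v = a * lval l v.
Proof. by rewrite /lval -scalemxAr mxE. Qed.

(** The projection onto a complement of [U] does not kill [v]; one of its
    coordinates, rescaled, is the form. *)
Lemma exists_form_sep U v : v \notin U ->
  exists l, (forall u, u \in U -> lval l u = 0) /\ lval l v = 1.
Proof.
move=> vU.
pose A := lin1_mx (projv U).
have AE u : u *m A = projv U u by rewrite mul_rV_lin1.
have [j nz] : exists j, (v - v *m A) 0 j != 0.
  apply/existsP; apply: contraT => /existsPn h; case/negP: vU.
  have -> : v = v *m A.
    apply/eqP; rewrite -subr_eq0; apply/eqP/rowP => j; rewrite [RHS]mxE.
    by apply/eqP; move: (h j); rewrite negbK.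
  by rewrite AE memv_proj.
have key u : lval (((v - v *m A) 0 j)^-1 *: col j (1%:M - A)) u =
     ((v - v *m A) 0 j)^-1 * (u - u *m A) 0 j.
  rewrite lvalZl; congr (_ * _); rewrite /lval colE mulmxA -colE mxE.
  by rewrite mulmxBr mulmx1.
exists (((v - v *m A) 0 j)^-1 *: col j (1%:M - A)); split=> [u uU|].
  by rewrite key (AE u) projv_id // subrr [X in _ * X]mxE mulr0.
by rewrite key mulVf.
Qed.

End LinearForms.

Section Weights.
Variables (k : fieldType) (m : nat).
Local Notation pt := (proj_pt k m).
Implicit Types (X : seq pt) (mu : pt -> k) (l : 'cV[k]_m.+1) (q : pt).

Definition pval l q : k := lval l (hcoord q).

Lemma plineE q : pline q = <[hcoord q]>%VS.
Proof.
apply/esym/eqP; rewrite eqEdim -memvE memv_pick dim_vline hcoord_neq0.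
by rewrite (eqP (pline_dim q)).
Qed.

Lemma mem_pline q (U : {vspace 'rV[k]_m.+1}) : (pline q <= U)%VS = (hcoord q \in U).
Proof. by rewrite plineE memvE. Qed.

Lemma hcoord_inj q q' : hcoord q' \in <[hcoord q]>%VS -> q' = q.
Proof.
rewrite memvE => h; apply/val_inj => /=; rewrite !plineE; apply/eqP.
by rewrite eqEdim h !dim_vline !hcoord_neq0.
Qed.

Lemma exists_form_pt q q' : q' != q -> exists l, pval l q = 0 /\ pval l q' = 1.
Proof.
move=> ne; have [|l [l0 l1]] := @exists_form_sep k _ <[hcoord q]>%VS (hcoord q').
  by apply: contra ne => /hcoord_inj ->.
by exists l; split; [apply/l0/memv_line | exact: l1].
Qed.

Lemma exists_form_nz q : exists l, pval l q = 1.
Proof.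
have [|l [_ l1]] := @exists_form_sep k _ 0%VS (hcoord q).
  by rewrite memv0 hcoord_neq0.
by exists l.
Qed.

(** Forms of degree [e] are combinations of products of [e] linear forms, so this
    says that sum mu_q F(q) = 0 for every form F of degree [e]. The list [X] stays
    fixed and only the support of the weights [mu] changes. *)
Definition form_rel X e mu := forall ls : seq 'cV[k]_m.+1, size ls = e ->
  \sum_(q <- X) mu q * \prod_(l <- ls) pval l q = 0.

Definition nsupp X mu := count (fun q => mu q != 0) X.

Definition mul_form mu l q : k := mu q * pval l q.
Definition killed mu l q := (mu q != 0) && (pval l q == 0).

Lemma form_rel_mul X e mu l : form_rel X e.+1 mu -> form_rel X e (mul_form mu l).
Proof.
move=> h ls sz; rewrite -[RHS](h (l :: ls)) /= ?sz //.
by apply: eq_bigr => q _; rewrite /mul_form big_cons mulrA.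
Qed.

Lemma nsupp_mul X mu l :
  (nsupp X (mul_form mu l) +
   count (killed mu l) X)%N = nsupp X mu.
Proof.
rewrite addnC; apply/esym; rewrite /nsupp.
elim: X => //= q X ->; rewrite /killed /mul_form mulf_eq0 negb_or.
by case: (mu q == 0); case: (pval l q == 0) => /=; lia.
Qed.

Lemma count_sub (T : eqType) (a : pred T) (s X : seq T) :
  uniq s -> (forall x, x \in s -> x \in X /\ a x) -> (size s <= count a X)%N.
Proof.
move=> us h; rewrite -size_filter; apply: uniq_leq_size => // q /h[qX aq].
by rewrite mem_filter aq.
Qed.

Lemma nsupp_ge X mu s : uniq s ->
  (forall q, q \in s -> q \in X /\ mu q != 0) -> (size s <= nsupp X mu)%N.
Proof. exact: count_sub. Qed.

(** A form through one support point [q1] and not through [q0] divides the relation: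
    the degree drops by one and at least one point disappears. *)
Lemma nsupp_ge_rel X e mu q0 : uniq X -> form_rel X e mu -> q0 \in X -> mu q0 != 0 ->
  (e + 2 <= nsupp X mu)%N.
Proof.
move=> uX; elim: e mu => [|e IH] mu h q0X nz.
  have [q1 q1X /andP[ne nz1]] : exists2 q1, q1 \in X & (q1 != q0) && (mu q1 != 0).
    apply/hasP; apply: contraT => /hasPn hn; case/eqP: nz.
    have := h [::] erefl; rewrite (bigD1_seq q0) //= big_nil mulr1 big_seq_cond big1 ?addr0 //.
    move=> q /andP[qX ne]; move: (hn q qX); rewrite ne negbK => /eqP ->.
    by rewrite mul0r.
  apply: (@nsupp_ge X mu [:: q0; q1]) => /=.
    by rewrite inE eq_sym ne.
  by move=> q; rewrite !inE => /orP[] /eqP ->.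
have [/hasP[q1 q1X /andP[ne nz1]]|/hasPn hn] :=
    boolP (has (fun q1 => (q1 != q0) && (mu q1 != 0)) X).
  rewrite eq_sym in ne; have [l [l1 l0]] := exists_form_pt ne.
  have nz' : mul_form mu l q0 != 0 by rewrite /mul_form l0 mulr1.
  have := IH _ (form_rel_mul l h) q0X nz'.
  rewrite -(nsupp_mul X mu l).
  have : (0 < count (killed mu l) X)%N.
    by rewrite -has_count; apply/hasP; exists q1; rewrite /killed ?nz1 ?l1 ?eqxx.
  lia.
have [l l0] := exists_form_nz q0.
have nz' : mul_form mu l q0 != 0 by rewrite /mul_form l0 mulr1.
have ge2 := IH _ (form_rel_mul l h) q0X nz'.
have : (nsupp X (mul_form mu l) <= 1)%N.
  apply: (@leq_trans (count_mem q0 X)); last by rewrite count_uniq_mem //; case: (_ \in _).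
  rewrite /nsupp -!size_filter; apply: uniq_leq_size; rewrite ?filter_uniq // => q.
  rewrite !mem_filter /mul_form mulf_eq0 negb_or => /andP[/andP[nq _] qX]; rewrite qX andbT.
  by move: (hn q qX); rewrite nq andbT negbK.
lia.
Qed.

End Weights.

(** [lia] identifies atoms syntactically; instances inferred along different paths
    make equal terms look different, so they are abstracted up to conversion first.
    The rest of the context is cleared because its preprocessing is slow. *)
Ltac nat_lia :=
  repeat match goal with H : is_true (leq _ _) |- _ => revert H
    | H : @eq nat _ _ |- _ => revert H end;
  repeat match goal with
  | |- context [dimv ?A] => let x := fresh "x" in set x := (dimv A); clearbody x
  | |- context [nsupp ?A ?B] => let x := fresh "x" in set x := (nsupp A B); clearbody x
  | |- context [count ?A ?B] => let x := fresh "x" in set x := (count A B); clearbody x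
  | |- context [size ?A] => let x := fresh "x" in set x := (size A); clearbody x
  end; clear; lia.

Section Lines.
Variables (k : fieldType) (m : nat).
Local Notation pt := (proj_pt k m).
Implicit Types (X : seq pt) (mu : pt -> k) (l : 'cV[k]_m.+1) (q : pt).

Definition span_pts (s : seq pt) : {vspace 'rV[k]_m.+1} := (\sum_(q <- s) pline q)%VS.

Lemma dim_span_pts s : (\dim (span_pts s) <= size s)%N.
Proof.
rewrite /span_pts; elim: s => [|q s IH]; first by rewrite big_nil dimv0.
rewrite big_cons (leq_trans (dimv_add_leqif _ _)) // (eqP (pline_dim q)).
exact: IH.
Qed.

Lemma mem_span_pts s q : q \in s -> hcoord q \in span_pts s.
Proof.
move=> qs; rewrite -mem_pline /span_pts (big_rem q) //=; exact: addvSl.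
Qed.

(** A form through two support points that misses a third leaves a relation
    of degree [e] with at most [2 * e + 1] points, hence by induction a line with
    [e + 2] of them. A form through this line that misses a further point would then
    leave fewer than [e + 2] points. *)
Lemma form_rel_collinear X e mu : uniq X -> form_rel X e mu -> (nsupp X mu <= 2 * e + 1)%N ->
  exists2 L : {vspace 'rV[k]_m.+1}, (\dim L <= 2)%N &
    forall q, q \in X -> mu q != 0 -> hcoord q \in L.
Proof.
move=> uX; elim: e mu => [|e IH] mu h le.
  exists 0%VS; rewrite ?dimv0 // => q qX nz.
  by have := nsupp_ge_rel uX h qX nz; nat_lia.
have split (U : {vspace 'rV[k]_m.+1}) :
   (forall q, q \in X -> mu q != 0 -> hcoord q \in U) \/
   exists2 q, q \in X & (mu q != 0) && (hcoord q \notin U).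
  have [/hasP|/hasPn hn] := boolP (has (fun q => (mu q != 0) && (hcoord q \notin U)) X).
    by right.
  by left=> q qX nz; move: (hn q qX); rewrite nz negbK.
have [[q1 [q1X nz1]]|hno] := pselect (exists q, q \in X /\ mu q != 0); last first.
  by exists 0%VS; rewrite ?dimv0 // => q qX nz; case: hno; exists q.
have [hU|[q2 q2X /andP[nz2 q2U]]] := split <[hcoord q1]>%VS.
  by exists <[hcoord q1]>%VS; rewrite ?dim_vline ?hcoord_neq0.
have [hU|[q3 q3X /andP[nz3 q3U]]] := split (span_pts [:: q1; q2]).
  by exists (span_pts [:: q1; q2]); rewrite ?(dim_span_pts [:: q1; q2]).
have [l [lU l3]] := exists_form_sep q3U.
have r1 := form_rel_mul l h.
have c1 := nsupp_mul X mu l.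
have k1 : (2 <= count (killed mu l) X)%N.
  apply: (@count_sub _ _ [:: q1; q2]) => [|q].
    by rewrite /= inE andbT; apply: contra q2U => /eqP ->; apply: memv_line.
  rewrite !inE => /orP[] /eqP ->; rewrite /killed /pval lU ?eqxx ?nz1 ?nz2 //;
    by apply: mem_span_pts; rewrite !inE eqxx ?orbT.
have nz3' : mul_form mu l q3 != 0 by rewrite /mul_form /pval l3 mulr1.
have [|L dL LP] := IH _ r1; first by nat_lia.
have m1 := nsupp_ge_rel uX r1 q3X nz3'.
have [hU|[q4 q4X /andP[nz4 q4U]]] := split L; first by exists L.
have [l' [lU' l4]] := exists_form_sep q4U.
have r2 := form_rel_mul l' h.
have c2 := nsupp_mul X mu l'.
have m2 : (e + 2 <= nsupp X (mul_form mu l'))%N.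
  by apply: (nsupp_ge_rel uX r2 q4X); rewrite /mul_form /pval l4 mulr1.
have : (nsupp X (mul_form mu l) <=
    count (killed mu l') X)%N.
  rewrite /nsupp -size_filter; apply: count_sub; first exact: filter_uniq.
  move=> q; rewrite mem_filter => /andP[nq qX]; split=> //.
  rewrite /killed /pval lU' ?eqxx ?andbT; last exact: LP.
  by apply: contra nq => /eqP nq0; rewrite /mul_form nq0 mul0r.
nat_lia.
Qed.

(** Support points outside the span of those already chosen are added one at a time;
    the last one serves to keep the form nonzero on the support. *)
Lemma exists_killing_form X mu r : uniq X ->
  (forall U : {vspace 'rV[k]_m.+1}, (\dim U <= r)%N ->
     exists2 q, q \in X & (mu q != 0) && (hcoord q \notin U)) ->
  exists l, (exists2 q, q \in X & mul_form mu l q != 0) /\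
    (nsupp X (mul_form mu l) + r <= nsupp X mu)%N.
Proof.
move=> uX h.
have [s [us sz sP]] : exists s : seq pt, [/\ uniq s, size s = r &
    forall q, q \in s -> q \in X /\ mu q != 0].
  suff ind : forall j, (j <= r)%N -> exists s : seq pt, [/\ uniq s, size s = j &
    forall q, q \in s -> q \in X /\ mu q != 0] by exact: (ind r (leqnn r)).
  elim=> [|j IH] lj; first by exists [::].
  have [s [us sz sP]] := IH (ltnW lj).
  have [|q qX /andP[nq qU]] := h (span_pts s).
    by rewrite (leq_trans (dim_span_pts s)) // sz ltnW.
  exists (q :: s); split=> [||q'] /=; rewrite ?sz ?us ?andbT //.
    by apply: contra qU; apply: mem_span_pts.
  by rewrite inE => /orP[/eqP ->|/sP].
have [|q qX /andP[nq qU]] := h (span_pts s).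
  by rewrite (leq_trans (dim_span_pts s)) // sz.
have [l [lU lq]] := exists_form_sep qU.
exists l; split; first by exists q; rewrite // /mul_form /pval lq mulr1.
rewrite -[X in (_ <= X)%N](nsupp_mul X mu l) leq_add2l -sz.
apply: count_sub => // q' q's; have [q'X nq'] := sP _ q's; split=> //.
by rewrite /killed nq' /pval lU ?eqxx // mem_span_pts.
Qed.

End Lines.

(** * Relations between an arc and points *)

Section Arc.
Variables (k : fieldType) (m : nat) (e0 e1 e2 : 'rV[k]_m.+1).
Implicit Types (l : 'cV[k]_m.+1).

(** The value of the linear form along the arc e0 + t e1 + t^2 e2. *)
Definition arc_lin l : {poly k} :=
  (lval l e0)%:P + (lval l e1)%:P * 'X + (lval l e2)%:P * 'X^2.

Lemma arc_lin0 l : (arc_lin l)`_0 = lval l e0.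
Proof. by rewrite /arc_lin !coefE /= !mulr0 !addr0. Qed.

Lemma arc_lin1 l : (arc_lin l)`_1 = lval l e1.
Proof. by rewrite /arc_lin !coefE /= !mulr0 !addr0 mulr1 add0r. Qed.

Lemma arc_lin2 l : (arc_lin l)`_2 = lval l e2.
Proof. by rewrite /arc_lin !coefE /= !mulr0 !add0r mulr1. Qed.

Definition arc_prod (gs : seq 'cV[k]_m.+1) : {poly k} := \prod_(g <- gs) arc_lin g.

End Arc.

Lemma coefM1 (k : fieldType) (p q : {poly k}) :
  (p * q)`_1 = p`_0 * q`_1 + p`_1 * q`_0.
Proof. by rewrite coefM !big_ord_recl big_ord0 addr0. Qed.

Lemma coefM2 (k : fieldType) (p q : {poly k}) :
  (p * q)`_2 = p`_0 * q`_2 + p`_1 * q`_1 + p`_2 * q`_0.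
Proof. by rewrite coefM !big_ord_recl big_ord0 addr0 addrA. Qed.

Section LowerBound.
Variables (k : fieldType) (m d : nat) (e0 e1 e2 : 'rV[k]_m.+1).
Local Notation pt := (proj_pt k m).
Local Notation vsp := {vspace 'rV[k]_m.+1}.
Variables (X : seq pt) (mu : pt -> k) (p0 : pt) (a b c : k).
Hypotheses (uX : uniq X) (p0X : p0 \in X) (hp0 : hcoord p0 = e0) (c_neq0 : c != 0).
Local Notation arcP := (arc_prod e0 e1 e2).
Hypothesis hJ : forall ls, size ls = d ->
  a * (arcP ls)`_0 + b * (arcP ls)`_1 + c * (arcP ls)`_2 =
  \sum_(q <- X) mu q * \prod_(l <- ls) pval l q.

(** The weights of the relation that results from hJ when every form is multiplied
    by the product G of [gs]. If G has order at least two along the arc, the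
    functional a F_0 + b F_1 + c F_2 becomes c G_2 F(e0), a weight at the point [p0]. *)
Definition residual gs q : k :=
  mu q * \prod_(g <- gs) pval g q - (q == p0)%:R * (c * (arcP gs)`_2).

Lemma arcP0 ls : (arcP ls)`_0 = \prod_(l <- ls) pval l p0.
Proof.
rewrite /arc_prod; elim: ls => [|l ls IH]; first by rewrite !big_nil coefC.
by rewrite !big_cons coef0M IH arc_lin0 /pval hp0.
Qed.

Lemma residual_p0 gs : (arcP gs)`_0 = 0 -> residual gs p0 = - (c * (arcP gs)`_2).
Proof. by rewrite arcP0 /residual => ->; rewrite mulr0 add0r eqxx mul1r. Qed.

Lemma residual_ne gs q : q != p0 -> residual gs q = mu q * \prod_(g <- gs) pval g q.
Proof. by rewrite /residual => /negbTE ->; rewrite mul0r subr0. Qed.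

Lemma support_other nu : (2 <= nsupp X nu)%N ->
  exists2 q, q \in X & (q != p0) && (nu q != 0).
Proof.
move=> w2; apply/hasP; apply: contraT => /hasPn hn.
have : (nsupp X nu <= 1)%N; last by rewrite leqNgt w2.
apply: (@leq_trans (count_mem p0 X)); last by rewrite count_uniq_mem // p0X.
rewrite /nsupp -!size_filter; apply: uniq_leq_size; rewrite ?filter_uniq // => q.
rewrite !mem_filter => /andP[nz qX]; rewrite qX andbT /=.
by move: (hn q qX); rewrite nz andbT negbK.
Qed.

(** If q_0 and q_1 vanish, the second coefficient of q r is q_2 r_0: only
    the value at e0 of the second factor matters. *)
Lemma residual_rel gs : (size gs <= d)%N -> (arcP gs)`_0 = 0 -> (arcP gs)`_1 = 0 ->
  form_rel X (d - size gs) (residual gs).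
Proof.
move=> le g0 g1 ls sz.
have szd : size (gs ++ ls) = d by rewrite size_cat sz subnKC.
have := hJ szd; rewrite /arc_prod !big_cat /= -![\prod_(i <- _) arc_lin _ _ _ i]/(arcP _).
rewrite coef0M coefM1 coefM2 g0 g1 !mul0r !addr0 !mulr0 !add0r arcP0 => E.
under eq_bigr do rewrite mulrBl.
rewrite sumrB; under eq_bigr do rewrite -mulrA -big_cat /=.
rewrite -E (bigD1_seq p0) //= eqxx mul1r [X in _ - (_ + X)]big1; last first.
  by move=> q /negbTE ->; rewrite !mul0r.
by rewrite addr0 mulrA subrr.
Qed.

Definition in_config q := (q == p0) || (mu q != 0).

Lemma residual_in_config gs q : residual gs q != 0 -> in_config q.
Proof.
apply: contraR; rewrite negb_or negbK => /andP[ne /eqP m0].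
by rewrite residual_ne // m0 mul0r.
Qed.

(** The point [p0] is the only one that may survive on the zero set of the product:
    its weight there comes from the arc and not from [mu]. *)
Lemma nsupp_residual gs (pr : pred pt) :
  (forall q, q \in X -> q != p0 -> pr q -> residual gs q = 0) ->
  (nsupp X (residual gs) + count [pred q | in_config q && pr q] X <=
     count in_config X + (pr p0 && (residual gs p0 != 0)%R))%N.
Proof.
move=> h; rewrite addnC.
have -> : count in_config X = (count [pred q | in_config q && pr q] X + count [pred q | in_config q && ~~ pr q] X)%N.
  by elim: X => //= q s ->; case: (in_config q); case: (pr q) => /=; lia.
rewrite -addnA leq_add2l /nsupp.
apply: (@leq_trans (count [pred q | in_config q && ~~ pr q] X +
   count [pred q | (q == p0) && (pr p0 && (residual gs p0 != 0)%R)] X)%N).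
  rewrite -count_predUI -[X in (X <= _)%N]addn0 leq_add //.
  rewrite -!size_filter; apply: uniq_leq_size; first exact: filter_uniq.
  move=> q; rewrite !mem_filter => /andP[nz qX]; rewrite qX andbT /= (residual_in_config nz) /=.
  case: (boolP (pr q)) => //= pq; case: (eqVneq q p0) => [E|ne].
    by move: nz pq; rewrite E => -> ->.
  by move: nz; rewrite (h q) ?eqxx.
rewrite leq_add2l; case: (pr p0 && _) => /=; last first.
  by rewrite (eq_count (a2 := pred0)) ?count_pred0 // => q /=; rewrite andbF.
rewrite (eq_count (a2 := pred1 p0)); last by move=> q /=; rewrite andbT.
by rewrite count_uniq_mem // p0X.
Qed.

Lemma residual_killed gs g (M : vsp) q : g \in gs -> (forall u, u \in M -> lval g u = 0) ->
  q != p0 -> hcoord q \in M -> residual gs q = 0.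
Proof.
move=> gin gM ne qM; rewrite residual_ne // (big_rem g) //= /pval gM // mul0r mulr0 //.
Qed.

Definition npts (M : vsp) : nat := count [pred q | in_config q && (hcoord q \in M)] X.

Lemma nsupp_residual_sub gs g (M : vsp) : g \in gs -> (forall u, u \in M -> lval g u = 0) ->
  (nsupp X (residual gs) + npts M <=
     count in_config X + ((e0 \in M) && (residual gs p0 != 0)%R))%N.
Proof.
move=> gin gM; rewrite -hp0; apply: (@nsupp_residual gs (fun q => hcoord q \in M)) => q _.
exact: (residual_killed gin gM).
Qed.

Lemma residual_collinear gs : (size gs <= d)%N -> (arcP gs)`_0 = 0 -> (arcP gs)`_1 = 0 ->
  (exists2 q, q \in X & residual gs q != 0) ->
  (nsupp X (residual gs) <= 2 * (d - size gs) + 1)%N ->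
  exists L : vsp, [/\ (\dim L <= 2)%N,
    forall q, q \in X -> residual gs q != 0 -> hcoord q \in L &
    (d - size gs + 2 <= nsupp X (residual gs))%N].
Proof.
move=> le g0 g1 [q qX nz] wle; have r := residual_rel le g0 g1.
have [L dL LP] := form_rel_collinear uX r wle.
by exists L; split=> //; apply: (nsupp_ge_rel uX r qX nz).
Qed.

Lemma nsupp_residual_le gs (L : vsp) : (forall q, q \in X -> residual gs q != 0 -> hcoord q \in L) ->
  (nsupp X (residual gs) <= npts L)%N.
Proof.
move=> h; rewrite /nsupp -size_filter; apply: count_sub; first exact: filter_uniq.
move=> q; rewrite mem_filter => /andP[nz qX]; split=> //.
by rewrite /= (residual_in_config nz) h.
Qed.

Local Notation W := (<[e0]> + <[e1]> + <[e2]>)%VS.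
Local Notation t01 := (<[e0]> + <[e1]>)%VS.

Lemma arcP_cons g gs i : (arcP (g :: gs))`_i = (arc_lin e0 e1 e2 g * arcP gs)`_i.
Proof. by rewrite /arc_prod big_cons. Qed.

Lemma arcP_nil i : (arcP [::])`_i = (i == 0%N)%:R.
Proof. by rewrite /arc_prod big_nil coef1. Qed.

Definition arcP_coefE := (arcP_cons, coef0M, coefM1, coefM2, arcP_nil, arc_lin0, arc_lin1, arc_lin2).

Lemma mem_t01_0 : e0 \in t01.
Proof. by rewrite memvE addvSl. Qed.
Lemma mem_t01_1 : e1 \in t01.
Proof. by rewrite memvE addvSr. Qed.

Lemma line_sub (L : vsp) u v : (\dim L <= 2)%N -> u != 0 -> v \notin <[u]>%VS ->
  u \in L -> v \in L -> (L <= <[u]> + <[v]>)%VS.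
Proof.
move=> dL u0 vu uL vL.
have sub : (<[u]> + <[v]> <= L)%VS by rewrite subv_add -!memvE uL.
suff /eqP <- : (<[u]> + <[v]>)%VS == L by [].
rewrite eqEdim sub /= (leq_trans dL) //.
rewrite dimv_disjoint_sum ?dim_vline ?u0; last first.
  apply/eqP; rewrite -subv0; apply/subvP => w /memv_capP[wu /vlineP[x E]].
  rewrite memv0 E; case: (eqVneq x 0) => [->|x0]; first by rewrite scale0r.
  case/negP: vu; have -> : v = x^-1 *: w by rewrite E scalerA mulVf ?scale1r.
  exact: memvZ.
by case: (eqVneq v 0) vu => // ->; rewrite mem0v.
Qed.

Ltac count_lia :=
  repeat match goal with H : is_true (leq _ _) |- _ => revert H end;
  repeat match goal with
  | |- context [npts ?A] => let x := fresh "x" in set x := (npts A); clearbody x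
  end; nat_lia.

Definition heavy (n : nat) (M : vsp) :=
  (n <= npts M)%N.

Section Free.
Hypothesis (e1_free : e1 \notin <[e0]>%VS) (e2_free : e2 \notin t01).

Lemma e0_neq0 : e0 != 0.
Proof. by rewrite -hp0 hcoord_neq0. Qed.

Lemma tangent_line_sub (L : vsp) : (\dim L <= 2)%N -> e0 \in L -> e1 \in L -> (L <= t01)%VS.
Proof. by move=> dL; apply: line_sub => //; apply: e0_neq0. Qed.

Lemma exists_form_tangent : exists l, [/\ lval l e0 = 0 & lval l e1 = 1].
Proof.
by have [l [l0 l1]] := exists_form_sep e1_free; exists l; rewrite l0 ?memv_line.
Qed.

Lemma exists_form_second : exists l, [/\ forall u, u \in t01 -> lval l u = 0, lval l e0 = 0, lval l e1 = 0 & lval l e2 = 1].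
Proof.
have [l [l0 l1]] := exists_form_sep e2_free; exists l.
by split=> //; apply: l0; [exact: mem_t01_0 | exact: mem_t01_1].
Qed.

(** A form of order two along the arc leaves [e0] and at most [2 * d - 2] more points
    in degree [d - 1]: they lie on a line L through [e0], at least [d + 1] of
    them. L is not the tangent line, so a form through L has order one, and together with
    a second form of order one it leaves [e0] in degree [d - 2]: at least [d - 1] points
    lie off L. *)
Lemma arc_relation_lower : (3 <= d)%N -> (2 * d <= count in_config X)%N.
Proof.
move=> d3; rewrite leqNgt; apply/negP => lt.
have [l1 [l1t l10 l11 l12]] := exists_form_second.
have [lT [lT0 lT1]] := exists_form_tangent.
have r0 : residual [:: l1] p0 != 0.
  by rewrite residual_p0 !arcP_coefE ?l10 ?l11 ?l12 !(mul0r, mulr0, addr0, add0r, mulr1) // oppr_eq0.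
have wle : (nsupp X (residual [:: l1]) <= count in_config X)%N.
  rewrite /nsupp -!size_filter; apply: uniq_leq_size; rewrite ?filter_uniq // => q.
  by rewrite !mem_filter => /andP[nz ->]; rewrite (residual_in_config nz).
have [L [dL LP wge]] : exists L : vsp, [/\ (\dim L <= 2)%N,
    forall q, q \in X -> residual [:: l1] q != 0 -> hcoord q \in L &
    (d - 1 + 2 <= nsupp X (residual [:: l1]))%N].
  by apply: residual_collinear => /=; [lia | rewrite !arcP_coefE l10 mul0r |
    rewrite !arcP_coefE l10 l11 !mul0r addr0 | exists p0 | lia].
have e0L : e0 \in L by rewrite -hp0 LP.
have [q qX /andP[qp nz]] := support_other (leq_trans (leq_addl _ 2) wge).
have e1L : e1 \notin L.
  apply/negP => e1L; move: (nz); apply/negP; rewrite negbK; apply/eqP.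
  rewrite residual_ne // big_seq1 /pval l1t ?mulr0 //.
  exact: (subvP (tangent_line_sub dL e0L e1L)) (LP q qX nz).
have [l [lL l1']] := exists_form_sep e1L.
have l0' := lL _ e0L.
have r0' : residual [:: l; lT] p0 != 0.
  by rewrite residual_p0 !arcP_coefE ?l0' ?l1' ?lT0 ?lT1 !(mul0r, mulr0, addr0, add0r, mulr1) // oppr_eq0.
have rr : form_rel X (d - 2) (residual [:: l; lT]).
  by apply: (@residual_rel [:: l; lT]); [exact: ltnW | rewrite !arcP_coefE l0' mul0r |
    rewrite !arcP_coefE l0' lT0 !(mul0r, mulr0, addr0)].
have w2 := nsupp_ge_rel uX rr p0X r0'.
have := @nsupp_residual_sub [:: l; lT] l L; rewrite inE eqxx => /(_ isT lL).
have := nsupp_residual_le LP; case: (_ && _); count_lia.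
Qed.

Definition arc_ring := (mul0r, mulr0, addr0, add0r, mulr1, mul1r).

Lemma heavy_line_of_residual gs : (size gs <= 3)%N -> (3 <= d)%N -> (arcP gs)`_0 = 0 -> (arcP gs)`_1 = 0 ->
  (exists2 q, q \in X & residual gs q != 0) ->
  (nsupp X (residual gs) <= 2 * (d - size gs) + 1)%N ->
  exists2 L : vsp, (\dim L <= 2)%N & heavy (d - 1) L.
Proof.
move=> s3 d3 g0 g1 ex wle.
have [|L [dL LP wge]] := residual_collinear _ g0 g1 ex wle; first by lia.
by exists L => //; have := nsupp_residual_le LP; rewrite /heavy; count_lia.
Qed.

(** A form through [M] is completed by at most two forms of order one at [e0] to a
    product of order at least two. The number of these factors is two only if [e0] is not in [M],
    and then all the points of [M] disappear; this makes the count sharp. *)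
Lemma line_of_heavy s (M : vsp) : (2 * s + 5 <= d)%N ->
  (count in_config X <= 2 * d + 2 * s)%N -> heavy d M ->
  ~ (W <= M)%VS \/ (exists2 q, q \in X & (mu q != 0) && (hcoord q \notin M)) ->
  exists2 L : vsp, (\dim L <= 2)%N & heavy (d - 1) L.
Proof.
move=> ds cle hM hW; rewrite /heavy in hM.
have [lT [lT0 lT1]] := exists_form_tangent.
have d3 : (3 <= d)%N by lia.
have [e0M|e0M] := boolP (e0 \in M); last first.
  have [l [lM l0]] := exists_form_sep e0M.
  apply: (@heavy_line_of_residual [:: l; lT; lT]) => //; rewrite ?arcP_coefE ?lT0 ?arc_ring //.
    by exists p0; rewrite // residual_p0 ?arcP_coefE ?lT0 ?lT1 ?l0 ?arc_ring // oppr_eq0.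
  have := @nsupp_residual_sub [:: l; lT; lT] l M; rewrite inE eqxx (negbTE e0M) => /(_ isT lM) /=; count_lia.
have [e1M|e1M] := boolP (e1 \in M); last first.
  have [l [lM l1]] := exists_form_sep e1M.
  have l0 := lM _ e0M.
  apply: (@heavy_line_of_residual [:: l; lT]) => //; rewrite ?arcP_coefE ?lT0 ?l0 ?arc_ring //.
    by exists p0; rewrite // residual_p0 ?arcP_coefE ?lT0 ?lT1 ?l0 ?l1 ?arc_ring // oppr_eq0.
  have := @nsupp_residual_sub [:: l; lT] l M; rewrite inE eqxx => /(_ isT lM) /=.
  by case: (_ && _); count_lia.
have ord1 l : (forall u, u \in M -> lval l u = 0) ->
    (exists2 q, q \in X & residual [:: l] q != 0) ->
    exists2 L : vsp, (\dim L <= 2)%N & heavy (d - 1) L.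
  move=> lM ex; have l0 := lM _ e0M; have l1 := lM _ e1M.
  apply: (@heavy_line_of_residual [:: l]) => //; rewrite ?arcP_coefE ?l0 ?l1 ?arc_ring //.
  have := @nsupp_residual_sub [:: l] l M; rewrite inE eqxx => /(_ isT lM) /=.
  by case: (_ && _); count_lia.
have [e2M|e2M] := boolP (e2 \in M); last first.
  have [l [lM l2]] := exists_form_sep e2M.
  have l0 := lM _ e0M; have l1 := lM _ e1M.
  apply: (ord1 l) => //; exists p0 => //.
  by rewrite residual_p0 ?arcP_coefE ?l0 ?l1 ?l2 ?arc_ring // oppr_eq0.
case: hW => [[]|[q qX /andP[nq qM]]]; first by rewrite !subv_add -!memvE e0M e1M.
have [l [lM lq]] := exists_form_sep qM.
apply: (ord1 l) => //; exists q => //.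
rewrite residual_ne ?big_seq1 /pval ?lq ?mulr1 //.
by apply: contra qM => /eqP ->; rewrite hp0.
Qed.

End Free.

Section WithPoints.
Variable (S : seq pt).
Hypothesis (hI : \dim (W + span_pts S) = (3 + size S)%N).

Lemma dim_t01 : (\dim t01 <= 2)%N.
Proof.
rewrite (leq_trans (dimv_add_leqif _ _)) // !dim_vline.
by case: (_ != 0); case: (_ != 0).
Qed.

Lemma e2_notin_span : e2 \notin (t01 + span_pts S)%VS.
Proof.
apply/negP => h.
have : (W + span_pts S <= t01 + span_pts S)%VS.
  rewrite !subv_add addvSr (subv_trans (addvSl <[e0]> <[e1]>) (addvSl _ _)).
  by rewrite (subv_trans (addvSr <[e0]> <[e1]>) (addvSl _ _)) -memvE h.
move/dimvS; rewrite hI => h'; have h1 : (\dim (t01 + span_pts S) <= _)%N := dimv_add_leqif _ _.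
by have := dim_t01; have := dim_span_pts S; count_lia.
Qed.

Lemma e2_notin_tangent : e2 \notin t01.
Proof. by apply: contra e2_notin_span => /(subvP (addvSl _ _)). Qed.

Lemma e1_notin_line : e1 \notin <[e0]>%VS.
Proof.
apply/negP => h.
have : (W + span_pts S <= <[e0]> + <[e2]> + span_pts S)%VS.
  rewrite !subv_add addvSr (subv_trans (addvSl <[e0]> <[e2]>) (addvSl _ _)).
  rewrite (subv_trans _ (subv_trans (addvSl <[e0]> <[e2]>) (addvSl _ _))) -?memvE //.
  by rewrite (subvP (addvSl _ (span_pts S))) // memvE addvSr.
move/dimvS; rewrite hI => h'.
have h1 : (\dim (<[e0]> + <[e2]> + span_pts S) <= _)%N := dimv_add_leqif _ _.
have h2 : (\dim (<[e0]> + <[e2]>) <= _)%N := dimv_add_leqif _ _.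
have := dim_span_pts S; move: h2; rewrite !dim_vline.
by case: (_ != 0); case: (_ != 0) => /=; count_lia.
Qed.

Lemma S_notin_t01 q : q \in S -> hcoord q \notin t01.
Proof.
move=> qS; apply/negP => h.
have s0 : (0 < size S)%N by rewrite lt0n size_eq0; apply: contraTneq qS => ->.
have : (W + span_pts S <= W + span_pts (rem q S))%VS.
  rewrite subv_add addvSl /span_pts (big_rem q) //= subv_add addvSr andbT mem_pline.
  by rewrite (subvP (addvSl _ _)) // (subvP (addvSl _ _)).
move/dimvS; rewrite hI => h'.
have h1 : (\dim (W + span_pts (rem q S)) <= _)%N := dimv_add_leqif _ _.
have h2 : (\dim W <= _)%N := dimv_add_leqif _ _.
have := dim_span_pts (rem q S); rewrite size_rem //; move: h2.
by have := dim_t01; rewrite !dim_vline; case: (_ != 0) => /=; count_lia.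
Qed.

Hypotheses (S_gt0 : (0 < size S)%N) (SX : forall q, q \in S -> q \in X /\ mu q != 0).

Let e1_free := e1_notin_line.
Let e2_free := e2_notin_tangent.

Lemma span_not_in (M : vsp) : (\dim M <= size S + 2)%N ->
  ~ (W <= M)%VS \/ (exists2 q, q \in X & (mu q != 0) && (hcoord q \notin M)).
Proof.
move=> dM; have [WM|] := boolP (W <= M)%VS; last by left; apply/negP.
right; have [/hasP[q qS qM]|/hasPn hn] := boolP (has (fun q => hcoord q \notin M) S).
  by have [qX nq] := SX qS; exists q; rewrite ?nq.
have : (W + span_pts S <= M)%VS.
  rewrite subv_add WM /span_pts big_seq /=.
  elim/big_ind: _ => [|A B hA hB|q qS]; rewrite ?sub0v ?subv_add ?hA //.
  by rewrite mem_pline -[_ \in _]negbK hn.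
by move/dimvS; rewrite hI; count_lia.
Qed.

(** A point of [S] lies on [L], so [L] is the line through it and [e0]. A form that
    vanishes on the tangent line and on [S] but not at e2 then leaves [e0]
    alone, and a single point satisfies no relation. *)
Lemma not_two_lines (L : vsp) : (2 <= d)%N -> (\dim L <= 2)%N -> e0 \in L ->
  ~ (forall q, q \in X -> mu q != 0 -> (hcoord q \in t01) || (hcoord q \in L)).
Proof.
move=> d2 dL e0L h.
have [q qS] : exists q, q \in S by case: S S_gt0 => // q ? _; exists q; rewrite inE eqxx.
have qt := S_notin_t01 qS.
have [qX nq] := SX qS.
have qL : hcoord q \in L by move: (h q qX nq); rewrite (negbTE qt).
have LS : (L <= <[e0]> + <[hcoord q]>)%VS.
  apply: line_sub => //; first exact: e0_neq0.
  by apply: contra qt => /(subvP (addvSl _ _)).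
have [l [lS l2]] := exists_form_sep e2_notin_span.
have lt u : u \in t01 -> lval l u = 0.
  by move=> ut; apply: lS; apply: (subvP (addvSl _ _)).
have lL u : u \in L -> lval l u = 0.
  move/(subvP LS)/memv_addP => [u1 /vlineP[x ->] [u2 /vlineP[y ->] ->]].
  rewrite lvalDr !lvalZr lt ?mem_t01_0 // lS ?mulr0 ?addr0 //.
  by apply: (subvP (addvSr _ _)); apply: mem_span_pts.
have l0 := lt _ mem_t01_0; have l1 := lt _ mem_t01_1.
have r0 : residual [:: l] p0 != 0.
  by rewrite residual_p0 ?arcP_coefE ?l0 ?l1 ?l2 ?arc_ring // oppr_eq0.
have rr : form_rel X (d - 1) (residual [:: l]).
  by apply: (@residual_rel [:: l]); [exact: ltnW | rewrite !arcP_coefE l0 mul0r |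
    rewrite !arcP_coefE l0 l1 !mul0r addr0].
have w2 := nsupp_ge_rel uX rr p0X r0.
have [q' qX' /andP[ne nz]] := support_other (leq_trans (leq_addl _ 2) w2).
move/negP: nz; apply; rewrite residual_ne // big_seq1.
case: (eqVneq (mu q') 0) => [->|nq']; first by rewrite mul0r eqxx.
by rewrite /pval; case/orP: (h q' qX' nq') => [/lt|/lL] ->; rewrite mulr0 eqxx.
Qed.

Lemma mul_form_neq0 (nu : pt -> k) (l : 'cV[k]_m.+1) q : mul_form nu l q != 0 -> nu q != 0.
Proof. by apply: contraNneq => h; rewrite /mul_form h mul0r. Qed.

Lemma heavy_sub (nu : pt -> k) (M : vsp) n :
  (forall q, q \in X -> nu q != 0 -> in_config q) -> (n <= nsupp X nu)%N ->
  (forall q, q \in X -> nu q != 0 -> hcoord q \in M) -> heavy n M.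
Proof.
move=> h1 nw h2; apply: leq_trans nw _; rewrite /nsupp -size_filter.
apply: count_sub; first exact: filter_uniq.
by move=> q; rewrite mem_filter => /andP[nz qX]; rewrite /= h1 // h2.
Qed.

Lemma spanned_or (nu : pt -> k) r :
  (exists2 U : vsp, (\dim U <= r)%N & forall q, q \in X -> nu q != 0 -> hcoord q \in U) \/
  (forall U : vsp, (\dim U <= r)%N ->
     exists2 q, q \in X & (nu q != 0) && (hcoord q \notin U)).
Proof.
have [h|h] := pselect (exists2 U : vsp, (\dim U <= r)%N &
    forall q, q \in X -> nu q != 0 -> hcoord q \in U); first by left.
right=> U dU; apply/hasP; apply: contraT => /hasPn hn; case: h; exists U => // q qX nz.
by move: (hn q qX); rewrite nz negbK.
Qed.

Hypothesis (uS : uniq S) (dS : (2 * size S + 5 <= d)%N)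
  (T_le : (count in_config X <= 2 * d + 2 * size S)%N).

(** Start with a form of order two along the arc that vanishes on [S]; it leaves at most
    [2 * d + size S] points in degree [d - 1]. If they span at most as much as
    [size S + 2] points, [line_of_heavy] applies. If not, a form that kills
    [size S + 2] of them leaves at most [2 * d - 2] points in degree [d - 2]; these
    span at most a plane, and [line_of_heavy] applies again, or three of them can be
    killed and the rest is collinear. *)
Lemma exists_heavy_line : exists2 L : vsp, (\dim L <= 2)%N & heavy (d - 1) L.
Proof.
have d5 : (5 <= d)%N := leq_trans (leq_addl _ _) dS.
have d2 : (2 <= d)%N := leq_trans (isT : (2 <= 5)%N) d5.
have d3 : (3 <= d)%N := leq_trans (isT : (3 <= 5)%N) d5.
have [l1 [l1S l12]] := exists_form_sep e2_notin_span.
have l1t u : u \in t01 -> lval l1 u = 0.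
  by move=> ut; apply: l1S; apply: (subvP (addvSl _ _)).
have l10 := l1t _ mem_t01_0; have l11 := l1t _ mem_t01_1.
pose nu1 := residual [:: l1].
have n1 : nu1 p0 != 0.
  by rewrite /nu1 residual_p0 ?arcP_coefE ?l10 ?l11 ?l12 ?arc_ring // oppr_eq0.
have r1 : form_rel X (d - 1) nu1.
  by apply: (@residual_rel [:: l1]); [exact: ltnW | rewrite !arcP_coefE l10 mul0r |
    rewrite !arcP_coefE l10 l11 !mul0r addr0].
have T1 q : q \in X -> nu1 q != 0 -> in_config q by move=> _; apply: residual_in_config.
have w1 : (nsupp X nu1 + size S <= count in_config X)%N.
  have p0S : p0 \in S = false.
    by apply/negbTE/negP => /S_notin_t01; rewrite hp0 mem_t01_0.
  have := @nsupp_residual [:: l1] (fun q => q \in S); rewrite p0S addn0 => h.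
  apply: leq_trans (h _); last first.
    move=> q qX ne qS; rewrite residual_ne // big_seq1 /pval l1S ?mulr0 //.
    by apply: (subvP (addvSr _ _)); apply: mem_span_pts.
  rewrite leq_add2l; apply: count_sub => // q qS; have [qX nq] := SX qS.
  by rewrite /= /in_config nq orbT.
have m1 := nsupp_ge_rel uX r1 p0X n1.
case: (spanned_or nu1 (size S + 2)) => [[U dU hU]|h1].
  apply: (line_of_heavy e1_free e2_free dS T_le _ (span_not_in dU)).
  by apply: (heavy_sub T1 _ hU); count_lia.
have [l2 [[q2 q2X n2] w2]] := exists_killing_form uX h1.
have r2 : form_rel X (d - 2) (mul_form nu1 l2).
  by apply: form_rel_mul; rewrite subnSK.
have T2 q : q \in X -> mul_form nu1 l2 q != 0 -> in_config q.
  by move=> qX /mul_form_neq0; apply: T1.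
have m2 := nsupp_ge_rel uX r2 q2X n2.
case: (spanned_or (mul_form nu1 l2) 3) => [[U dU hU]|h2].
  have dU' : (\dim U <= size S + 2)%N.
    by rewrite (leq_trans dU) // -addn1 addnC leq_add2r.
  apply: (line_of_heavy e1_free e2_free dS T_le _ (span_not_in dU')).
  by apply: (heavy_sub T2 _ hU); count_lia.
have [l3 [[q3 q3X n3] w3]] := exists_killing_form uX h2.
have r3 : form_rel X (d - 3) (mul_form (mul_form nu1 l2) l3).
  by apply: form_rel_mul; rewrite subnSK.
have m3 := nsupp_ge_rel uX r3 q3X n3.
have [|L dL hL] := form_rel_collinear uX r3; first by count_lia.
exists L => //; apply: (heavy_sub _ _ hL); last by count_lia.
by move=> q qX /mul_form_neq0; apply: T2.
Qed.

(** Two lines L and L2 carry at least [2 * d - 1] of the points; what is left cannot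
    satisfy a relation, so a product of at most three forms that contains forms through L
    and L2 and has order at least two along the arc annihilates the identity. A product of order
    exactly two always exists, except when L is the tangent line and L2 passes
    through [e0]; that case is [not_two_lines]. *)
Lemma arc_relation_with_points : False.
Proof.
have [L dL hL] := exists_heavy_line; rewrite /heavy in hL.
have d5 : (5 <= d)%N := leq_trans (leq_addl _ _) dS.
have d2 : (2 <= d)%N := leq_trans (isT : (2 <= 5)%N) d5.
have d3 : (3 <= d)%N := leq_trans (isT : (3 <= 5)%N) d5.
have [lT [lT0 lT1]] := exists_form_tangent e1_free.
have [l1 [l1t l10 l11 l12]] := exists_form_second e2_free.
(* A second line, heavy outside L: divide by a form through the tangent line
   and a form through L. *)
have [gs gsz [g1 [g2 [[E g1t g2L] [q qX nq]]]]] : exists2 gs, size gs = 2%N &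
  exists g1 g2, [/\ gs = [:: g1; g2], forall u, u \in t01 -> lval g1 u = 0 &
    forall u, u \in L -> lval g2 u = 0] /\ exists2 q, q \in X & residual gs q != 0.
  have [e0L|e0L] := boolP (e0 \in L); last first.
    have [l [lL l0]] := exists_form_sep e0L.
    exists [:: l1; l] => //; exists l1, l; split=> //; exists p0 => //.
    by rewrite residual_p0 ?arcP_coefE ?l10 ?l11 ?l12 ?l0 ?arc_ring // oppr_eq0.
  have [/hasP[q qX /and3P[nq qt qL]]|/hasPn hn] := boolP (has (fun q =>
      [&& mu q != 0, hcoord q \notin t01 & hcoord q \notin L]) X); last first.
    exfalso; apply: (not_two_lines d2 dL e0L) => q qX nq.
    by move: (hn q qX); rewrite nq /= negb_and !negbK.
  have [g1 [g1t g1q]] := exists_form_sep qt; have [g2 [g2L g2q]] := exists_form_sep qL.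
  exists [:: g1; g2] => //; exists g1, g2; split=> //; exists q => //.
  rewrite residual_ne ?big_cons ?big_nil /pval ?g1q ?g2q ?mulr1 //.
  by apply: contra qt => /eqP ->; rewrite hp0 mem_t01_0.
have g10 := g1t _ mem_t01_0; have g11 := g1t _ mem_t01_1.
have P0 : (arcP gs)`_0 = 0 by rewrite E !arcP_coefE g10 mul0r.
have P1 : (arcP gs)`_1 = 0 by rewrite E !arcP_coefE g10 g11 ?arc_ring.
have rp0 : (e0 \in L) && (residual gs p0 != 0) = false.
  apply/negbTE; rewrite negb_and negbK; case: (boolP (e0 \in L)) => //= /g2L g20.
  by rewrite residual_p0 // E !arcP_coefE g10 g11 g20 !arc_ring oppr0.
have nL q' : q' \in X -> residual gs q' != 0 -> hcoord q' \notin L.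
  move=> q'X nz; apply/negP => q'L; move/negP: nz; apply.
  case: (eqVneq q' p0) => [Eq|ne]; last first.
    by rewrite (@residual_killed gs g2 L) // E !inE eqxx orbT.
  by move: rp0; rewrite -hp0 -Eq q'L /= => /negbFE.
have out := @nsupp_residual_sub gs g2 L; rewrite rp0 E !inE eqxx orbT -E addn0 in out.
have {}out := out isT g2L.
have := @residual_collinear gs; rewrite gsz => /(_ d2 P0 P1); case.
- by exists q.
- by count_lia.
move=> L2 [dL2 LP2 w2].
have [q2 q2X /andP[ne2 nq2]] : exists2 q, q \in X & (q != p0) && (residual gs q != 0).
  by apply: support_other; count_lia.
have q2L := LP2 _ q2X nq2.
have q2t : hcoord q2 \notin t01.
  apply/negP => h; move/negP: nq2; apply.
  by rewrite (@residual_killed gs g1 t01) // E inE eqxx.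
have L2t : (L2 <= t01)%VS -> False by move/subvP/(_ _ q2L); apply/negP.
pose onL q := (hcoord q \in L) || (hcoord q \in L2).
have cnt : (2 * d <= count [pred q | in_config q && onL q] X + 1)%N.
  have : (npts L + nsupp X (residual gs) <= count [pred q | in_config q && onL q] X)%N.
    rewrite /npts /nsupp -!size_filter -size_cat size_filter.
    apply: count_sub.
      rewrite cat_uniq !filter_uniq // andbT /=; apply/hasPn => q'.
      rewrite !mem_filter => /andP[nz q'X] /=; rewrite q'X andbT negb_and.
      by rewrite (nL q') // orbT.
    move=> q'; rewrite mem_cat !mem_filter /= => /orP[/andP[/andP[Tq qL] ->]|/andP[nz q'X]].
      by rewrite Tq /onL qL.
    by rewrite (residual_in_config nz) /onL (LP2 q') ?orbT.
  by count_lia.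
(* Off the two lines at most 2 * size S + 1 points remain, and [dS] makes these, even
   together with p0, too few for a relation of degree at least d - 3. *)
have small hs : (size hs <= 3)%N -> (arcP hs)`_0 = 0 -> (arcP hs)`_1 = 0 ->
    (exists2 h, h \in hs & forall u, u \in L -> lval h u = 0) ->
    (exists2 h, h \in hs & forall u, u \in L2 -> lval h u = 0) ->
    forall q', q' \in X -> residual hs q' = 0.
  move=> s3 h0 h1 [g gin gL] [g' gin' gL'] q' q'X; apply/eqP; apply: contraT => nz.
  have hsd := leq_trans s3 d3.
  have w3 := nsupp_ge_rel uX (residual_rel hsd h0 h1) q'X nz.
  have := @nsupp_residual hs onL.
  have hon x : x \in X -> x != p0 -> onL x -> residual hs x = 0.
    move=> _ ne /orP[]; [exact: (residual_killed gin gL) | exact: (residual_killed gin' gL')].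
  by move=> /(_ hon); case: (_ && _); count_lia.
have no_p0 hs : (size hs <= 3)%N -> (arcP hs)`_0 = 0 -> (arcP hs)`_1 = 0 ->
    (arcP hs)`_2 != 0 ->
    (exists2 h, h \in hs & forall u, u \in L -> lval h u = 0) ->
    (exists2 h, h \in hs & forall u, u \in L2 -> lval h u = 0) -> False.
  move=> s3 h0 h1 h2 hl hl2; have := small hs s3 h0 h1 hl hl2 p0 p0X.
  by rewrite residual_p0 // => /eqP; rewrite oppr_eq0 mulf_eq0 (negbTE c_neq0) (negbTE h2).
(* A suitable form through a line has order zero along the arc if e0 is not on the line,
   one if e0 is and e1 is not, and two if the line is tangent; lT and l1 supply what
   is missing to order two. *)
have [e0L|e0L] := boolP (e0 \in L); have [e0L2|e0L2] := boolP (e0 \in L2).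
- have e1L2 : e1 \notin L2 by apply/negP => /(tangent_line_sub e1_free dL2 e0L2).
  have [f2 [f2L f21]] := exists_form_sep e1L2; have f20 := f2L _ e0L2.
  have [e1L|e1L] := boolP (e1 \in L); last first.
    have [f1 [f1L f11]] := exists_form_sep e1L; have f10 := f1L _ e0L.
    apply: (no_p0 [:: f1; f2]); rewrite // ?arcP_coefE ?f10 ?f20 ?f11 ?f21 ?arc_ring ?oner_eq0 //.
      by exists f1; rewrite // inE eqxx.
    by exists f2; rewrite // !inE eqxx orbT.
  have Lt := tangent_line_sub e1_free dL e0L e1L.
  apply: (not_two_lines d2 dL2 e0L2) => q3 q3X nq3; apply: contraT.
  rewrite negb_or => /andP[q3t q3L].
  have [h1 [h1t h1q]] := exists_form_sep q3t; have [h2 [h2L h2q]] := exists_form_sep q3L.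
  have h10 := h1t _ mem_t01_0; have h11 := h1t _ mem_t01_1.
  have /eqP : residual [:: h1; h2] q3 = 0.
    apply: small; rewrite // ?arcP_coefE ?h10 ?h11 ?arc_ring //.
      by exists h1; rewrite ?inE ?eqxx // => u /(subvP Lt); apply: h1t.
    by exists h2; rewrite // !inE eqxx orbT.
  rewrite residual_ne; first by rewrite !big_cons big_nil /pval h1q h2q !mulr1 (negbTE nq3).
  by apply: contra q3t => /eqP ->; rewrite hp0 mem_t01_0.
- have [f2 [f2L f20]] := exists_form_sep e0L2.
  have [e1L|e1L] := boolP (e1 \in L).
    have Lt := tangent_line_sub e1_free dL e0L e1L.
    apply: (no_p0 [:: l1; f2]); rewrite // ?arcP_coefE ?l10 ?l11 ?l12 ?f20 ?arc_ring ?oner_eq0 //.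
      by exists l1; rewrite ?inE ?eqxx // => u /(subvP Lt); apply: l1t.
    by exists f2; rewrite // !inE eqxx orbT.
  have [f1 [f1L f11]] := exists_form_sep e1L; have f10 := f1L _ e0L.
  apply: (no_p0 [:: f1; lT; f2]); rewrite // ?arcP_coefE ?f10 ?f20 ?f11 ?lT0 ?lT1 ?arc_ring ?oner_eq0 //.
    by exists f1; rewrite // inE eqxx.
  by exists f2; rewrite // !inE eqxx !orbT.
- have e1L2 : e1 \notin L2 by apply/negP => /(tangent_line_sub e1_free dL2 e0L2).
  have [f2 [f2L f21]] := exists_form_sep e1L2; have f20 := f2L _ e0L2.
  have [f1 [f1L f10]] := exists_form_sep e0L.
  apply: (no_p0 [:: f1; lT; f2]); rewrite // ?arcP_coefE ?f10 ?f20 ?f21 ?lT0 ?lT1 ?arc_ring ?oner_eq0 //.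
    by exists f1; rewrite // inE eqxx.
  by exists f2; rewrite // !inE eqxx !orbT.
- have [f1 [f1L f10]] := exists_form_sep e0L.
  have [f2 [f2L f20]] := exists_form_sep e0L2.
  apply: (no_p0 [:: l1; f1; f2]); rewrite // ?arcP_coefE ?f10 ?f20 ?l10 ?l11 ?l12 ?arc_ring ?oner_eq0 //.
    by exists f1; rewrite // !inE eqxx orbT.
  by exists f2; rewrite // !inE eqxx !orbT.
Qed.

End WithPoints.
End LowerBound.

(** * Ideals of finite colength *)

(** Otherwise the vectors would span a space of dimension r+1 that meets U trivially. *)
Lemma codim_dep (k : fieldType) (V : vectType k) (U : {vspace V}) r (v : 'I_r.+1 -> V) :
  (\dim {:V} - \dim U <= r)%N ->
  exists c : 'I_r.+1 -> k, (exists i, c i != 0) /\ \sum_i c i *: v i \in U.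
Proof.
move=> dU; have [//|h] := pselect (exists c : 'I_r.+1 -> k,
  (exists i, c i != 0) /\ \sum_i c i *: v i \in U).
exfalso.
have triv c : \sum_i c i *: v i \in U -> forall i, c i = 0.
  move=> cU i; apply/eqP; apply: contraT => ci; case: h; exists c; split=> //.
  by exists i.
pose X := [tuple v i | i < r.+1].
have XE (i : 'I_r.+1) : X`_i = v i by rewrite -tnth_nth tnth_mktuple.
have fX : free X.
  apply/freeP => c c0; apply: triv.
  by rewrite (eq_bigr (fun i : 'I_r.+1 => c i *: X`_i)) ?c0 ?mem0v // => i _; rewrite XE.
have cap : (<<X>> :&: U = 0)%VS.
  apply/eqP; rewrite -subv0; apply/subvP => w /memv_capP[wX wU]; rewrite memv0.
  rewrite (coord_span wX) big1 // => i _; rewrite (triv (coord X ^~ w)) ?scale0r //.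
  by rewrite (eq_bigr (fun i : 'I_r.+1 => coord X i w *: X`_i)) -?coord_span // => j _; rewrite XE.
have := dimvS (subvf (<<X>> + U)%VS); rewrite dimv_disjoint_sum //.
move: fX; rewrite /free => /eqP ->; rewrite size_tuple.
by have := dimvS (subvf U); lia.
Qed.

Lemma codim_indep (k : fieldType) (V : vectType k) (U : {vspace V}) :
  exists v : 'I_(\dim {:V} - \dim U) -> V,
    forall c : 'I_(\dim {:V} - \dim U) -> k, \sum_i c i *: v i \in U -> forall i, c i = 0.
Proof.
rewrite -dimv_compl; exists (fun i => (vbasis U^C)`_i) => c cU.
have cC : \sum_i c i *: (vbasis U^C)`_i \in (U^C)%VS.
  by apply: rpred_sum => i _; apply: rpredZ; apply: vbasis_mem; rewrite mem_nth // size_tuple.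
have : \sum_i c i *: (vbasis U^C)`_i \in (U :&: U^C)%VS by apply/memv_capP.
rewrite capv_compl memv0 => /eqP c0.
have /basis_free/freeP := vbasisP U^C; exact.
Qed.

Section Hilbert.
Variables (k : fieldType) (n : nat) (Z : subscheme k n).

Lemma hilbert_dep t r (F : 'I_r.+1 -> {mpoly k[n.+1]}) :
  (hilbert Z t <= r)%N -> (forall i, F i \is t.-homog) ->
  exists c : 'I_r.+1 -> k, (exists i, c i != 0) /\ Z (\sum_i c i *: F i).
Proof.
move=> hZ hF.
have [c [c0 cU]] := codim_dep (fun i => DHomog (hF i)) hZ.
exists c; split=> //; move: cU; rewrite mem_prop_vspace => /asboolP.
by rewrite raddf_sum.
Qed.

Lemma hilbert_indep t : exists F : 'I_(hilbert Z t) -> {mpoly k[n.+1]},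
  (forall i, F i \is t.-homog) /\ forall c : 'I_(hilbert Z t) -> k,
   Z (\sum_i c i *: F i) -> forall i, c i = 0.
Proof.
have [v vP] := codim_indep (homog_part Z t).
exists (fun i => mpoly_of_dhomog (v i)); split=> [i|c Zc]; first exact: dhomog_is_dhomog.
by apply: vP; rewrite mem_prop_vspace; apply/asboolP; rewrite raddf_sum.
Qed.

End Hilbert.

(** Ideals as predicates, in the style of the record of subschemes but without grading
    and saturation. *)
Record mideal (k : fieldType) (n : nat) := MIdeal {
  imem :> {mpoly k[n]} -> Prop;
  mideal0 : imem 0;
  midealD : forall f g, imem f -> imem g -> imem (f + g);
  midealM : forall f g, imem g -> imem (f * g) }.

Section Ideals.
Variables (k : fieldType) (n : nat) (J : mideal k n).

Lemma midealMr f g : J f -> J (f * g).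
Proof. by rewrite mulrC; apply: midealM. Qed.

Lemma midealZ c f : J f -> J (c *: f).
Proof. by rewrite -mul_mpolyC; apply: midealM. Qed.

Lemma midealN f : J f -> J (- f).
Proof. by rewrite -scaleN1r; apply: midealZ. Qed.

Lemma midealB f g : J f -> J g -> J (f - g).
Proof. by move=> Jf Jg; apply: midealD => //; apply: midealN. Qed.

Lemma mideal_sum (I : Type) (r : seq I) (P : pred I) F :
  (forall i, P i -> J (F i)) -> J (\sum_(i <- r | P i) F i).
Proof. by move=> h; apply: big_ind => //; [apply: mideal0 | apply: midealD]. Qed.

Lemma mideal_congr f g : J (f - g) -> J g -> J f.
Proof. by move=> h Jg; rewrite -(subrK g f); apply: midealD. Qed.

Lemma mideal_congr_sym f g : J (f - g) -> J (g - f).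
Proof. by move=> h; rewrite -opprB; apply: midealN. Qed.

Lemma mideal_trans f g h : J (f - g) -> J (g - h) -> J (f - h).
Proof. by move=> a b; rewrite -(subrK g f) -addrA; apply: midealD. Qed.

Lemma mideal_congrM f g f' g' : J (f - f') -> J (g - g') -> J (f * g - f' * g').
Proof.
move=> hf hg; have -> : f * g - f' * g' = f * (g - g') + g' * (f - f').
  by rewrite !mulrBr [g' * f]mulrC [g' * f']mulrC addrA subrK.
by apply: midealD; apply: midealM.
Qed.

Lemma mideal_congrX f g i : J (f - g) -> J (f ^+ i - g ^+ i).
Proof.
move=> h; elim: i => [|i IH]; first by rewrite subrr; apply: mideal0.
by rewrite !exprS; apply: mideal_congrM.
Qed.

Lemma mideal_congr_mmap (g h : 'I_n -> {mpoly k[n]}) (f : {mpoly k[n]}) :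
  (forall i, J (g i - h i)) ->
  J (mmap (@mpolyC n k) g f - mmap (@mpolyC n k) h f).
Proof.
move=> gh; rewrite /mmap -sumrB; apply: mideal_sum => m _; rewrite -mulrBr.
apply: midealM; rewrite /mmap1.
elim/big_ind2: _ => [|f1 g1 f2 g2 h1 h2|i _]; first by rewrite subrr; apply: mideal0.
  exact: mideal_congrM.
exact: mideal_congrX.
Qed.

End Ideals.

Program Definition sch_ideal (k : fieldType) (n : nat) (Z : subscheme k n) :
  mideal k n.+1 := @MIdeal k n.+1 (sideal Z) _ _ _.
Next Obligation. by move=> *; apply: sideal0. Qed.
Next Obligation. by move=> *; apply: sidealD. Qed.
Next Obligation. by move=> *; apply: sidealM. Qed.

(** The ideal generated by [Z] and [y - 1]: the quotient is the coordinate ring of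
    the affine chart where [y] does not vanish. *)
Program Definition chart (k : fieldType) (n : nat) (Z : subscheme k n) (y : {mpoly k[n.+1]}) :
  mideal k n.+1 := @MIdeal k n.+1 (fun f => exists g h, Z g /\ f = g + (y - 1) * h) _ _ _.
Next Obligation. by move=> k n Z y; exists 0, 0; rewrite mulr0 addr0; split=> //; apply: sideal0. Qed.
Next Obligation.
move=> k n Z y f g [g1 [h1 [Z1 ->]]] [g2 [h2 [Z2 ->]]]; exists (g1 + g2), (h1 + h2).
by split; [apply: sidealD | rewrite mulrDr addrACA].
Qed.
Next Obligation.
move=> k n Z y f g [g1 [h1 [Z1 ->]]]; exists (f * g1), (f * h1).
by split; [apply: sidealM | rewrite mulrDr [(y - 1) * (f * _)]mulrCA].
Qed.

Program Definition colon (k : fieldType) (n : nat) (J : mideal k n) (g : {mpoly k[n]}) :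
  mideal k n := @MIdeal k n (fun f => J (f * g)) _ _ _.
Next Obligation. by move=> * /=; rewrite mul0r; apply: mideal0. Qed.
Next Obligation. by move=> * /=; rewrite mulrDl; apply: midealD. Qed.
Next Obligation. by move=> * /=; rewrite -mulrA; apply: midealM. Qed.

Arguments imem : simpl never.

Section Homogenize.
Variables (k : fieldType) (n : nat) (Z : subscheme k n) (y : {mpoly k[n.+1]}).
Hypothesis y1 : y \is 1.-homog.

(** The homogenization in degree [T] with respect to [y], valid for polynomials of
    degree at most [T]; it passes from the chart back to [Z]. *)
Definition homogenize T (f : {mpoly k[n.+1]}) : {mpoly k[n.+1]} :=
  \sum_(t < T.+1) y ^+ (T - t) * pihomog mdeg t f.

Lemma homogenizeD T f g : homogenize T (f + g) = homogenize T f + homogenize T g.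
Proof. by rewrite /homogenize -big_split; apply: eq_bigr => t _; rewrite pihomogD mulrDr. Qed.

Lemma homogenizeN T f : homogenize T (- f) = - homogenize T f.
Proof. by rewrite /homogenize -sumrN; apply: eq_bigr => t _; rewrite pihomogN mulrN. Qed.

Lemma yX_homog i : y ^+ i \is i.-homog.
Proof. by have := dhomogMn i y1; rewrite mul1n. Qed.

Lemma homogenize_homog T f : homogenize T f \is T.-homog.
Proof.
apply: rpred_sum => t _.
have := dhomogM (yX_homog (T - t)) (pihomogP mdeg t f).
by rewrite subnK // -ltnS.
Qed.

Lemma homogenize_sch T f : Z f -> Z (homogenize T f).
Proof.
move=> Zf; apply: (@mideal_sum _ _ (sch_ideal Z)) => t _ /=.
by apply: sidealM; apply: sideal_homog.
Qed.

Lemma homogenizeS T f : (msize f <= T.+1)%N -> homogenize T.+1 f = y * homogenize T f.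
Proof.
move=> le; rewrite /homogenize big_ord_recr /= subnn expr0 mul1r.
have -> : pihomog mdeg T.+1 f = 0.
  rewrite pihomogE big_seq_cond big_pred0 // => m; apply/negP => /andP[mf /eqP E].
  by have := msize_mdeg_lt mf; rewrite E ltnNge le.
rewrite addr0 mulr_sumr; apply: eq_bigr => t _.
by rewrite mulrA -exprS subSn // -ltnS.
Qed.

Lemma homogenize_mul T f : homogenize T.+1 (y * f) = y * homogenize T f.
Proof.
rewrite /homogenize big_ord_recl /= (pihomogM _ _ y1) /= mulr0 add0r mulr_sumr.
by apply: eq_bigr => t _; rewrite /= subSS (pihomogM _ _ y1) /= subn1 mulrCA.
Qed.

Lemma homogenize_dE t T f : f \is t.-homog -> (t <= T)%N -> homogenize T f = y ^+ (T - t) * f.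
Proof.
move=> hf le; rewrite /homogenize (bigD1 (Ordinal (le : t < T.+1)%N)) //= (pihomog_dE hf).
rewrite big1 ?addr0 // => i ne; rewrite (pihomog_ne0 (d := t)) ?mulr0 //.
by apply: contra ne => /eqP E; apply/eqP/val_inj.
Qed.

(** In degrees above that of h the homogenizations of y h and of h agree, so that only
    the part of [f] in [Z] contributes. *)
Lemma chart_homogenize f : chart Z y f -> exists T0, forall T, (T0 <= T)%N -> Z (homogenize T f).
Proof.
move=> [g [h [Zg ->]]]; exists (msize h).+1 => T le.
rewrite homogenizeD mulrBl mul1r homogenizeD homogenizeN.
case: T le => // T le; rewrite homogenize_mul (homogenizeS (ltnW le)) subrr addr0; exact: homogenize_sch.
Qed.

Lemma chart_sch f : Z f -> chart Z y f.
Proof. by move=> Zf; exists f, 0; rewrite mulr0 addr0. Qed.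

Lemma chart_y : chart Z y (y - 1).
Proof. by exists 0, 1; rewrite mulr1 add0r; split=> //; apply: sideal0. Qed.

Lemma chart_congr_homogenize T f : (msize f <= T.+1)%N -> chart Z y (homogenize T f - f).
Proof.
move=> le; rewrite /homogenize {2}(pihomog_partitionE (le : mmeasure mdeg f <= _)%N) -sumrB.
apply: mideal_sum => t _; rewrite -[X in _ - X]mul1r -mulrBl; apply: midealMr.
by rewrite -[X in _ - X](expr1n _ (T - t)); apply: mideal_congrX; apply: chart_y.
Qed.

Lemma homogenize1 T : homogenize T 1 = y ^+ T.
Proof. by rewrite (homogenize_dE (t := 0)) ?subn0 ?mulr1 // dhomog1. Qed.

Lemma chart_proper : (forall N, ~ Z (y ^+ N)) -> ~ chart Z y 1.
Proof. by move=> h /chart_homogenize[T /(_ T (leqnn T))]; rewrite homogenize1; apply: h. Qed.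

Lemma chart_homog t f : f \is t.-homog -> chart Z y f -> exists N, Z (y ^+ N * f).
Proof.
move=> hf /chart_homogenize[T0 h]; exists (maxn T0 t - t)%N.
by rewrite -(homogenize_dE hf) ?leq_maxr //; apply: h; apply: leq_maxl.
Qed.

(** The chart inherits the bound on the Hilbert function, because modulo [y - 1] finitely
    many polynomials are congruent to forms of one large degree. *)
Lemma chart_dep r t0 : (forall t, (t0 <= t)%N -> (hilbert Z t <= r)%N) ->
  forall F : 'I_r.+1 -> {mpoly k[n.+1]},
  exists c : 'I_r.+1 -> k, (exists i, c i != 0) /\ chart Z y (\sum_i c i *: F i).
Proof.
move=> hZ F; pose T := (t0 + \sum_i msize (F i))%N.
have le i : (msize (F i) <= T.+1)%N.
  by rewrite leqW // /T (bigD1 i) //= addnCA leq_addr.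
have [c [c0 cZ]] := hilbert_dep (hZ T (leq_addr _ _)) (fun i => homogenize_homog T (F i)).
exists c; split=> //.
apply: mideal_congr (chart_sch cZ); rewrite -sumrB; apply: mideal_sum => i _.
by rewrite -scalerBr; apply: midealZ; apply: mideal_congr_sym; apply: chart_congr_homogenize.
Qed.

End Homogenize.

Section FiniteZero.
Variables (k : closedFieldType) (n r : nat).

(** The quotient by [J] has dimension at most [r]. *)
Definition fin_codim (J : mideal k n) := forall F : 'I_r.+1 -> {mpoly k[n]},
  exists c : 'I_r.+1 -> k, (exists i, c i != 0) /\ J (\sum_i c i *: F i).

(** Powers of [x] satisfy a polynomial equation modulo [J], which splits into
    linear factors. Between the partial products that lie in [J] and those that
    do not there is a factor [x - a] that becomes zero in a proper colon ideal. *)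
Lemma coord_value (J : mideal k n) (x : {mpoly k[n]}) : fin_codim J -> ~ J 1 ->
  exists (J' : mideal k n) a, [/\ forall f, J f -> J' f, ~ J' 1 & J' (x - a%:MP)].
Proof.
move=> fJ J1; have [c [[i ci] Jc]] := fJ (fun i => x ^+ i).
pose p := \poly_(i < r.+1) c (inord i).
have p0 : p != 0.
  apply/eqP => /(congr1 (fun q : {poly k} => q`_i)).
  by rewrite coef_poly ltn_ord inord_val coef0 => /eqP; rewrite (negbTE ci).
pose phi (q : {poly k}) : {mpoly k[n]} := (map_poly (@mpolyC n k) q).[x].
have phip : J (phi p).
  suff -> : phi p = \sum_i c i *: x ^+ i by [].
  rewrite /phi (horner_coef_wide _ (n := r.+1)); last first.
    by rewrite (leq_trans (size_poly _ _)) // size_poly.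
  apply: eq_bigr => j _; rewrite coef_map /= coef_poly ltn_ord inord_val.
  by rewrite mul_mpolyC.
have [rs Ers] := closed_field_poly_normal p.
have {phip Ers} : J (\prod_(z <- rs) (x - z%:MP)).
  move: phip; rewrite Ers /phi map_polyZ /= hornerZ mul_mpolyC => /(midealZ (lead_coef p)^-1).
  rewrite scalerA mulVf ?lead_coef_eq0 // scale1r.
  rewrite rmorph_prod /= horner_prod; congr (J _); apply: eq_bigr => z _.
  by rewrite rmorphB /= map_polyX map_polyC /= hornerXsubC.
elim: rs => [|z rs IH]; rewrite ?big_nil ?big_cons // => h.
have [/IH //|nJ] := pselect (J (\prod_(z <- rs) (x - z%:MP))).
exists (colon J (\prod_(z <- rs) (x - z%:MP))), z; split=> //= [f Jf|]; first exact: midealMr.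
by rewrite /imem /= mul1r.
Qed.

(** Applying [coord_value] to the coordinates one after the other gives a proper
    ideal that contains all [X_i - a_i]; it consists of polynomials vanishing at [a]. *)
Lemma ideal_zero (J : mideal k n) : fin_codim J -> ~ J 1 ->
  exists a : 'rV[k]_n, forall f, J f -> f.@[a 0] = 0.
Proof.
move=> fJ J1.
have key (s : seq 'I_n) : exists J' : mideal k n, [/\ forall f, J f -> J' f, ~ J' 1 &
    forall i, i \in s -> exists a, J' ('X_i - a%:MP)].
  elim: s => [|i s [J' [JJ' J'1 hs]]]; first by exists J.
  have [|J2 [a [h1 h2 h3]]] := coord_value 'X_i _ J'1.
    by move=> F; have [c [c0 cJ]] := fJ F; exists c; split=> //; apply: JJ'.
  exists J2; split=> // [f /JJ'/h1 //|j]; rewrite inE => /orP[/eqP ->|/hs[b hb]].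
    by exists a.
  by exists b; apply: h1.
have [J' [JJ' J'1 h]] := key (enum 'I_n).
have {}h i : exists a, J' ('X_i - a%:MP) by apply: h; rewrite mem_enum.
have [a ha] := choice h; exists (\row_i a i) => f /JJ' Jf.
apply/eqP; apply: contraT => nz; case: J'1.
have : J' (f - (f.@[(\row_i a i) 0])%:MP).
  have -> : f.@[(\row_i a i) 0] = f.@[a] by apply: meval_eq => i; rewrite mxE.
  have := @mideal_congr_mmap _ _ J' (fun i => 'X_i) (fun i => (a i)%:MP) f ha.
  have -> : mmap (@mpolyC n k) (fun i => 'X_i) f = f.
    rewrite -[RHS]comp_mpoly_id /comp_mpoly; apply: eq_bigr => m _; congr (_ * _).
    by apply: mmap1_eq => i; rewrite tnth_mktuple.
  suff -> : mmap (@mpolyC n k) (fun i => (a i)%:MP) f = (f.@[a])%:MP by [].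
  rewrite mevalE rmorph_sum /= /mmap; apply: eq_bigr => m _.
  rewrite rmorphM /= /mmap1 rmorph_prod /=; congr (_ * _); apply: eq_bigr => i _.
  by rewrite rmorphXn.
move=> /(midealB Jf); rewrite subKr => Jc.
rewrite -[1](_ : (f.@[(\row_i a i) 0])^-1%:MP * (f.@[(\row_i a i) 0])%:MP = 1).
  exact: midealM.
by rewrite -mpolyCM mulVf.
Qed.

End FiniteZero.

(** * The support of a zero-dimensional scheme *)

Section LinearPoly.
Variables (k : fieldType) (n : nat).
Implicit Types (l : 'cV[k]_n) (v : 'rV[k]_n).

Definition lf l : {mpoly k[n]} := \sum_j l j 0 *: 'X_j.

Lemma lf_homog l : lf l \is 1.-homog.
Proof.
apply: rpred_sum => j _; apply: rpredZ; rewrite dhomogX; apply/eqP/mdeg1.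
Qed.

Lemma lf_eval l v : (lf l).@[v 0] = lval l v.
Proof.
rewrite /lf raddf_sum lvalE; apply: eq_bigr => j _ /=.
by rewrite mevalZ mevalXU mulrC.
Qed.

Definition lfs (ls : seq 'cV[k]_n) : {mpoly k[n]} := \prod_(l <- ls) lf l.

Lemma lfs_homog ls : lfs ls \is (size ls).-homog.
Proof.
rewrite /lfs; elim: ls => [|l ls IH]; first by rewrite big_nil dhomog1.
by rewrite big_cons; apply: (dhomogM (lf_homog l) IH).
Qed.

Lemma lfs_eval ls v : (lfs ls).@[v 0] = \prod_(l <- ls) lval l v.
Proof. by rewrite /lfs rmorph_prod; apply: eq_bigr => l _; apply: lf_eval. Qed.

Lemma pihomog_homog (t e : nat) (f : {mpoly k[n]}) : f \is e.-homog ->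
  pihomog mdeg t f = if t == e then f else 0.
Proof.
move=> h; case: eqP => [->|/eqP ne]; first exact: pihomog_dE.
by rewrite (pihomog_ne0 (d := e)) // eq_sym.
Qed.

Lemma homog_scale_eval (t : nat) (f : {mpoly k[n]}) (a : k) v : f \is t.-homog ->
  f.@[(a *: v) 0] = a ^+ t * f.@[v 0].
Proof.
move=> /dhomogP hf; rewrite !mevalE mulr_sumr big_seq [RHS]big_seq.
apply: eq_bigr => x /hf dx; rewrite mulrCA; congr (_ * _).
rewrite -(dx : mdeg x = t) mdegE -prodrXr -big_split; apply: eq_bigr => i _ /=.
by rewrite mxE exprMn.
Qed.

End LinearPoly.

Section Support.
Variables (k : fieldType) (m : nat).
Local Notation pt := (proj_pt k m).

Lemma separating_forms (q : pt) (s : seq pt) e : q \notin s ->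
  exists ls, [/\ size ls = (size s + e)%N, \prod_(l <- ls) pval l q = 1 &
    forall q', q' \in s -> \prod_(l <- ls) pval l q' = 0].
Proof.
elim: s => [|q' s IH] /=.
  have [l l1] := exists_form_nz q; exists (nseq e l); rewrite size_nseq; split=> //.
  by rewrite big_nseq iter_fix // l1 mulr1.
rewrite inE negb_or => /andP[ne /IH[ls [sz l1 l0]]].
have [l [lq' lq]] := exists_form_pt ne.
exists (l :: ls); rewrite /= sz big_cons lq l1 mulr1; split=> // x.
by rewrite inE big_cons => /orP[/eqP -> | /l0 ->]; rewrite ?lq' ?mul0r ?mulr0.
Qed.

Lemma supp_pts_sch (B : {fset pt}) q : supp (pts_sch B) q <-> q \in B.
Proof.
split=> [h|qB f Zf]; last first.
  by rewrite (pihomog_partitionE (leqnn (mmeasure mdeg f))) raddf_sum big1 // => t _; apply: Zf.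
apply: contraT => qB; have [ls [sz l1 l0]] := separating_forms 0 qB.
have := h (lfs ls); rewrite lfs_eval [\prod_(l <- ls) _]l1 => /(_ _)/eqP; rewrite oner_eq0 => -> //=.
  move=> t p pB; rewrite (pihomog_homog _ (lfs_homog ls)); case: ifP; rewrite ?meval0 //.
  by rewrite lfs_eval => _; apply: l0.
Qed.

Variable (Z : subscheme k m).

Lemma supp_of_zero (v : 'rV[k]_m.+1) : v != 0 -> (forall f, Z f -> f.@[v 0] = 0) ->
  exists2 p, supp Z p & hcoord p \in <[v]>%VS.
Proof.
move=> v0 h; have dv : \dim <[v]>%VS == 1%N by rewrite dim_vline v0.
exists (ProjPt dv); last by rewrite -mem_pline /= subvv.
move=> f Zf; have /vlineP[a ->] : hcoord (ProjPt dv) \in <[v]>%VS by rewrite -mem_pline /= subvv.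
rewrite (pihomog_partitionE (leqnn (mmeasure mdeg f))) raddf_sum big1 // => t _ /=.
by rewrite (homog_scale_eval _ _ (pihomogP _ _ _)) h ?mulr0 //; apply: sideal_homog.
Qed.

Variables (r t0 : nat).
Hypothesis hZ : forall t, (t0 <= t)%N -> (hilbert Z t <= r)%N.

(** Forms that separate r+1 points are independent modulo the ideal. *)
Lemma supp_size (s : seq pt) : uniq s -> (forall q, q \in s -> supp Z q) -> (size s <= r)%N.
Proof.
move=> us sZ; rewrite leqNgt; apply/negP => lt.
pose s' := take r.+1 s.
have sz : size s' = r.+1 by apply: size_takel.
have us' : uniq s' by apply: take_uniq.
have [q0 _] : exists q, q \in s' by case: (s') sz => // q ? _; exists q; rewrite inE eqxx.
have hF (i : 'I_r.+1) : exists ls, [/\ size ls = (r + t0)%N,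
   \prod_(l <- ls) pval l (nth q0 s' i) = 1 &
   forall j : 'I_r.+1, j != i -> \prod_(l <- ls) pval l (nth q0 s' j) = 0].
  have ins : nth q0 s' i \in s' by rewrite mem_nth // sz.
  have nin : nth q0 s' i \notin rem (nth q0 s' i) s' by rewrite mem_rem_uniqF.
  have [ls [h1 h2 h3]] := separating_forms t0 nin; exists ls; split=> //.
    by rewrite h1 size_rem // sz.
  move=> j ne; apply: h3; rewrite mem_rem_uniq // inE mem_nth ?sz // andbT /=.
  by rewrite nth_uniq ?sz.
have [F hF'] := choice hF.
have [||c [[i ci] Zc]] := @hilbert_dep k m Z (r + t0) r (fun i => lfs (F i)).
- by apply: hZ; apply: leq_addl.
- by move=> i; have [<- _ _] := hF' i; apply: lfs_homog.
case/negP: ci; apply/eqP.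
have := sZ (nth q0 s' i) _ _ Zc.
rewrite raddf_sum (bigD1 i) //= mevalZ lfs_eval; have [_ -> _] := hF' i.
rewrite mulr1 big1 ?addr0 => [-> //|j ne].
  by apply: mem_take (mem_nth _ _); rewrite sz.
by rewrite mevalZ lfs_eval; have [_ _ ->] := hF' j; rewrite ?mulr0 // eq_sym.
Qed.

Lemma supp_finite : exists B : {fset pt}, forall p, supp Z p <-> p \in B.
Proof.
have [||N /asboolP[s [us sZ sN]] maxN] := @ex_maxnP
  (fun N => `[< exists s : seq pt, [/\ uniq s, forall q, q \in s -> supp Z q & size s = N] >]) r.
- by exists 0%N; apply/asboolP; exists [::].
- by move=> i /asboolP[s [us sZ <-]]; apply: supp_size.
exists [fset q in s]%fset => p; rewrite inE; split=> [hp|]; last exact: sZ.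
apply: contraT => ps.
have : (N.+1 <= N)%N; last by rewrite ltnn.
apply: maxN; apply/asboolP; exists (p :: s); split=> /=; rewrite ?ps ?sN //.
by move=> q; rewrite inE => /orP[/eqP -> //|/sZ].
Qed.

(** The support is finite, hence the disjoint union of one point and a closed set. *)
Lemma supp_connected : connected_sch Z -> exists p, forall q, supp Z q <-> q = p.
Proof.
move=> [[p hp] hc]; exists p => q; split=> [hq|-> //].
have [B hB] := supp_finite.
apply: contrapT => ne.
case: (hc (pts_sch [fset p]%fset) (pts_sch (B `\ p)%fset)).
- move=> x; split=> [/hB xB|[/supp_pts_sch|/supp_pts_sch]].
  + case: (eqVneq x p) => [->|xp]; [left|right]; apply/supp_pts_sch; rewrite ?in_fset1 ?in_fsetD1 ?eqxx //.
    by rewrite xp.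
  + by rewrite ?in_fset1 => /eqP ->.
  + by rewrite ?in_fset1 ?in_fsetD1 ?eqxx => /andP[_ xB]; apply/hB.
- move=> x [/supp_pts_sch + /supp_pts_sch]; rewrite ?in_fset1 ?in_fsetD1 ?eqxx => /eqP ->.
  by rewrite eqxx.
- by move=> /(_ p); apply; apply/supp_pts_sch; rewrite ?in_fset1.
move=> /(_ q); apply; apply/supp_pts_sch; rewrite ?in_fset1 ?in_fsetD1 ?eqxx.
by move/hB: hq => ->; rewrite andbT; apply/eqP.
Qed.

End Support.

(** * Powers of an ideal and the Euler identity *)

Program Definition ideal1 (k : fieldType) (n : nat) : mideal k n :=
  @MIdeal k n (fun _ => True) _ _ _.
Next Obligation. by []. Qed.
Next Obligation. by []. Qed.
Next Obligation. by []. Qed.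

(** The ideal I + (z_1, ..., z_n) M. *)
Program Definition ideal_step (k : fieldType) (n : nat) (I : mideal k n)
    (z : 'I_n -> {mpoly k[n]}) (M : mideal k n) : mideal k n :=
  @MIdeal k n (fun f => exists g : 'I_n -> {mpoly k[n]},
    (forall j, M (g j)) /\ I (f - \sum_j z j * g j)) _ _ _.
Next Obligation.
move=> k n I z M /=; exists (fun=> 0); split=> [_|]; first exact: mideal0.
by rewrite big1 ?subrr => [|j _]; [apply: mideal0 | rewrite mulr0].
Qed.
Next Obligation.
move=> k n I z M f1 f2 /= [g1 [h1 i1]] [g2 [h2 i2]]; exists (fun j => g1 j + g2 j).
split=> [j|]; first exact: midealD.
under eq_bigr do rewrite mulrDr.
by rewrite big_split opprD addrACA; apply: midealD.
Qed.
Next Obligation.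
move=> k n I z M f1 f2 /= [g [h i]]; exists (fun j => f1 * g j).
split=> [j|]; first exact: midealM.
under eq_bigr do rewrite mulrCA.
by rewrite -mulr_sumr -mulrBr; apply: midealM.
Qed.

Section Powers.
Variables (k : fieldType) (n : nat) (I : mideal k n) (z : 'I_n -> {mpoly k[n]}).

(** The ideals I + (z_1, ..., z_n)^i. *)
Fixpoint mpow i : mideal k n := if i is i'.+1 then ideal_step I z (mpow i') else ideal1 k n.

Lemma mpow_sub i f : I f -> mpow i f.
Proof.
case: i => //= i If; exists (fun=> 0); split=> [_|]; first exact: mideal0.
by rewrite big1 ?subr0 // => j _; rewrite mulr0.
Qed.

Lemma mpow_z i j f : mpow i f -> mpow i.+1 (z j * f).
Proof.
move=> h; exists (fun j' => if j' == j then f else 0); split=> [j'|].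
  by case: ifP => _ //; apply: mideal0.
rewrite (bigD1 j) //= eqxx big1 ?addr0 ?subrr => [|j' /negbTE ->]; last by rewrite mulr0.
exact: mideal0.
Qed.

Lemma mpowM i1 i2 f g : mpow i1 f -> mpow i2 g -> mpow (i1 + i2) (f * g).
Proof.
elim: i1 f => [|i1 IH] f; first by move=> _; apply: midealM.
move=> [h [hM If]] Mg; rewrite addSn.
have -> : f * g = (f - \sum_j z j * h j) * g + \sum_j z j * (h j * g).
  by rewrite mulrBl mulr_suml; under [X in _ - X]eq_bigr do rewrite -mulrA; rewrite subrK.
apply: midealD; first by apply: mpow_sub; apply: midealMr.
by apply: mideal_sum => j _; apply: mpow_z; apply: IH.
Qed.

Lemma mpow1_z j : mpow 1 (z j).
Proof. by rewrite -[z j]mulr1; apply: mpow_z. Qed.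

Lemma mpowX i f : mpow 1 f -> mpow i (f ^+ i).
Proof.
move=> h; elim: i => [//|i IH]; rewrite exprS -add1n; exact: mpowM.
Qed.

(** By the pigeonhole principle a product of many z's contains a high power of one of
    them; the factor [u] collects the variables split off so far. *)
Lemma mpow_nil i (N : 'I_n -> nat) u f : (0 < n)%N -> (\sum_j N j <= i)%N ->
  (forall j, I (z j ^+ N j * u)) -> mpow i f -> I (u * f).
Proof.
move=> n0; elim: i N u f => [|i IH] N u f le h.
  move=> _; have := h (Ordinal n0); suff -> : N (Ordinal n0) = 0%N.
    by rewrite mul1r; apply: midealMr.
  by apply/eqP; rewrite -leqn0 (leq_trans _ le) // (bigD1 (Ordinal n0)) //= leq_addr.
move=> [g [gM If]].
have -> : u * f = u * (f - \sum_j z j * g j) + \sum_j u * (z j * g j).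
  by rewrite -mulr_sumr -mulrDr subrK.
apply: midealD; first exact: midealM.
apply: mideal_sum => j _; rewrite mulrA.
have [N0|N0] := posnP (N j).
  by have := h j; rewrite N0 mul1r => hu; rewrite -mulrA; apply: midealMr.
apply: (IH (fun j' => if j' == j then (N j).-1 else N j')) (gM j).
  rewrite (bigD1 j) //= eqxx -ltnS (leq_trans _ le) //.
  rewrite [X in (_ <= X)%N](bigD1 j) //= -addSn prednK // leq_add2l.
  by rewrite leq_eqVlt; apply/orP; left; apply/eqP; apply: eq_bigr => j' /negbTE ->.
move=> j'; case: eqP => [->|_].
  by rewrite mulrCA -exprSr prednK // mulrC; apply: h.
by rewrite mulrA; apply: midealMr.
Qed.

End Powers.

Arguments mpow : simpl never.

Section Euler.
Variables (k : fieldType) (n : nat).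

Lemma euler_X (x : 'X_{1..n}) :
  \sum_j 'X_j * ('X_[x] : {mpoly k[n]})^`M(j) = (mdeg x)%:R *: 'X_[x].
Proof.
rewrite mdegE natr_sum scaler_suml; apply: eq_bigr => j _.
rewrite mderivX -scalerAr -mpolyXD.
have [->|x0] := eqVneq (x j) 0%N; first by rewrite !scale0r.
by rewrite addmC submK // lep1mP.
Qed.

Lemma euler_homog t (f : {mpoly k[n]}) : f \is t.-homog ->
  \sum_j 'X_j * f^`M(j) = t%:R *: f.
Proof.
move=> /dhomogP hf; rewrite {2}[f]mpolyE scaler_sumr.
rewrite {1}[f]mpolyE; under eq_bigr do rewrite raddf_sum mulr_sumr.
rewrite exchange_big big_seq [RHS]big_seq /=; apply: eq_bigr => x /hf dx.
under eq_bigr do rewrite mderivZ -scalerAr.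
by rewrite -scaler_sumr euler_X (dx : mdeg x = t) !scalerA mulrC.
Qed.

End Euler.

(** By the Euler identity the directional derivative of a form along the point itself
    is a multiple of its value. *)
Lemma euler_tangent (k : fieldType) (m : nat) (Z : subscheme k m) (p : proj_pt k m) :
  supp Z p -> hcoord p \in tangent Z p.
Proof.
move=> hp; rewrite mem_prop_vspace; apply/asboolP => f Zf.
have h t : \sum_i ((pihomog mdeg t f)^`M(i)).@[hcoord p 0] * hcoord p 0 i = 0.
  have := euler_homog (pihomogP mdeg t f).
  move=> /(congr1 (meval (hcoord p 0))); rewrite raddf_sum mevalZ hp ?mulr0; last exact: sideal_homog.
  by move=> E; rewrite -[RHS]E; apply: eq_bigr => i _; rewrite /= mevalM mevalXU mulrC.
have -> : \sum_i (f^`M(i)).@[hcoord p 0] * hcoord p 0 i =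
    \sum_i \sum_(t < mmeasure mdeg f)
      ((pihomog mdeg t f)^`M(i)).@[hcoord p 0] * hcoord p 0 i.
  apply: eq_bigr => i _; rewrite -mulr_suml; congr (_ * _).
  by rewrite {1}(pihomog_partitionE (leqnn (mmeasure mdeg f))) (raddf_sum (mderiv i)) (raddf_sum (meval _)).
by rewrite exchange_big big1.
Qed.

(** * First order Taylor expansion *)

Section Taylor.
Variables (k : fieldType) (n : nat) (I : mideal k n) (e0 : 'rV[k]_n).

Definition zc j : {mpoly k[n]} := 'X_j - (e0 0 j)%:MP.

Definition dlin (f : {mpoly k[n]}) : {mpoly k[n]} :=
  \sum_j (f^`M(j)).@[e0 0] *: zc j.

Lemma dlinD f g : dlin (f + g) = dlin f + dlin g.
Proof.
rewrite /dlin -big_split; apply: eq_bigr => j _ /=.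
by rewrite mderivD mevalD scalerDl.
Qed.

Lemma dlinM f g : dlin (f * g) = g.@[e0 0] *: dlin f + f.@[e0 0] *: dlin g.
Proof.
rewrite /dlin !scaler_sumr -big_split; apply: eq_bigr => j _ /=.
by rewrite mderivM mevalD !mevalM !scalerA -scalerDl [_ * g.@[_]]mulrC.
Qed.

Local Notation M := (mpow I zc).

Lemma dlin_mpow1 f : M 1 (dlin f).
Proof. by apply: mideal_sum => j _; apply: midealZ; apply: mpow1_z. Qed.

(** First order Taylor expansion at [e0], modulo the square of the ideal of [e0]. *)
Definition taylor f := M 2 (f - (f.@[e0 0])%:MP - dlin f).

Lemma taylorC c : taylor c%:MP.
Proof.
rewrite /taylor mevalC subrr sub0r /dlin big1 ?oppr0; first exact: mideal0.
by move=> j _; rewrite mderivC meval0 scale0r.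
Qed.

Lemma dlin_X j : dlin 'X_j = zc j.
Proof.
rewrite /dlin (bigD1 j) //= big1 ?addr0.
  have UU : (U_(j) - U_(j) = 0)%MM by apply/mnmP => i; rewrite mnmBE mnm0E subnn.
  by rewrite mderivX mnm1E eqxx UU mpolyX0 scale1r meval1 scale1r.
by move=> i ne; rewrite mderivX mnm1E eq_sym (negbTE ne) scale0r meval0 scale0r.
Qed.

Lemma taylorX j : taylor 'X_j.
Proof. by rewrite /taylor mevalXU dlin_X /zc subrr; apply: mideal0. Qed.

Lemma taylorD f g : taylor f -> taylor g -> taylor (f + g).
Proof.
rewrite /taylor dlinD mevalD mpolyCD => h1 h2.
have -> : f + g - ((f.@[e0 0])%:MP + (g.@[e0 0])%:MP) - (dlin f + dlin g) =
  (f - (f.@[e0 0])%:MP - dlin f) + (g - (g.@[e0 0])%:MP - dlin g) by ring.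
exact: midealD.
Qed.

Lemma taylorM f g : taylor f -> taylor g -> taylor (f * g).
Proof.
rewrite /taylor dlinM mevalM mpolyCM -!mul_mpolyC.
set a := (f.@[_])%:MP; set b := (g.@[_])%:MP => h1 h2.
have -> : f * g - a * b - (b * dlin f + a * dlin g) =
  dlin f * dlin g + g * (f - a - dlin f) + (a + dlin f) * (g - b - dlin g) by ring.
apply: midealD; last exact: midealM.
apply: midealD; last exact: midealM.
by apply: (@mpowM _ _ I zc 1 1); apply: dlin_mpow1.
Qed.

(** The set of f for which the expansion holds contains the variables and is closed
    under sums and, by the Leibniz rule, under products. *)
Lemma taylorP f : taylor f.
Proof.
elim/mpolyind: f => [|c x f _ _ h]; first by rewrite -(mpolyC0 n k); apply: taylorC.
apply: taylorD => //; rewrite -mul_mpolyC; apply: taylorM; first exact: taylorC.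
rewrite mpolyXE_id; apply: (big_ind taylor); first by rewrite -mpolyC1; apply: taylorC.
  exact: taylorM.
move=> i _; elim: (x i) => [|e IH]; first by rewrite expr0 -mpolyC1; apply: taylorC.
by rewrite exprS; apply: taylorM => //; apply: taylorX.
Qed.

End Taylor.

(** * Evaluation along an arc; nilpotent coordinates *)

Section ArcEval.
Variables (k : fieldType) (n : nat) (e0 e1 e2 : 'rV[k]_n).

Definition arc_coord j : {poly k} :=
  (e0 0 j)%:P + (e1 0 j)%:P * 'X + (e2 0 j)%:P * 'X^2.

(** The polynomial F(gamma(t)) in one variable, gamma(t) = e0 + t e1 + t^2 e2. *)
Definition arc_eval (f : {mpoly k[n]}) : {poly k} := mmap (@polyC k) arc_coord f.

Lemma arc_evalX j : arc_eval 'X_j = arc_coord j.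
Proof. by rewrite /arc_eval mmapX mmap1U. Qed.

Lemma arc_evalZ c f : arc_eval (c *: f) = c%:P * arc_eval f.
Proof. exact: mmapZ. Qed.

Lemma arc_evalM f g : arc_eval (f * g) = arc_eval f * arc_eval g.
Proof. exact: rmorphM. Qed.

Lemma arc_eval_sum (I : Type) (r : seq I) (P : pred I) F :
  arc_eval (\sum_(i <- r | P i) F i) = \sum_(i <- r | P i) arc_eval (F i).
Proof. exact: raddf_sum. Qed.

End ArcEval.

Section Nilpotency.
Variables (k : closedFieldType) (m : nat) (Z : subscheme k m) (p : proj_pt k m).
Local Notation e0 := (hcoord p).
Hypothesis hsupp : forall q, supp Z q <-> q = p.
Variables (t0 r : nat).
Hypothesis hZ : forall t, (t0 <= t)%N -> (hilbert Z t <= r)%N.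
Variable (l0 : 'cV[k]_m.+1).
Hypothesis l01 : lval l0 e0 = 1.
Local Notation y0 := (lf l0).

Let y j : {mpoly k[m.+1]} := 'X_j - e0 0 j *: y0.

Let y_homog j : y j \is 1.-homog.
Proof.
by rewrite rpredB ?rpredZ ?lf_homog // dhomogX; apply/eqP/mdeg1.
Qed.

Let y_eval j (v : 'rV[k]_m.+1) : (y j).@[v 0] = v 0 j - e0 0 j * lval l0 v.
Proof. by rewrite /y mevalB mevalXU mevalZ lf_eval. Qed.

(** Otherwise the chart of this form would be nonempty, and a zero of the
    ideal there would give a second point of the support. *)
Lemma y_nil j : exists N, Z (y j ^+ N).
Proof.
apply: contrapT => hN.
have np : ~ chart Z (y j) 1.
  by apply: (chart_proper (y_homog j)) => N ZN; apply: hN; exists N.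
have [a ha] := @ideal_zero k _ r _ (chart_dep (y_homog j) hZ) np.
have ya : (y j).@[a 0] = 1.
  by have := ha _ (chart_y Z (y j)); rewrite mevalB meval1 => /eqP; rewrite subr_eq0 => /eqP.
have a0 : a != 0.
  apply/eqP => a0; move: ya; rewrite y_eval a0 mxE lvalE big1 => [|i _]; last by rewrite mxE mul0r.
  by rewrite mulr0 subrr => /esym/eqP; rewrite oner_eq0.
have [q qZ qa] := supp_of_zero a0 (fun f Zf => ha f (chart_sch (y j) Zf)).
move/hsupp: qZ qa => -> /vlineP[c Ec].
have c0 : c != 0 by apply/eqP => c0; have := hcoord_neq0 p; rewrite Ec c0 scale0r eqxx.
have : (y j).@[e0 0] = 0 by rewrite y_eval l01 mulr1 subrr.
rewrite Ec (homog_scale_eval _ _ (y_homog j)) ya mulr1 expr1 => /eqP.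
by rewrite (negbTE c0).
Qed.

(** Modulo [y0] every variable is congruent to one of the nilpotent forms, so a power of
    every variable multiplies [f] into [Z], and [Z] is saturated. *)
Lemma nonzerodivisor f : Z (y0 * f) -> Z f.
Proof.
move=> h; apply: sideal_sat => i; have [N ZN] := y_nil i; exists N.
pose J := colon (sch_ideal Z) f.
apply: (@mideal_congr _ _ J ('X_i ^+ N) (y i ^+ N)); last exact: (@midealMr _ _ (sch_ideal Z) _ f ZN).
apply: mideal_congrX; rewrite /y subKr; exact: midealZ.
Qed.

Lemma nonzerodivisorX N f : Z (y0 ^+ N * f) -> Z f.
Proof.
elim: N => [|N IH]; first by rewrite mul1r.
by rewrite exprS -mulrA => /nonzerodivisor.
Qed.

Lemma zc_nil : exists N : 'I_m.+1 -> nat, forall j, chart Z y0 (zc e0 j ^+ N j).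
Proof.
suff h j : exists N, chart Z y0 (zc e0 j ^+ N) by have [N hN] := choice h; exists N.
have [N ZN] := y_nil j; exists N.
apply: mideal_congr (chart_sch _ ZN); apply: mideal_congrX.
have -> : zc e0 j - y j = (e0 0 j)%:MP * (y0 - 1).
  by rewrite /zc /y -mul_mpolyC; ring.
by apply: midealM; apply: chart_y.
Qed.

Lemma mpow_chart : exists N, forall f, mpow (chart Z y0) (zc e0) N f -> chart Z y0 f.
Proof.
have [N hN] := zc_nil; exists (\sum_j N j)%N => f Mf.
rewrite -[f]mul1r; apply: mpow_nil Mf => // j.
by rewrite mulr1.
Qed.

End Nilpotency.

(** * Parametrization of a curvilinear scheme of length three *)

Lemma subspace_form_prop (k : fieldType) (n : nat) (J : mideal k n) (z : 'I_n -> {mpoly k[n]}) :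
  subspace_prop (fun g : 'rV[k]_n => J (\sum_j g 0 j *: z j)).
Proof.
split=> [|a u v hu hv].
  by rewrite big1 => [|j _]; [apply: mideal0 | rewrite mxE scale0r].
under eq_bigr do rewrite !mxE scalerDl -scalerA.
by rewrite big_split -scaler_sumr; apply: midealD => //; apply: midealZ.
Qed.

Section Curve.
Variables (k : closedFieldType) (m : nat) (Z : subscheme k m) (p : proj_pt k m).
Local Notation e0 := (hcoord p).
Hypothesis hsupp : forall q, supp Z q <-> q = p.
Variable (t0 : nat).
Hypothesis hZ : forall t, (t0 <= t)%N -> hilbert Z t = 3.
Hypothesis htan : (\dim (tangent Z p) <= 2)%N.
Variable (l0 : 'cV[k]_m.+1).
Hypothesis l01 : lval l0 e0 = 1.
Local Notation y0 := (lf l0).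
Local Notation I := (chart Z y0).
Local Notation z := (zc e0).
Local Notation M := (mpow I z).

Let hZ' t : (t0 <= t)%N -> (hilbert Z t <= 3)%N.
Proof. by move/hZ ->. Qed.

Let pZ : supp Z p. Proof. exact/hsupp. Qed.

Lemma lf_zc (l : 'cV[k]_m.+1) : \sum_j l j 0 *: z j = lf l - (lval l e0)%:MP.
Proof.
rewrite /lf lvalE rmorph_sum -sumrB; apply: eq_bigr => j _ /=.
by rewrite /zc -!mul_mpolyC mpolyCM; ring.
Qed.

(** The tangent space has dimension at most two and contains e0, on which [l0] does not
    vanish. *)
Lemma tangent_line : exists w : 'rV[k]_m.+1, forall v,
  v \in tangent Z p -> lval l0 v = 0 -> v \in <[w]>%VS.
Proof.
have [[w [wT w0 wn]]|h] := pselect (exists w, [/\ w \in tangent Z p, lval l0 w = 0 & w != 0]);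
    last first.
  exists 0 => v vT v0; have [->|vn] := eqVneq v 0; first exact: mem0v.
  by case: h; exists v.
exists w => v vT v0.
have ew : e0 \notin <[w]>%VS.
  apply/negP => /vlineP[c Ec]; move: l01; rewrite Ec lvalZr w0 mulr0.
  by move/esym/eqP; rewrite oner_eq0.
have /subvP/(_ v vT) := line_sub htan wn ew wT (euler_tangent pZ).
move=> /memv_addP[u /vlineP[a ->] [u' /vlineP[b ->] E]].
move: v0; rewrite E lvalDr !lvalZr w0 l01 mulr0 add0r mulr1 => ->.
by rewrite scale0r addr0; apply: memvZ; apply: memv_line.
Qed.

(** The linear relations that hold modulo second order terms include the differentials
    of the elements of [Z] and that of [l0]; their common kernel is at most the line of w.
    Dually, every linear form that vanishes on w is such a relation, and each coordinate
    is proportional to a single one, tau. *)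
Lemma tangent_param : exists w t : 'rV[k]_m.+1, forall j,
  M 2 (z j - w 0 j *: \sum_i t 0 i *: z i).
Proof.
have [w hw] := tangent_line.
pose E := prop_vspace (subspace_form_prop (M 2) z).
have Eperp (g : 'rV[k]_m.+1) : \sum_j g 0 j * w 0 j = 0 -> g \in E.
  move=> gw; apply: contraT => gE.
  have [l [lE lg]] := exists_form_sep gE.
  have : l^T \in <[w]>%VS.
    apply: hw.
      rewrite mem_prop_vspace; apply/asboolP => f Zf.
      have : (\row_j (f^`M(j)).@[e0 0]) \in E.
        rewrite mem_prop_vspace; apply/asboolP.
        have -> : \sum_j (\row_j (f^`M(j)).@[e0 0]) 0 j *: z j = dlin e0 f.
          by apply: eq_bigr => j _; rewrite mxE.
        have := taylorP I e0 f; rewrite /taylor (pZ Zf) mpolyC0 subr0.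
        move=> /mideal_congr_sym h; apply: mideal_congr h _.
        by apply: mpow_sub; apply: chart_sch.
      by move/lE; rewrite lvalE => h; rewrite -[RHS]h; apply: eq_bigr => j _; rewrite !mxE.
    have : l0^T \in E.
      rewrite mem_prop_vspace; apply/asboolP.
      have -> : \sum_j l0^T 0 j *: z j = y0 - 1.
        rewrite -[1](mpolyC1 m.+1 k) -l01 -lf_zc; apply: eq_bigr => j _.
        by rewrite mxE.
      by apply: mpow_sub; apply: chart_y.
    by move/lE; rewrite !lvalE => h; rewrite -[RHS]h; apply: eq_bigr => j _; rewrite !mxE mulrC.
  move=> /vlineP[c Ec].
  have : lval l g = 0.
    transitivity (c * \sum_j g 0 j * w 0 j); last by rewrite gw mulr0.
    rewrite lvalE mulr_sumr; apply: eq_bigr => j _.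
    have -> : l j 0 = l^T 0 j by rewrite mxE.
    by rewrite Ec mxE mulrCA.
  by rewrite lg => /eqP; rewrite oner_eq0.
have EM (g : 'rV[k]_m.+1) : \sum_j g 0 j * w 0 j = 0 -> M 2 (\sum_j g 0 j *: z j).
  by move/Eperp; rewrite mem_prop_vspace => /asboolP.
have [w0|wn] := eqVneq w 0.
  exists w, 0 => j; rewrite w0 mxE scale0r subr0.
  have -> : z j = \sum_i (delta_mx 0 j : 'rV[k]_m.+1) 0 i *: z i.
    rewrite (bigD1 j) //= mxE !eqxx scale1r big1 ?addr0 // => i ne.
    by rewrite mxE eqxx (negbTE ne) scale0r.
  by apply: EM; rewrite big1 // => i _; rewrite w0 [(0 : 'rV__) _ _]mxE mulr0.
have [j0 wj0] : exists j0, w 0 j0 != 0.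
  apply/existsP; apply: contraT => /existsPn h; case/eqP: wn; apply/rowP => j.
  by rewrite [RHS]mxE; apply/eqP; move: (h j); rewrite negbK.
exists w, ((w 0 j0)^-1 *: delta_mx 0 j0) => j.
have sumd (i : 'I_m.+1) (F : 'I_m.+1 -> {mpoly k[m.+1]}) :
    \sum_j (delta_mx 0 i : 'rV[k]_m.+1) 0 j *: F j = F i.
  rewrite (bigD1 i) //= mxE !eqxx scale1r big1 ?addr0 // => i' ne.
  by rewrite mxE eqxx (negbTE ne) scale0r.
have sumk (i : 'I_m.+1) (F : 'I_m.+1 -> k) :
    \sum_j (delta_mx 0 i : 'rV[k]_m.+1) 0 j * F j = F i.
  rewrite (bigD1 i) //= mxE !eqxx mul1r big1 ?addr0 // => i' ne.
  by rewrite mxE eqxx (negbTE ne) mul0r.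
have rowB (A B : 'rV[k]_m.+1) c i (x : {mpoly k[m.+1]}) :
    (A - c *: B) 0 i *: x = A 0 i *: x - c *: (B 0 i *: x).
  by rewrite !mxE scalerBl scalerA.
have rowBk (A B : 'rV[k]_m.+1) c i (x : k) :
    (A - c *: B) 0 i * x = A 0 i * x - c * (B 0 i * x).
  by rewrite !mxE mulrBl mulrA.
have rowZ (B : 'rV[k]_m.+1) c i (x : {mpoly k[m.+1]}) :
    (c *: B) 0 i *: x = c *: (B 0 i *: x).
  by rewrite !mxE scalerA.
have -> : z j - w 0 j *: \sum_i ((w 0 j0)^-1 *: delta_mx 0 j0 : 'rV[k]_m.+1) 0 i *: z i =
   \sum_i (delta_mx 0 j - (w 0 j / w 0 j0) *: delta_mx 0 j0 : 'rV[k]_m.+1) 0 i *: z i.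
  under [in RHS]eq_bigr => i _ do rewrite rowB.
  rewrite sumrB sumd -scaler_sumr sumd; congr (_ - _).
  under eq_bigr => i _ do rewrite rowZ.
  by rewrite -scaler_sumr sumd scalerA.
apply: EM; under eq_bigr => i _ do rewrite rowBk.
by rewrite sumrB sumk -mulr_sumr sumk divfK // subrr.
Qed.

Lemma mpow_le n (I' : mideal k n) (z' : 'I_n -> {mpoly k[n]}) i f :
  mpow I' z' i.+1 f -> mpow I' z' i f.
Proof.
elim: i f => [//|i IH] f [g [hg If]]; exists g; split=> // j; exact: IH.
Qed.

Lemma mpow_leD n (I' : mideal k n) (z' : 'I_n -> {mpoly k[n]}) i j f :
  mpow I' z' (j + i) f -> mpow I' z' i f.
Proof. by elim: j => // j IH; rewrite addSn => /mpow_le/IH. Qed.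

Section Param.
Variables (w t : 'rV[k]_m.+1).
Definition tau : {mpoly k[m.+1]} := \sum_i t 0 i *: z i.
Hypothesis hw : forall j, M 2 (z j - w 0 j *: tau).

Definition in_tau (q : {poly k}) : {mpoly k[m.+1]} := (map_poly (@mpolyC m.+1 k) q).[tau].

Lemma in_tau_wide n (q : {poly k}) : (size q <= n)%N -> in_tau q = \sum_(i < n) q`_i *: tau ^+ i.
Proof.
move=> le; rewrite /in_tau (horner_coef_wide _ (leq_trans (size_poly _ _) le)).
by apply: eq_bigr => i _; rewrite coef_map /= mul_mpolyC.
Qed.

Lemma in_tau_trunc n (q : {poly k}) : I (tau ^+ n) -> I (in_tau q - \sum_(i < n) q`_i *: tau ^+ i).
Proof.
move=> h; rewrite (@in_tau_wide (n + size q)) ?leq_addl // big_split_ord /=.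
rewrite [X in X - _]addrC addrK; apply: mideal_sum => i _; apply: midealZ.
by rewrite exprD; apply: midealMr.
Qed.

Lemma tau_mpow1 : M 1 tau.
Proof. by apply: mideal_sum => i _; apply: midealZ; apply: mpow1_z. Qed.

(** The n-th power of the maximal ideal is generated by tau^n modulo the next one, since
    each generator is a multiple of tau up to second order. *)
Lemma tau_step n f : M n f -> exists c, M n.+1 (f - c *: tau ^+ n).
Proof.
elim: n f => [|n IH] f.
  move=> _; exists f.@[e0 0]; rewrite expr0 -mul_mpolyC mulr1.
  rewrite -(subrK (dlin e0 f) (f - _)); apply: midealD; last exact: dlin_mpow1.
  apply: mpow_le; exact: taylorP.
move=> [g [hg If]].
have /choice[c hc] : forall j, exists c, M n.+1 (g j - c *: tau ^+ n) by move=> j; apply: IH.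
exists (\sum_j c j * w 0 j).
have -> : f - (\sum_j c j * w 0 j) *: tau ^+ n.+1 =
   (f - \sum_j z j * g j) + \sum_j z j * (g j - c j *: tau ^+ n) +
   \sum_j c j *: ((z j - w 0 j *: tau) * tau ^+ n).
  rewrite scaler_suml -addrA -big_split -addrA; congr (_ + _).
  rewrite -!sumrN -big_split; apply: eq_bigr => j _ /=.
  by rewrite exprS -!mul_mpolyC mpolyCM; ring.
apply: midealD; first apply: midealD; first exact: mpow_sub.
  by apply: mideal_sum => j _; apply: mpow_z.
apply: mideal_sum => j _; apply: midealZ.
by apply: (@mpowM _ _ I z 2 n) => //; apply: mpowX; apply: tau_mpow1.
Qed.

Lemma tau_expand i n f : M n f -> exists q, M (i + n) (f - tau ^+ n * in_tau q).
Proof.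
elim: i n f => [|i IH] n f Mf.
  by exists 0; rewrite /in_tau rmorph0 horner0 mulr0 subr0.
have [c /IH[q hq]] := tau_step Mf; exists (c%:P + 'X * q).
rewrite addSnnS; suff -> : f - tau ^+ n * in_tau (c%:P + 'X * q) =
  f - c *: tau ^+ n - tau ^+ n.+1 * in_tau q by [].
rewrite /in_tau rmorphD rmorphM /= map_polyC map_polyX hornerD hornerM hornerC hornerX.
by rewrite -mul_mpolyC exprSr /=; ring.
Qed.

Lemma tau_poly n f : M n f -> exists q, I (f - tau ^+ n * in_tau q).
Proof.
move=> Mf; have [N hN] := mpow_chart hsupp hZ' l01.
have [q hq] := tau_expand N Mf; exists q; apply: hN.
by apply: (@mpow_leD _ _ _ _ n); rewrite addnC.
Qed.

Lemma tau_nil : exists N, I (tau ^+ N).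
Proof.
have [N hN] := mpow_chart hsupp hZ' l01; exists N; apply: hN; apply: mpowX; exact: tau_mpow1.
Qed.

(** Otherwise 1 and tau would span the coordinate ring, whose dimension is at least three. *)
Lemma tau2_notin : ~ I (tau ^+ 2).
Proof.
move=> h2; have := hilbert_indep Z t0; rewrite hZ // => -[F [hF indF]].
have /choice[q hq] : forall i : 'I_3, exists q, I (F i - in_tau q).
  by move=> i; have [|q] := @tau_poly 0 (F i); [|exists q; rewrite -[in_tau q]mul1r].
have [|c [[i ci]]] := @codim_dep k 'rV[k]_2 0%VS 2 (fun i => \row_(j < 2) (q i)`_j).
  by rewrite dimv0 subn0 dimvf /dim /= mul1n.
rewrite memv0 => /eqP c0; case/negP: ci; apply/eqP; apply: indF.
have sumq (j : 'I_2) : \sum_i c i * (q i)`_j = 0.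
  move/rowP/(_ j): c0; rewrite summxE mxE => E; rewrite -[RHS]E.
  by apply: eq_bigr => i' _; rewrite !mxE.
have Ic : I (\sum_i c i *: F i).
  have -> : \sum_i c i *: F i = \sum_i c i *: (F i - \sum_(j < 2) (q i)`_j *: tau ^+ j).
    under [RHS]eq_bigr do rewrite scalerBr.
    rewrite sumrB [X in _ - X](_ : _ = 0) ?subr0 //.
    under eq_bigr do rewrite scaler_sumr; rewrite exchange_big big1 // => j _ /=.
    under eq_bigr do rewrite scalerA; by rewrite -scaler_suml sumq scale0r.
  apply: mideal_sum => j _; apply: midealZ.
  exact: mideal_trans (hq j) (in_tau_trunc _ h2).
have [|N] := chart_homog (lf_homog l0) _ Ic (t := t0).
  by apply: rpred_sum => j _; apply: rpredZ; apply: hF.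
exact: (nonzerodivisorX hsupp hZ' l01).
Qed.

(** Multiplying a relation between powers of tau by a power of tau isolates its lowest
    term, since the other terms move into degrees that already lie in [I]. *)
Lemma lowest_term n (c : 'I_n -> k) i0 : c i0 != 0 -> I (\sum_i c i *: tau ^+ i) ->
  exists i : 'I_n, forall N, I (tau ^+ N.+1) -> (i <= N)%N -> I (tau ^+ N).
Proof.
move=> ci0 Ic; have [i ci imin] := @arg_minnP _ i0 (fun i => c i != 0) (@nat_of_ord n) ci0.
exists i => N hN le; rewrite -[tau ^+ N]scale1r -(mulVf ci) -scalerA; apply: midealZ.
have : I (tau ^+ (N - i) * \sum_i c i *: tau ^+ i) by apply: midealM.
rewrite mulr_sumr (bigD1 i) //= -scalerAr -exprD subnK // => h.
rewrite -[_ *: _](addrK (\sum_(j < n | j != i) tau ^+ (N - i) * (c j *: tau ^+ j))).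
apply: midealB => //; apply: mideal_sum => j ji; rewrite -scalerAr -exprD.
have [->|cj] := eqVneq (c j) 0; first by rewrite scale0r; apply: mideal0.
apply: midealZ; have lij : (i < j)%N by rewrite ltn_neqAle imin // andbT eq_sym.
have le' : (N.+1 <= N - i + j)%N by lia.
by rewrite -(subnK le') exprD; apply: midealM.
Qed.

(** The least N with tau^N in the ideal is at most three, because four powers of tau are
    dependent. *)
Lemma tau3_in : I (tau ^+ 3).
Proof.
have [N0 hN0] := tau_nil.
have hex : exists N, `[< I (tau ^+ N) >] by exists N0; apply/asboolP.
case: (ex_minnP hex) => N /asboolP hN Nmin.
have [c [[i ci] Ic]] := chart_dep (lf_homog l0) hZ' (fun i : 'I_4 => tau ^+ i).
have [j hj] := lowest_term ci Ic.
have [le|lt] := leqP N 3; first by rewrite -(subnK le) exprD; apply: midealM.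
case: N lt hN Nmin => // N lt hN Nmin.
have : (N.+1 <= N)%N; last by rewrite ltnn.
apply: Nmin; apply/asboolP; apply: hj => //.
by apply: leq_trans (lt : (3 <= N)%N); rewrite -ltnS.
Qed.

Lemma tau_indep (c : 'I_3 -> k) : I (\sum_i c i *: tau ^+ i) -> forall i, c i = 0.
Proof.
move=> Ic i; apply/eqP; apply: contraT => ci; have [j hj] := lowest_term ci Ic.
by case: tau2_notin; apply: hj; [exact: tau3_in | rewrite -ltnS].
Qed.

Lemma in_tau_coef (q : {poly k}) : I (in_tau q) -> forall i, (i < 3)%N -> q`_i = 0.
Proof.
move=> Iq i lt; apply: (tau_indep (c := fun i : 'I_3 => q`_i) _ (Ordinal lt)).
by apply: mideal_congr Iq; apply: mideal_congr_sym; apply: in_tau_trunc; apply: tau3_in.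
Qed.

Lemma curve_param : exists w' : 'rV[k]_m.+1, forall j,
  I (z j - (w 0 j *: tau + w' 0 j *: tau ^+ 2)).
Proof.
have /choice[c hc] : forall j, exists c, I (z j - (w 0 j *: tau + c *: tau ^+ 2)).
  move=> j; have [q hq] := tau_poly (hw j); exists q`_0.
  have -> : z j - (w 0 j *: tau + q`_0 *: tau ^+ 2) =
    z j - w 0 j *: tau - tau ^+ 2 * in_tau q + tau ^+ 2 * (in_tau q - q`_0 *: 1).
    by rewrite -!mul_mpolyC; ring.
  apply: midealD => //.
  have -> : in_tau q - q`_0 *: 1 = (in_tau q - \sum_(i < 3) q`_i *: tau ^+ i) +
      tau * (q`_1 *: 1 + q`_2 *: tau).
    rewrite !big_ord_recl big_ord0 /= expr0 expr1 /bump /= -!mul_mpolyC; ring.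
  rewrite mulrDr; apply: midealD; first by apply: midealM; apply: in_tau_trunc; apply: tau3_in.
  by rewrite mulrA -exprSr; apply: midealMr; apply: tau3_in.
by exists (\row_j c j) => j; rewrite mxE.
Qed.

End Param.

(** Modulo the ideal of the chart the coordinates are those of gamma(tau), so [f] is
    congruent to f(gamma(tau)), and 1, tau, tau^2 are independent. *)
Theorem arc_exists : exists e1 e2 : 'rV[k]_m.+1, e1 \notin <[e0]>%VS /\
  forall f, Z f -> forall i, (i < 3)%N -> (arc_eval e0 e1 e2 f)`_i = 0.
Proof.
have [w [t hw]] := tangent_param; have [w' hw'] := curve_param hw.
have ph (f : {mpoly k[m.+1]}) : I (f - in_tau t (arc_eval e0 w w' f)).
  have -> : in_tau t (arc_eval e0 w w' f) = mmap (@mpolyC m.+1 k)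
      (fun j => (e0 0 j)%:MP + (w 0 j *: tau t + w' 0 j *: tau t ^+ 2)) f.
    rewrite /in_tau /arc_eval /mmap raddf_sum horner_sum; apply: eq_bigr => x _ /=.
    rewrite rmorphM /= hornerM map_polyC hornerC; congr (_ * _).
    rewrite /mmap1 rmorph_prod horner_prod; apply: eq_bigr => j _ /=.
    rewrite rmorphXn /= horner_exp; congr (_ ^+ _).
    rewrite /arc_coord !rmorphD !rmorphM ?rmorphXn /= !map_polyC ?map_polyXn ?map_polyX /=.
    by rewrite !(hornerD, hornerM, hornerC, hornerXn, hornerX) -!mul_mpolyC -addrA.
  have {1}-> : f = mmap (@mpolyC m.+1 k) (fun i => 'X_i) f.
    rewrite -[LHS]comp_mpoly_id /comp_mpoly; apply: eq_bigr => x _; congr (_ * _).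
    by apply: mmap1_eq => i; rewrite tnth_mktuple.
  by apply: mideal_congr_mmap => j; rewrite opprD addrA; apply: hw'.
have Zi f : Z f -> forall i, (i < 3)%N -> (arc_eval e0 w w' f)`_i = 0.
  move=> Zf; apply: (in_tau_coef hw).
  by apply: mideal_congr (chart_sch _ Zf); apply: mideal_congr_sym; apply: ph.
exists w, w'; split=> //.
have lin (l : 'cV[k]_m.+1) : I (lf l - (lval l e0)%:MP - (lval l w *: tau t + lval l w' *: tau t ^+ 2)).
  rewrite -lf_zc !lvalE !scaler_suml -big_split -sumrB; apply: mideal_sum => j _ /=.
  rewrite [w 0 j * _]mulrC [w' 0 j * _]mulrC -!scalerA -scalerDr -scalerBr.
  by apply: midealZ; apply: hw'.
have indep a b c : I (a *: 1 + b *: tau t + c *: tau t ^+ 2) -> [/\ a = 0, b = 0 & c = 0].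
  move=> h; have := @tau_indep w t hw (fun i : 'I_3 => [:: a; b; c]`_i).
  rewrite !big_ord_recl big_ord0 /= addr0 addrA => /(_ h) h'.
  by split; [apply: (h' ord0) | apply: (h' (lift ord0 ord0)) | apply: (h' ord_max)].
apply/negP => /vlineP[c Ec].
have lw0 : lval l0 w = 0.
  have := lin l0; rewrite l01 mpolyC1 => /(midealB (chart_y Z y0)); rewrite subKr => h.
  by have [|] := indep 0 (lval l0 w) (lval l0 w'); rewrite ?scale0r ?add0r.
have w0 : w = 0 by move: lw0; rewrite Ec lvalZr l01 mulr1 => ->; rewrite scale0r.
have := lin t^T; rewrite -lf_zc.
have -> : \sum_j t^T j 0 *: zc e0 j = tau t by apply: eq_bigr => j _; rewrite mxE.
rewrite w0 -(scale0r 0) lvalZr mul0r scale0r add0r => h.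
have [|_ /eqP] := indep 0 1 (- lval t^T w'); last by rewrite oner_eq0.
by rewrite scale0r add0r scale1r scaleNr.
Qed.

End Curve.

(** * The ideal of an arc *)

Definition low0 (k : fieldType) (j : nat) (q : {poly k}) := forall i, (i < j)%N -> q`_i = 0.

Section Low.
Variables (k : fieldType) (j : nat).
Implicit Types (q u : {poly k}).

Lemma low0_0 : low0 j (0 : {poly k}).
Proof. by move=> i _; rewrite coef0. Qed.

Lemma low0D q u : low0 j q -> low0 j u -> low0 j (q + u).
Proof. by move=> hq hu i lt; rewrite coefD hq // hu // addr0. Qed.

Lemma low0M u q : low0 j q -> low0 j (u * q).
Proof.
move=> hq i lt; rewrite coefM big1 // => i' _; rewrite hq ?mulr0 //.
exact: leq_ltn_trans (leq_subr _ _) lt.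
Qed.

Lemma low0_unit u q : u`_0 != 0 -> low0 j (u * q) -> low0 j q.
Proof.
move=> u0 h i; elim/ltn_ind: i => i IH lt.
have := h i lt; rewrite coefM big_ord_recl /= subn0 big1 ?addr0 => [/eqP|i' _].
  by rewrite mulf_eq0 (negbTE u0) => /eqP.
rewrite /bump /= IH ?mulr0 //; first by have := ltn_ord i'; lia.
by apply: leq_ltn_trans (leq_subr _ _) lt.
Qed.

End Low.

Lemma sch_homogP (k : fieldType) (n : nat) (Z : subscheme k n) f :
  Z f <-> forall t, Z (pihomog mdeg t f).
Proof.
split=> [Zf t|h]; first exact: sideal_homog.
rewrite (pihomog_partitionE (leqnn (mmeasure mdeg f))).
by apply: (@mideal_sum _ _ (sch_ideal Z)) => t _; apply: h.
Qed.

Section ArcLinear.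
Variables (k : fieldType) (n : nat) (e0 e1 e2 : 'rV[k]_n.+1).

Lemma arc_eval_lf l : arc_eval e0 e1 e2 (lf l) = arc_lin e0 e1 e2 l.
Proof.
rewrite /lf arc_eval_sum /arc_lin !lvalE !rmorph_sum !mulr_suml -!big_split /=.
apply: eq_bigr => j _; rewrite arc_evalZ arc_evalX /arc_coord !polyCM; ring.
Qed.

Lemma arc_eval_lfs ls : arc_eval e0 e1 e2 (lfs ls) = arc_prod e0 e1 e2 ls.
Proof.
rewrite /lfs /arc_prod [arc_eval _ _ _ _]rmorph_prod; apply: eq_bigr => l _.
exact: arc_eval_lf.
Qed.

Lemma arc_eval0 f : (arc_eval e0 e1 e2 f)`_0 = f.@[e0 0].
Proof.
rewrite /arc_eval -horner_coef0 /mmap mevalE horner_sum; apply: eq_bigr => x _.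
rewrite hornerM hornerC; congr (_ * _); rewrite /mmap1 horner_prod; apply: eq_bigr => j _.
by rewrite horner_exp /arc_coord !(hornerD, hornerM, hornerC, hornerXn, hornerX) !mulr0 !addr0.
Qed.

End ArcLinear.

Section JetScheme.
Variables (k : fieldType) (n : nat) (e0 e1 e2 : 'rV[k]_n.+1) (j : nat).
Hypothesis e0_neq0 : e0 != 0.

(** The scheme-theoretic image of Spec k[t]/(t^j) under gamma. *)
Program Definition jet_sch : subscheme k n := @Subscheme k n
  (fun f => forall t, low0 j (arc_eval e0 e1 e2 (pihomog mdeg t f))) _ _ _ _ _.
Next Obligation. by move=> t; rewrite pihomog0 /arc_eval mmap0; apply: low0_0. Qed.
Next Obligation. by move=> f g hf hg t; rewrite pihomogD /arc_eval mmapD; apply: low0D; [apply: hf | apply: hg]. Qed.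
Next Obligation.
move=> f g hg t.
rewrite (pihomog_partitionE (leqnn (mmeasure mdeg f))).
rewrite mulr_suml (linear_sum (pihomog mdeg t)) arc_eval_sum.
apply: (big_ind (low0 j)); [exact: low0_0 | exact: low0D |] => i _ /=.
rewrite (pihomogM _ _ (pihomogP _ _ _)); case: ifP => _.
  by rewrite arc_evalM; apply: low0M.
by rewrite /arc_eval mmap0; apply: low0_0.
Qed.
Next Obligation.
move=> t f hf t'; rewrite (pihomog_homog _ (pihomogP mdeg t f)).
by case: ifP => _; [apply: hf | rewrite /arc_eval mmap0; apply: low0_0].
Qed.
Next Obligation.
move=> f h t.
have [i vi] : exists i, e0 0 i != 0.
  apply/existsP; apply: contraT => /existsPn v0; case/eqP: e0_neq0.
  by apply/rowP => i; rewrite mxE; apply/eqP; move: (v0 i); rewrite negbK.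
have [N /(_ (N + t)%N)] := h i.
have hX : ('X_i : {mpoly k[n.+1]}) ^+ N \is N.-homog.
  by apply: yX_homog; rewrite dhomogX; apply/eqP/mdeg1.
rewrite (pihomogM _ _ hX) leq_addr addKn arc_evalM; apply: low0_unit.
by rewrite arc_eval0 rmorphXn /= mevalXU expf_neq0.
Qed.

Lemma jet_sch_homog t f : f \is t.-homog -> jet_sch f <-> low0 j (arc_eval e0 e1 e2 f).
Proof.
move=> hf; split=> [/(_ t)|h t']; rewrite (pihomog_homog _ hf) ?eqxx //.
by case: ifP => // _; rewrite /arc_eval mmap0; apply: low0_0.
Qed.

End JetScheme.

(** The ideal of [Z] is contained in the ideal of the arc by [arc_exists], and
    in large degree both have codimension three: the forms l0^T, l0^(T-1) l1 and l0^(T-2) l1^2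
    have independent jets. Saturation extends the equality to all degrees. *)
Lemma arc_ideal (k : closedFieldType) (m : nat) (Z : subscheme k m) :
  connected_sch Z -> curvilinear Z -> zero_dim_deg Z 3 ->
  exists p (e1 e2 : 'rV[k]_m.+1), e1 \notin <[hcoord p]>%VS /\
   forall t f, f \is t.-homog ->
    (Z f <-> low0 3 (arc_eval (hcoord p) e1 e2 f)).
Proof.
move=> hc hcurv [t0 hZ].
have hZ' t : (t0 <= t)%N -> (hilbert Z t <= 3)%N by move/hZ ->.
have [p hp] := supp_connected hZ' hc.
have [l0 l01] := exists_form_nz p.
have htan : (\dim (tangent Z p) <= 2)%N.
  by have := hcurv p (proj2 (hp p) erefl); rewrite /pdim; lia.
have [e1 [e2 [e1f hZf]]] := arc_exists hp hZ htan l01.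
exists p, e1, e2; split=> // t f hf; split; first by move=> Zf i; apply: hZf.
move=> f0; apply: sideal_sat => i.
pose T := (t0 + 2)%N; exists T.
have hX : ('X_i : {mpoly k[m.+1]}) ^+ T \is T.-homog.
  by apply: yX_homog; rewrite dhomogX; apply/eqP/mdeg1.
have hg := dhomogM hX hf; set g := _ * f in hg *.
have g0 : low0 3 (arc_eval (hcoord p) e1 e2 g) by rewrite arc_evalM; apply: low0M.
have [l1 [l10 l11]] := exists_form_sep e1f.
have {}l10 : lval l1 (hcoord p) = 0 by apply: l10; apply: memv_line.
pose F (i : 'I_4) : {mpoly k[m.+1]} :=
  if (i < 3)%N then lf l0 ^+ (T + t - i) * lf l1 ^+ i else g.
have [||c [[i0 ci0] Zc]] := @hilbert_dep _ _ Z (T + t) 3 F.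
- by apply: hZ'; rewrite /T; lia.
- move=> i'; rewrite /F; case: ifP => // lt.
  have := dhomogM (yX_homog (lf_homog l0) (T + t - i')) (yX_homog (lf_homog l1) i').
  by rewrite subnK // /T; lia.
move: (Zc) (hZf _ Zc).
rewrite !big_ord_recl big_ord0 addr0 /F /= /bump /=.
set a := lf l0; set b := lf l1; set c0 := c _; set c1 := c _; set c2 := c _; set c3 := c _.
move=> {}Zc low.
have pw q n : (q : {poly k})`_0 = 1 -> (q ^+ n)`_0 = 1.
  by move=> q0; rewrite -horner_coef0 horner_exp horner_coef0 q0 expr1n.
pose A := arc_eval (hcoord p) e1 e2 a; pose B := arc_eval (hcoord p) e1 e2 b.
have A0 : A`_0 = 1 by rewrite /A arc_eval_lf arc_lin0.
have B0 : B`_0 = 0 by rewrite /B arc_eval_lf arc_lin0.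
have B1 : B`_1 = 1 by rewrite /B arc_eval_lf arc_lin1.
have E j : (j < 3)%N ->
   c0 * (A ^+ (T + t))`_j + c1 * (A ^+ (T + t - 1) * B)`_j + c2 * (A ^+ (T + t - 2) * (B * B))`_j = 0.
  move=> lt; have := low j lt.
  rewrite /arc_eval !mmapD -![mmap _ _ _]/(arc_eval _ _ _ _) !arc_evalZ !coefD !coefCM g0 // mulr0 addr0.
  rewrite /arc_eval !rmorphM /= !rmorphXn /= -![mmap _ _ _]/(arc_eval _ _ _ _).
  by rewrite expr0 mulr1 expr1 subn0 addrA.
have c00 : c0 = 0.
  by have := E 0%N isT; rewrite !coef0M !pw // B0 mul0r !mulr0 !addr0 mulr1.
have c10 : c1 = 0.
  have := E 1%N isT; rewrite c00 mul0r add0r !coefM1 !coef0M B0 B1 !pw //.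
  by rewrite !(mul0r, mulr0, addr0, add0r, mulr1, mul1r).
have c20 : c2 = 0.
  have := E 2%N isT; rewrite c00 c10 !mul0r !add0r !coefM2 !coefM1 !coef0M B0 B1 !pw //.
  by rewrite !(mul0r, mulr0, addr0, add0r, mulr1, mul1r).
have c30 : c3 != 0.
  apply: contra ci0 => /eqP c3z; apply/eqP; case: i0 => [[|[|[|[|//]]]] lt].
  - by rewrite -[RHS]c00; congr c; apply: val_inj.
  - by rewrite -[RHS]c10; congr c; apply: val_inj.
  - by rewrite -[RHS]c20; congr c; apply: val_inj.
  - by rewrite -[RHS]c3z; congr c; apply: val_inj.
move: Zc; rewrite c00 c10 c20 !scale0r !add0r => /(@midealZ _ _ (sch_ideal Z) c3^-1).
by rewrite scalerA mulVf // scale1r.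
Qed.

(** * Points of the Veronese space as functionals on forms *)

Lemma vmon_inj m d : injective (@vmon m d).
Proof.
move=> i j /eqP; rewrite /vmon nth_uniq ?uniq_basis ?size_basis -?vdimE //.
by move/eqP/val_inj.
Qed.

Section Pairing.
Variables (k : fieldType) (m d : nat).
Local Notation N := (vdim m d).+1.
Implicit Types (v u : 'rV[k]_N) (F : {mpoly k[m.+1]}).

(** The vector [v] as a functional on forms of degree [d], in the basis of monomials. *)
Definition pair v F : k := \sum_i v 0 i * F@_(vmon i).

Lemma pairDl u v F : pair (u + v) F = pair u F + pair v F.
Proof. by rewrite /pair -big_split; apply: eq_bigr => i _; rewrite mxE mulrDl. Qed.

Lemma pairZl a v F : pair (a *: v) F = a * pair v F.
Proof. by rewrite /pair mulr_sumr; apply: eq_bigr => i _; rewrite mxE mulrA. Qed.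

Lemma pair_suml (I : Type) (r : seq I) (P : pred I) f F :
  pair (\sum_(i <- r | P i) f i) F = \sum_(i <- r | P i) pair (f i) F.
Proof.
elim/big_rec2: _ => [|i y1 y2 _ <-]; last by rewrite pairDl.
by rewrite /pair big1 // => i _; rewrite mxE mul0r.
Qed.

Lemma homog_vmonE F : F \is d.-homog -> F = \sum_(i < N) F@_(vmon i) *: 'X_[vmon i].
Proof.
move=> hF; apply/mpolyP => x; rewrite raddf_sum /=.
have [dx|dx] := eqVneq (mdeg x) d.
  have [i <-] := vmonP dx; rewrite (bigD1 i) //= mcoeffZ mcoeffX eqxx mulr1 big1 ?addr0 //.
  by move=> j ne; rewrite mcoeffZ mcoeffX (inj_eq (@vmon_inj m d)) (negbTE ne) mulr0.
rewrite (dhomog_nemf_coeff hF dx) big1 // => i _; rewrite mcoeffZ mcoeffX.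
by case: eqP => [E|]; rewrite ?mulr0 //; move: dx; rewrite -E mdeg_vmon eqxx.
Qed.

Lemma pair_ver (x : 'rV[k]_m.+1) F : F \is d.-homog -> pair (ver_vec d x) F = F.@[x 0].
Proof.
move=> hF; rewrite {2}(homog_vmonE hF) raddf_sum; apply: eq_bigr => i _ /=.
by rewrite mevalZ mevalX mxE mulrC.
Qed.

Definition form_of (l : 'cV[k]_N) : {mpoly k[m.+1]} := \sum_i l i 0 *: 'X_[vmon i].

Lemma form_of_homog l : form_of l \is d.-homog.
Proof. by apply: rpred_sum => i _; apply: rpredZ; rewrite dhomogX; apply/eqP/mdeg_vmon. Qed.

Lemma form_of_coef l i : (form_of l)@_(vmon i) = l i 0.
Proof.
rewrite /form_of raddf_sum (bigD1 i) //= mcoeffZ mcoeffX eqxx mulr1 big1 ?addr0 //.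
by move=> j ne; rewrite mcoeffZ mcoeffX (inj_eq (@vmon_inj m d)) (negbTE ne) mulr0.
Qed.

Lemma pair_form_of v l : pair v (form_of l) = lval l v.
Proof. by rewrite lvalE; apply: eq_bigr => i _; rewrite form_of_coef. Qed.

Lemma homog1E n (L : {mpoly k[n]}) : L \is 1.-homog -> L = lf (\col_j L@_U_(j)).
Proof.
move=> hL; apply/mpolyP => x; rewrite /lf raddf_sum /=.
have [dx|dx] := eqVneq (mdeg x) 1%N.
  have /existsP[i /eqP ->] : [exists i : 'I_n, x == U_(i)%MM] by rewrite -mdeg_eq1 dx.
  rewrite (bigD1 i) //= mcoeffZ mcoeffX mxE eqxx mulr1 big1 ?addr0 // => j ne.
  by rewrite mcoeffZ mcoeffX eq_mnm1 (negbTE ne) mulr0.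
rewrite (dhomog_nemf_coeff hL dx) big1 // => i _; rewrite mcoeffZ mcoeffX.
by case: eqP => [E|]; rewrite ?mulr0 //; move: dx; rewrite -E mdeg1.
Qed.

Lemma ver_pull_lf (l : 'cV[k]_N) : ver_pull (lf l) = form_of l.
Proof.
rewrite /ver_pull /lf raddf_sum; apply: eq_bigr => i _ /=.
by rewrite comp_mpolyZ comp_mpolyXU -tnth_nth tnth_mktuple.
Qed.

(** Linear forms on the Veronese space are forms of degree [d] on P^m. *)
Lemma mem_lspan_ver (Z : subscheme k m) v :
  v \in lspan (ver_sch d Z) <-> (forall F, F \is d.-homog -> Z F -> pair v F = 0).
Proof.
rewrite mem_prop_vspace; split=> [/asboolP h F hF ZF|h].
  pose l : 'cV[k]_N := \col_i F@_(vmon i).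
  have EF : form_of l = F.
    by rewrite [RHS](homog_vmonE hF); apply: eq_bigr => i _; rewrite mxE.
  rewrite -EF pair_form_of -lf_eval; apply: h; first exact: lf_homog.
  move=> t; rewrite (pihomog_homog _ (lf_homog l)); case: ifP => _.
    by rewrite ver_pull_lf EF.
  by rewrite /ver_pull comp_mpoly0; apply: sideal0.
apply/asboolP => L hL /(_ 1%N); rewrite (pihomog_homog _ hL) eqxx (homog1E hL) ver_pull_lf.
by rewrite lf_eval -pair_form_of; apply: h; apply: form_of_homog.
Qed.

Lemma mem_of_pair (U : {vspace 'rV[k]_N}) v :
  (forall F, F \is d.-homog -> (forall u, u \in U -> pair u F = 0) -> pair v F = 0) ->
  v \in U.
Proof.
move=> h; apply: contraT => vU; have [l [lU lv]] := exists_form_sep vU.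
have := h (form_of l) (form_of_homog l); rewrite pair_form_of lv => /(_ _)/eqP.
by rewrite oner_eq0 => -> // u uU; rewrite pair_form_of lU.
Qed.

Definition jet_vec (e0 e1 e2 : 'rV[k]_m.+1) i : 'rV[k]_N :=
  \row_j (arc_eval e0 e1 e2 'X_[vmon j])`_i.

Lemma pair_jet e0 e1 e2 i F : F \is d.-homog ->
  pair (jet_vec e0 e1 e2 i) F = (arc_eval e0 e1 e2 F)`_i.
Proof.
move=> hF; rewrite {2}(homog_vmonE hF) arc_eval_sum coef_sum; apply: eq_bigr => j _.
by rewrite mxE arc_evalZ coefCM mulrC.
Qed.

Lemma pline_ver (p : proj_pt k m) : pline (ver_pt d p) = <[ver_vec d (hcoord p)]>%VS.
Proof. by []. Qed.

Lemma mem_pspan_ver (B : {fset proj_pt k m}) v :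
  v \in pspan (ver_set d B) <->
  exists c : proj_pt k m -> k, v = \sum_(q <- B) c q *: ver_vec d (hcoord q).
Proof.
have E : pspan (ver_set d B) = (\sum_(q <- B) <[ver_vec d (hcoord q)]>)%VS.
  apply/eqP; rewrite eqEsubv /pspan; apply/andP; split.
    rewrite big_seq; elim/big_ind: _ => [|U1 U2 h1 h2|q]; rewrite ?sub0v ?subv_add ?h1 //.
    move=> /imfsetP[p /= pB ->]; rewrite pline_ver [X in (_ <= X)%VS](big_rem p) //=.
    exact: addvSl.
  rewrite big_seq; elim/big_ind: _ => [|U1 U2 h1 h2|q qB]; rewrite ?sub0v ?subv_add ?h1 //.
  rewrite [X in (_ <= X)%VS](big_rem (ver_pt d q)) ?addvSl //=.
  by apply/imfsetP; exists q.
rewrite E {E}; have := fset_uniq B; move: (enum_fset B) => s us; split.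
  elim: s us v => [_ v|q s IH /= /andP[qs us] v].
    by rewrite big_nil memv0 => /eqP ->; exists (fun=> 0); rewrite big_nil.
  rewrite big_cons => /memv_addP[u1 /vlineP[a ->] [u2 /(IH us)[c ->] ->]].
  exists (fun q' => if q' == q then a else c q'); rewrite big_cons eqxx; congr (_ + _).
  rewrite big_seq [RHS]big_seq; apply: eq_bigr => q' q's.
  by case: eqP q's qs => // -> ->.
move=> [c ->]; elim: {us} s => [|q s IH]; first by rewrite !big_nil mem0v.
by rewrite !big_cons memv_add // memvZ ?memv_line.
Qed.

End Pairing.

(** * Roots of unity and coefficients along an arc *)

Lemma prim_root_exists (k : closedFieldType) n : [pchar k] =i pred0 -> (0 < n)%N ->
  exists z : k, n.-primitive_root z.
Proof.
move=> c0 n0; have nz : n%:R != 0 :> k by rewrite (proj1 (pcharf0P k) c0) -lt0n.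
have [rs Ers] := closed_field_poly_normal ('X^n - 1 : {poly k}).
have lc : lead_coef ('X^n - 1 : {poly k}) = 1 by apply/eqP; rewrite -[_ == 1]/(_ \is monic) monicXnsubC.
rewrite lc scale1r in Ers.
have srs : size rs = n.
  by have := size_XnsubC (1 : k) n0; rewrite Ers size_prod_XsubC => -[].
have : has n.-primitive_root rs.
  apply: has_prim_root => //; last by rewrite srs.
    apply/allP => z zr; rewrite unity_rootE -subr_eq0.
    have : root ('X^n - 1) z by rewrite Ers root_prod_XsubC.
    by rewrite /root !(hornerD, hornerN, hornerC, hornerXn).
  by rewrite -separable_prod_XsubC -Ers separable_Xn_sub_1.
by case/hasP => z _ hz; exists z.
Qed.

(** The sum of z^(ij) over i vanishes unless n divides j, and the bound on the size of [p]
    leaves s as the only exponent in its residue class modulo n. *)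
Lemma coef_roots (k : fieldType) (z : k) n s (p : {poly k}) : n%:R != 0 :> k ->
  n.-primitive_root z -> (s < n)%N -> (size p <= n + s)%N ->
  \sum_(i < n) (n%:R^-1 * z ^+ (i * (n - s))) * p.[z ^+ i] = p`_s.
Proof.
move=> nz hz sn sp.
have root_sum j : \sum_(i < n) (z ^+ j) ^+ i = if (n %| j)%N then n%:R else 0.
  rewrite (prim_order_dvd hz); case: ifP => [/eqP E|nd].
    by under eq_bigr do rewrite E expr1n; rewrite sumr_const card_ord.
  have zj : z ^+ j - 1 != 0 by rewrite subr_eq0 nd.
  by apply: (mulfI zj); rewrite -subrX1 -exprM mulnC exprM (prim_expr_order hz) expr1n subrr mulr0.
under eq_bigr do rewrite (horner_coef_wide _ sp) mulr_sumr.
rewrite exchange_big /=.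
have E (j : 'I_(n + s)) : \sum_(i < n) n%:R^-1 * z ^+ (i * (n - s)) * (p`_j * z ^+ i ^+ j) =
    if (j == s :> nat) then p`_j else 0.
  have -> : \sum_(i < n) n%:R^-1 * z ^+ (i * (n - s)) * (p`_j * z ^+ i ^+ j) =
     n%:R^-1 * p`_j * \sum_(i < n) (z ^+ (n - s + j)) ^+ i.
    rewrite mulr_sumr; apply: eq_bigr => i _.
    rewrite -!exprM mulrACA -exprD; congr (_ * z ^+ _); lia.
  rewrite root_sum; case: eqP => [->|ne].
    by rewrite (subnK (ltnW sn)) dvdnn mulrAC mulVf // mul1r.
  rewrite ifF ?mulr0 //; apply/negP => /dvdnP[q Eq].
  have lj := ltn_ord j; move: q Eq lj sn ne; move: (nat_of_ord j) => j'; clear.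
  by case=> [|[|q]] Eq lj sn ne; nia.
under eq_bigr do rewrite E.
rewrite -big_mkcond /=.
have lt : (s < n + s)%N by rewrite -[X in (X < _)%N]add0n ltn_add2r; lia.
by rewrite (big_pred1 (Ordinal lt)).
Qed.

(** Reduces identities that are linear in a form to products of linear forms. *)
Lemma monomial_lfs (k : fieldType) n (x : 'X_{1..n}) : exists ls : seq 'cV[k]_n,
  size ls = mdeg x /\ 'X_[x] = lfs ls.
Proof.
rewrite mdegE mpolyXE_id.
pose Q e (f : {mpoly k[n]}) := exists ls : seq 'cV[k]_n, size ls = e /\ f = lfs ls.
apply: (big_ind2 Q).
- by exists [::]; rewrite /lfs big_nil.
- move=> e1 f1 e2 f2 [l1 [<- ->]] [l2 [<- ->]]; exists (l1 ++ l2).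
  by rewrite size_cat /lfs big_cat.
move=> i _; exists (nseq (x i) (delta_mx i 0)); rewrite size_nseq; split=> //.
rewrite /lfs big_nseq -[RHS]/(iter _ _ _) iter_mulr_1; congr (_ ^+ _).
rewrite /lf (bigD1 i) //= mxE !eqxx scale1r big1 ?addr0 // => j ne.
by rewrite mxE (negbTE ne) scale0r.
Qed.

Section JetIdentities.
Variables (k : fieldType) (m : nat).
Implicit Types (e x y : 'rV[k]_m.+1) (ls : seq 'cV[k]_m.+1).

Lemma arc_prod_cons e x y l ls :
  arc_prod e x y (l :: ls) = arc_lin e x y l * arc_prod e x y ls.
Proof. by rewrite /arc_prod big_cons. Qed.

Lemma lval0 (l : 'cV[k]_m.+1) : lval l 0 = 0.
Proof. by rewrite -(scale0r 0) lvalZr mul0r. Qed.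

Definition arc_prod_coefE := (arc_prod_cons, coef0M, coefM1, coefM2, arc_lin0, arc_lin1, arc_lin2, lval0).

Lemma arc_prod0 e x y ls : (arc_prod e x y ls)`_0 = (arc_prod e 0 0 ls)`_0.
Proof.
by elim: ls => [|l ls IH]; rewrite ?arc_prod_coefE ?IH // /arc_prod !big_nil.
Qed.

Lemma arc_prod1 e x y ls : (arc_prod e x y ls)`_1 = (arc_prod e x 0 ls)`_1.
Proof.
elim: ls => [|l ls IH]; last by rewrite !arc_prod_coefE IH arc_prod0 [in RHS]arc_prod0.
by rewrite /arc_prod !big_nil.
Qed.

(** The term in t^2 arises either from two terms in t or from one in t^2. *)
Lemma arc_prod2 e x y ls :
  (arc_prod e x y ls)`_2 = (arc_prod e x 0 ls)`_2 + (arc_prod e y 0 ls)`_1.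
Proof.
elim: ls => [|l ls IH]; first by rewrite /arc_prod !big_nil !coef1 addr0.
rewrite !arc_prod_coefE IH (arc_prod1 e x y) (arc_prod0 e x y) (arc_prod0 e x 0) (arc_prod0 e y 0); ring.
Qed.

Lemma arc_prod1D e x y ls :
  (arc_prod e (x + y) 0 ls)`_1 = (arc_prod e x 0 ls)`_1 + (arc_prod e y 0 ls)`_1.
Proof.
elim: ls => [|l ls IH]; first by rewrite /arc_prod !big_nil !coef1 addr0.
rewrite !arc_prod_coefE IH lvalDr (arc_prod0 e x 0) (arc_prod0 e y 0) (arc_prod0 e (x + y) 0); ring.
Qed.

Lemma arc_prod1Z e a x ls : (arc_prod e (a *: x) 0 ls)`_1 = a * (arc_prod e x 0 ls)`_1.
Proof.
elim: ls => [|l ls IH]; first by rewrite /arc_prod !big_nil !coef1 mulr0.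
rewrite !arc_prod_coefE IH lvalZr (arc_prod0 e x 0) (arc_prod0 e (a *: x) 0); ring.
Qed.

Lemma arc_prod1_e e ls : (arc_prod e e 0 ls)`_1 = (size ls)%:R * (arc_prod e 0 0 ls)`_0.
Proof.
elim: ls => [|l ls IH]; first by rewrite /arc_prod !big_nil !coef1 mul0r.
rewrite /= !arc_prod_coefE IH (arc_prod0 e e 0) -natr1; ring.
Qed.

(** The functional of the arc is a second order functional on the line e, e1 plus a
    first order one on the line through e and a combination of e, e1, e2. The
    multiple of the value at e is absorbed because the derivative along e itself is
    [size ls] times this value. *)
Lemma arc_prod_split e e1 e2 a b c ls : (size ls)%:R != 0 :> k ->
  a * (arc_prod e e1 e2 ls)`_0 + b * (arc_prod e e1 e2 ls)`_1 +
    c * (arc_prod e e1 e2 ls)`_2 =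
  c * (arc_prod e e1 0 ls)`_2 +
  (arc_prod e (c *: e2 + b *: e1 + (a / (size ls)%:R) *: e) 0 ls)`_1.
Proof.
move=> nz; set x := c *: e2; set y := b *: e1; set w := _ *: e.
have Ex : (arc_prod e x 0 ls)`_1 = c * (arc_prod e e2 0 ls)`_1 by apply: arc_prod1Z.
have Ey : (arc_prod e y 0 ls)`_1 = b * (arc_prod e e1 0 ls)`_1 by apply: arc_prod1Z.
have Ew : (arc_prod e w 0 ls)`_1 = a * (arc_prod e 0 0 ls)`_0.
  apply: etrans (arc_prod1Z _ _ _ _) _.
  by rewrite arc_prod1_e mulrA divfK.
clearbody x y w.
rewrite (arc_prod2 e e1 e2) (arc_prod1 e e1 e2) (arc_prod0 e e1 e2).
transitivity (c * (arc_prod e e1 0 ls)`_2 + (c * (arc_prod e e2 0 ls)`_1 +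
  b * (arc_prod e e1 0 ls)`_1 + a * (arc_prod e 0 0 ls)`_0)); first by ring.
congr (_ + _); symmetry; apply: etrans (arc_prod1D _ _ _ _) _; rewrite -Ew; congr (_ + _).
by apply: etrans (arc_prod1D _ _ _ _) _; rewrite -Ex -Ey.
Qed.

Lemma size_arc_prod e x ls : (size (arc_prod e x 0 ls) <= (size ls).+1)%N.
Proof.
elim: ls => [|l ls IH]; first by rewrite /arc_prod big_nil size_poly1.
rewrite arc_prod_cons (leq_trans (size_polyMleq _ _)) //.
have : (size (arc_lin e x 0 l) <= 2)%N.
  rewrite /arc_lin lval0 mul0r addr0 (leq_trans (size_polyD _ _)) // geq_max.
  rewrite (leq_trans (size_polyC_leq1 _)) // (leq_trans (size_polyMleq _ _)) //.
  by rewrite size_polyX addn2 /= ltnS size_polyC_leq1.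
by move=> h; rewrite -subn1 leq_subLR (leq_trans (leq_add h IH)).
Qed.

Lemma horner_arc_prod e x ls z :
  (arc_prod e x 0 ls).[z] = (lfs ls).@[(e + z *: x) 0].
Proof.
rewrite lfs_eval /arc_prod horner_prod; apply: eq_bigr => l _.
rewrite lvalDr lvalZr /arc_lin lval0 mul0r addr0 hornerD hornerM !hornerC hornerX.
by rewrite mulrC.
Qed.

End JetIdentities.

(** * A decomposition with 2d-1 points *)

Section VeroneseSpan.
Variables (k : fieldType) (m d : nat).

Lemma ver_vecZ (a : k) (v : 'rV[k]_m.+1) : ver_vec d (a *: v) = a ^+ d *: ver_vec d v.
Proof.
apply/rowP => i; rewrite !mxE.
transitivity (\prod_j (a ^+ vmon i j * v 0 j ^+ vmon i j)).
  by apply: eq_bigr => j _; rewrite mxE exprMn.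
by rewrite big_split prodrXr -mdegE mdeg_vmon.
Qed.

Lemma ver_vec_mon (v : 'rV[k]_m.+1) i : ver_vec d v 0 i = ('X_[vmon i] : {mpoly k[m.+1]}).@[v 0].
Proof. by rewrite mxE mevalX. Qed.

Lemma pspan_sub n (B B' : {fset proj_pt k n}) : (B `<=` B')%fset -> (pspan B <= pspan B')%VS.
Proof.
move=> /fsubsetP h; rewrite /pspan big_seq; elim/big_ind: _ => [|U1 U2 h1 h2|q qB].
- exact: sub0v.
- by rewrite subv_add h1.
by rewrite [X in (_ <= X)%VS](big_rem q) ?addvSl //= h.
Qed.

Lemma mem_pspan n (B : {fset proj_pt k n}) q : q \in B -> (pline q <= pspan B)%VS.
Proof. by move=> qB; rewrite /pspan (big_rem q) ?addvSl. Qed.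

Lemma ver_set_sub (B B' : {fset proj_pt k m}) : (B `<=` B')%fset ->
  (ver_set d B `<=` ver_set d B')%fset.
Proof.
by move=> /fsubsetP h; apply/fsubsetP => x /imfsetP[q /= /h qB ->]; apply/imfsetP; exists q.
Qed.

Lemma ver_span_list (vs : seq 'rV[k]_m.+1) : (0 < d)%N ->
  exists2 B : {fset proj_pt k m}, (#|` B| <= size vs)%N &
    forall v, v \in vs -> ver_vec d v \in pspan (ver_set d B).
Proof.
move=> d0; elim: vs => [|v vs [B cB hB]]; first by exists fset0; rewrite ?cardfs0.
have [v0|v0] := eqVneq v 0.
  exists B => [|x]; first exact: leqW.
  rewrite inE => /orP[/eqP -> |/hB //].
  by rewrite v0 -(scale0r 0) ver_vecZ expr0n (gtn_eqF d0) scale0r mem0v.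
have [q vq] : exists q : proj_pt k m, v \in pline q.
  have dv : \dim <[v]>%VS == 1%N by rewrite dim_vline v0.
  by exists (ProjPt dv); apply: memv_line.
exists (q |` B)%fset => [|x].
  by rewrite cardfsU1; apply: (@leq_add _ _ 1 (size vs)) => //; apply: leq_b1.
rewrite inE => /orP[/eqP ->|/hB]; last first.
  by apply/subvP/pspan_sub/ver_set_sub/fsubsetUr.
have /subvP : (pline (ver_pt d q) <= pspan (ver_set d (q |` B)%fset))%VS.
  by apply: mem_pspan; apply/imfsetP; exists q; rewrite ?fset1U1.
apply; rewrite pline_ver.
move: vq; rewrite plineE => /vlineP[a ->].
by rewrite ver_vecZ memvZ // memv_line.
Qed.

End VeroneseSpan.

Section Upper.
Variables (k : closedFieldType) (m d : nat).
Hypothesis char0 : [pchar k] =i pred0.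

(** After [arc_prod_split], [d.-1] roots of unity suffice for the second order part, since
    modulo d-1 only the exponent 2 is congruent to 2 in the range 0..d, and [d]
    roots of unity suffice for the first order part. *)
Lemma arc_upper (e0 e1 e2 : 'rV[k]_m.+1) a b c : (4 <= d)%N ->
  exists2 B : {fset proj_pt k m}, (#|` B| <= 2 * d - 1)%N &
   a *: jet_vec d e0 e1 e2 0 + b *: jet_vec d e0 e1 e2 1 + c *: jet_vec d e0 e1 e2 2
     \in pspan (ver_set d B).
Proof.
move=> d4.
have nz n : (0 < n)%N -> n%:R != 0 :> k.
  by move=> n0; rewrite (proj1 (pcharf0P k) char0) -lt0n.
have d0 : (0 < d)%N by lia.
have d1 : (0 < d.-1)%N by lia.
have [z hz] := prim_root_exists char0 d1.
have [y hy] := prim_root_exists char0 d0.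
pose e2' := c *: e2 + b *: e1 + (a / d%:R) *: e0.
pose vs1 := [seq e0 + z ^+ i *: e1 | i : 'I_d.-1].
pose vs2 := [seq e0 + y ^+ i *: e2' | i : 'I_d].
have [B cB hB] := @ver_span_list k m d (vs1 ++ vs2) d0.
exists B.
  by rewrite (leq_trans cB) // size_cat !size_map -!enumT !size_enum_ord; lia.
have -> : a *: jet_vec d e0 e1 e2 0 + b *: jet_vec d e0 e1 e2 1 + c *: jet_vec d e0 e1 e2 2 =
  c *: (\sum_(i < d.-1) ((d.-1)%:R^-1 * z ^+ (i * (d.-1 - 2))) *: ver_vec d (e0 + z ^+ i *: e1)) +
  \sum_(i < d) (d%:R^-1 * y ^+ (i * (d - 1))) *: ver_vec d (e0 + y ^+ i *: e2').
  apply/rowP => j; have [ls [sz E]] := monomial_lfs k (vmon (d := d) j).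
  rewrite mdeg_vmon in sz.
  have sp x : (size (arc_prod e0 x 0 ls) <= d.+1)%N by rewrite -sz; apply: size_arc_prod.
  transitivity (c * (arc_prod e0 e1 0 ls)`_2 + (arc_prod e0 e2' 0 ls)`_1).
    have := @arc_prod_split k m e0 e1 e2 a b c ls; rewrite sz => <-; last exact: nz.
    by rewrite !mxE E arc_eval_lfs.
  have z1 : (2 < d.-1)%N by lia.
  have z2 : (1 < d)%N by lia.
  rewrite -(coef_roots (nz _ d1) hz z1); last by apply: leq_trans (sp _) _; lia.
  rewrite -(coef_roots (nz _ d0) hy z2); last by apply: leq_trans (sp _) _; lia.
  rewrite !mxE !summxE; congr (c * _ + _); apply: eq_bigr => i _.
    by rewrite horner_arc_prod [in RHS]mxE ver_vec_mon E.
  by rewrite horner_arc_prod [in RHS]mxE ver_vec_mon E.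
apply: memvD; first apply: memvZ.
  apply: rpred_sum => i _; apply: memvZ; apply: hB; rewrite mem_cat; apply/orP; left.
  by apply/mapP; exists i; rewrite ?mem_enum.
apply: rpred_sum => i _; apply: memvZ; apply: hB; rewrite mem_cat; apply/orP; right.
by apply/mapP; exists i; rewrite ?mem_enum.
Qed.

End Upper.

(** * Lower bounds for decompositions *)

Lemma sum_fset_sub (T : choiceType) (V : zmodType) (A X : {fset T}) (F : T -> V) :
  (A `<=` X)%fset -> \sum_(q <- A) F q = \sum_(q <- X) (if q \in A then F q else 0).
Proof.
move=> AX; rewrite -(@big_fset_incl _ _ _ _ A X (fun q => if q \in A then F q else 0)) //.
  by rewrite big_seq [RHS]big_seq; apply: eq_bigr => q ->.
by move=> q _ /negbTE ->.
Qed.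

Section Configuration.
Variables (k : fieldType) (m d : nat) (p : proj_pt k m) (e1 e2 : 'rV[k]_m.+1).
Local Notation e0 := (hcoord p).
Local Notation pt := (proj_pt k m).
Local Notation ver q := (ver_vec d (hcoord q)).
Local Notation W := (<[e0]> + <[e1]> + <[e2]>)%VS.
Variables (S : {fset pt}) (a b c : k) (lam : pt -> k).
Hypotheses (e1_free : e1 \notin <[e0]>%VS) (e2_free : e2 \notin (<[e0]> + <[e1]>)%VS).
Hypothesis c_neq0 : c != 0.

(** The functional a F_0 + b F_1 + c F_2 of the arc gamma. *)
Definition arc_vec : 'rV[k]_(vdim m d).+1 :=
  a *: jet_vec d e0 e1 e2 0 + b *: jet_vec d e0 e1 e2 1 + c *: jet_vec d e0 e1 e2 2.

Lemma pair_arc_vec F : F \is d.-homog -> pair arc_vec F =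
  a * (arc_eval e0 e1 e2 F)`_0 + b * (arc_eval e0 e1 e2 F)`_1 + c * (arc_eval e0 e1 e2 F)`_2.
Proof. by move=> hF; rewrite /arc_vec !pairDl !pairZl !pair_jet. Qed.

(** The point [p] is added to the list because residual relations may acquire
    a weight there. *)
Lemma lower_relation (X : {fset pt}) (mu : pt -> k) :
  arc_vec = \sum_(q <- X) mu q *: ver q ->
  let mu' q := if q \in X then mu q else 0 in
  (forall ls, size ls = d ->
    a * (arc_prod e0 e1 e2 ls)`_0 + b * (arc_prod e0 e1 e2 ls)`_1 +
    c * (arc_prod e0 e1 e2 ls)`_2 =
    \sum_(q <- (p |` X)%fset) mu' q * \prod_(l <- ls) pval l q) /\
  (count (in_config mu' p) (p |` X)%fset <= nsupp X mu + 1)%N.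
Proof.
move=> hu mu'; split=> [ls sz|].
  have hF : lfs ls \is d.-homog by rewrite -sz; apply: lfs_homog.
  rewrite -arc_eval_lfs -pair_arc_vec // hu pair_suml (sum_fset_sub _ (fsubsetU1 p X)).
  apply: eq_bigr => q _; rewrite /mu'; case: ifP => _; last by rewrite mul0r.
  by rewrite pairZl pair_ver // lfs_eval.
rewrite -size_filter /nsupp -size_filter addn1.
apply: (@uniq_leq_size _ _ (p :: [seq q <- X | mu q != 0])); first exact/filter_uniq/fset_uniq.
move=> q; rewrite mem_filter in_cons /in_config /mu' => /andP[+ _].
by case/orP => [-> //|]; rewrite mem_filter; case: (q \in X); rewrite ?eqxx // => ->; rewrite orbT.
Qed.

Lemma arc_lower (X : {fset pt}) (mu : pt -> k) : (3 <= d)%N ->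
  arc_vec = \sum_(q <- X) mu q *: ver q -> (2 * d - 1 <= nsupp X mu)%N.
Proof.
move=> d3 hu; have [hJ hc] := lower_relation hu.
have := arc_relation_lower (fset_uniq _) (fset1U1 p X) erefl c_neq0 hJ e1_free e2_free d3.
by move=> h; have := leq_trans h hc; nat_lia.
Qed.

Lemma arc_lower_span (B : {fset pt}) : (3 <= d)%N ->
  arc_vec \in pspan (ver_set d B) -> (2 * d - 1 <= #|` B|)%N.
Proof.
move=> d3 /mem_pspan_ver[mu /(arc_lower d3) h]; apply: leq_trans h _.
by rewrite /nsupp count_size.
Qed.

Hypothesis WS : \dim (W + pspan S) = (3 + #|` S|)%N.
Hypothesis dS : (2 * #|` S| + 5 <= d)%N.

Lemma arc_lower_points (X : {fset pt}) (mu : pt -> k) (S' : seq pt) :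
  arc_vec = \sum_(q <- X) mu q *: ver q -> uniq S' -> (0 < size S')%N ->
  (forall q, q \in S' -> [/\ q \in S, q \in X & mu q != 0]) ->
  (2 * d + 2 * size S' <= nsupp X mu)%N.
Proof.
move=> hu uS' S'0 hS'; rewrite leqNgt; apply/negP => lt.
have [hJ hc] := lower_relation hu.
have sub : (size S' <= #|` S|)%N.
  by apply: uniq_leq_size => // q /hS'[].
have dS' : (2 * size S' + 5 <= d)%N by lia.
have hT := leq_trans hc (_ : _ <= 2 * d + 2 * size S')%N.
apply: (arc_relation_with_points (fset_uniq _) (fset1U1 p X) erefl c_neq0 hJ _ S'0 _ uS' dS'); first last.
- by apply: hT; lia.
- move=> q /hS'[_ qX nq]; split; first by rewrite in_fset1U qX orbT.
  by rewrite qX.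
- apply/eqP; rewrite eqn_leq; apply/andP; split.
    rewrite (leq_trans (dimv_add_leqif _ _)) // leq_add ?dim_span_pts //.
    rewrite (leq_trans (dimv_add_leqif _ _)) // (leq_add (dim_t01 _ _)) // dim_vline.
    by case: (_ != 0).
  have : (W + pspan S <= (W + span_pts S') + span_pts [seq q <- S | q \notin S'])%VS.
    rewrite -[(_ + span_pts S' + _)%VS]addvA addvS ?subvv // /pspan big_seq.
    elim/big_ind: _ => [|U1 U2 h1 h2|q qS]; rewrite ?sub0v ?subv_add ?h1 // mem_pline.
    case: (boolP (q \in S')) => qS'.
      by apply: (subvP (addvSl _ _)); apply: mem_span_pts.
    by apply: (subvP (addvSr _ _)); apply: mem_span_pts; rewrite mem_filter qS'.
  move/dimvS; rewrite WS => h.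
  have h1 : (\dim (W + span_pts S' + span_pts [seq q <- S | q \notin S']) <= _)%N :=
    dimv_add_leqif _ _.
  have h2 := dim_span_pts [seq q <- S | q \notin S'].
  have h3 : (size [seq q <- S | q \notin S'] + size S' <= #|` S|)%N.
    rewrite -size_cat; apply: uniq_leq_size => [|q].
      rewrite cat_uniq filter_uniq ?fset_uniq // uS' andbT /=.
      by apply/hasPn => q qS'; rewrite mem_filter qS'.
    by rewrite mem_cat mem_filter => /orP[/andP[]|/hS'[]].
  by move: h h1 h2 h3; nat_lia.
Qed.

Hypothesis lam_neq0 : forall q, q \in S -> lam q != 0.

Definition union_vec := arc_vec + \sum_(q <- S) lam q *: ver q.

(** The set S' consists of the points of [S] whose coefficient in the decomposition is not
    the expected one. If it is nonempty, [arc_lower_points] makes [B] too large;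
    if it is empty, [S] splits off. *)
Lemma union_lower (B : {fset pt}) :
  union_vec \in pspan (ver_set d B) ->
  (#|` S| + 2 * d - 1 <= #|` B|)%N /\
  ((#|` B| <= #|` S| + 2 * d - 1)%N ->
    (S `<=` B)%fset /\ arc_vec \in pspan (ver_set d (B `\` S)%fset)).
Proof.
move=> /mem_pspan_ver[cf hv].
pose X := (S `|` B)%fset.
pose mu q := (if q \in B then cf q else 0) - (if q \in S then lam q else 0).
have hu : arc_vec = \sum_(q <- X) mu q *: ver q.
  under eq_bigr do rewrite scalerBl.
  rewrite sumrB; have -> : arc_vec = union_vec - \sum_(q <- S) lam q *: ver q by rewrite addrK.
  rewrite hv (sum_fset_sub _ (fsubsetUl S B)) (sum_fset_sub _ (fsubsetUr S B)).
  by congr (_ - _); apply: eq_bigr => q _; case: ifP; rewrite ?scale0r.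
pose S' := [seq q <- S | mu q != 0].
have cB : #|` B| = (#|` (B `&` S)%fset| + #|` (B `\` S)%fset|)%N by rewrite cardfsID.
have wle : (nsupp X mu <= size S' + #|` (B `\` S)%fset|)%N.
  rewrite /nsupp -size_filter cardfE -cardfE -size_cat.
  apply: uniq_leq_size; first exact/filter_uniq/fset_uniq.
  move=> q; rewrite mem_filter mem_cat mem_filter in_fsetD in_fsetU => /andP[-> /=].
  by case: (q \in S).
have [S'0|S'0] := posnP (size S'); last first.
  have hw := @arc_lower_points X mu S' hu (filter_uniq _ (fset_uniq _)) S'0 _.
  have {}hw : (2 * d + 2 * size S' <= nsupp X mu)%N.
    apply: hw => q; rewrite mem_filter => /andP[nq qS]; split=> //.
    by rewrite in_fsetU qS.
  have hS : (#|` S| <= size S' + #|` (B `&` S)%fset|)%N.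
    rewrite -size_cat; apply: uniq_leq_size; first exact: fset_uniq.
    move=> q qS; rewrite mem_cat mem_filter in_fsetI qS andbT.
    case: (boolP (q \in B)) => [_|qB]; first by rewrite orbT.
    by rewrite /mu (negbTE qB) qS sub0r oppr_eq0 lam_neq0.
  by split; lia.
have d3 : (3 <= d)%N := leq_trans (leq_trans (isT : (3 <= 5)%N) (leq_addl _ _)) dS.
have hl := arc_lower d3 hu.
have mu0 q : q \in S -> mu q = 0.
  move=> qS; apply/eqP; apply: contraT => nq.
  have : q \in S' by rewrite mem_filter nq.
  by rewrite (size0nil S'0).
have SB : (S `<=` B)%fset.
  apply/fsubsetP => q qS; apply: contraT => qB; have := mu0 q qS.
  by rewrite /mu (negbTE qB) qS sub0r => /eqP; rewrite oppr_eq0 (negbTE (lam_neq0 qS)).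
have cBS : #|` (B `&` S)%fset| = #|` S| by rewrite (fsetIidPr SB).
split; first by lia.
move=> _; split=> //; apply/mem_pspan_ver; exists mu.
have sub : (B `\` S `<=` X)%fset by apply: fsubset_trans (fsubsetDl _ _) (fsubsetUr _ _).
rewrite hu (sum_fset_sub _ sub) big_seq [RHS]big_seq; apply: eq_bigr => q.
rewrite in_fsetU in_fsetD; case: (boolP (q \in S)) => //= qS.
  by rewrite mu0 // scale0r.
by move=> ->.
Qed.

End Configuration.

(** * Subschemes of an arc *)

Section ArcScheme.
Variables (k : fieldType) (m : nat) (Z : subscheme k m) (p : proj_pt k m) (e1 e2 : 'rV[k]_m.+1).
Local Notation e0 := (hcoord p).
Local Notation W := (<[e0]> + <[e1]> + <[e2]>)%VS.
Hypothesis e1_free : e1 \notin <[e0]>%VS.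
Hypothesis hZ : forall t f, f \is t.-homog -> (Z f <-> low0 3 (arc_eval e0 e1 e2 f)).

Lemma low0_3 (q : {poly k}) : q`_0 = 0 -> q`_1 = 0 -> q`_2 = 0 -> low0 3 q.
Proof. by move=> h0 h1 h2 [|[|[|i]]]. Qed.

Lemma lf_in_arc l : Z (lf l) <-> [/\ lval l e0 = 0, lval l e1 = 0 & lval l e2 = 0].
Proof.
rewrite (hZ (lf_homog l)) arc_eval_lf; split=> [h|[h0 h1 h2]].
  by rewrite -(arc_lin0 e0 e1 e2) -(arc_lin1 e0 e1 e2) -(arc_lin2 e0 e1 e2) !h.
by apply: low0_3; rewrite ?arc_lin0 ?arc_lin1 ?arc_lin2.
Qed.

Lemma lspan_arc : lspan Z = W.
Proof.
apply/eqP; rewrite eqEsubv; apply/andP; split.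
  apply/subvP => v; rewrite mem_prop_vspace => /asboolP hv; apply: contraT => vW.
  have [l [lW lv]] := exists_form_sep vW.
  have := hv _ (lf_homog l) _; rewrite lf_eval lv => h.
  have /h/eqP : Z (lf l); last by rewrite oner_eq0.
  apply/lf_in_arc; split; apply: lW; rewrite memvE ?addvSr //.
    by rewrite (subv_trans (addvSl <[e0]> <[e1]>) (addvSl _ _)).
  by rewrite (subv_trans (addvSr <[e0]> <[e1]>) (addvSl _ _)).
rewrite !subv_add -!memvE !mem_prop_vspace; apply/andP; split; first (apply/andP; split);
  apply/asboolP => L hL; rewrite (homog1E hL) lf_eval => /lf_in_arc[] //.
Qed.

(** The ideal of [Z'] contains a form that does not vanish modulo t^3 along the arc, hence
    one of order exactly two. Modulo the ideal of [Z] such a form agrees, after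
    multiplication by powers of the variables, with a multiple of [lf l]. *)
Lemma proper_sub_arc (Z' : subscheme k m) l : proper_subsch Z' Z ->
  lval l e0 = 0 -> lval l e1 = 0 -> lval l e2 = 1 -> Z' (lf l).
Proof.
move=> [ZZ' nZ] l0 l1 l2.
have [f [Z'f nZf]] : exists f, Z' f /\ ~ Z f.
  apply: contrapT => h; apply: nZ => f Z'f; apply: contrapT => nZf; apply: h; by exists f.
have [t nt] : exists t, ~ Z (pihomog mdeg t f).
  apply: contrapT => h; apply: nZf; apply/sch_homogP => t; apply: contrapT => nt.
  by apply: h; exists t.
set g := pihomog mdeg t f in nt; have hg : g \is t.-homog by apply: pihomogP.
have Z'g : Z' g by apply: sideal_homog.
have [h [h0 h1]] := exists_form_sep e1_free.
have {}h0 : lval h e0 = 0 by apply: h0; apply: memv_line.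
(* Multiplying by a form h of order one along the arc raises the order of g
   to exactly two without leaving the ideal of Z'. *)
have [t' [g' [hg' Z'g' [g0 g1 g2]]]] : exists t' g', [/\ g' \is t'.-homog, Z' g' &
    [/\ (arc_eval e0 e1 e2 g')`_0 = 0, (arc_eval e0 e1 e2 g')`_1 = 0 &
        (arc_eval e0 e1 e2 g')`_2 != 0]].
  have mulh t1 g1 : g1 \is t1.-homog -> Z' g1 ->
      [/\ lf h * g1 \is t1.+1.-homog, Z' (lf h * g1),
      (arc_eval e0 e1 e2 (lf h * g1))`_0 = 0,
      (arc_eval e0 e1 e2 (lf h * g1))`_1 = (arc_eval e0 e1 e2 g1)`_0 &
      (arc_eval e0 e1 e2 g1)`_0 = 0 ->
        (arc_eval e0 e1 e2 (lf h * g1))`_2 = (arc_eval e0 e1 e2 g1)`_1].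
    move=> hg1 Z'g1; split; first exact: (dhomogM (lf_homog h) hg1).
    - exact: sidealM.
    - by rewrite arc_evalM coef0M arc_eval_lf arc_lin0 h0 mul0r.
    - by rewrite arc_evalM coefM1 arc_eval_lf arc_lin0 arc_lin1 h0 h1 mul0r mul1r add0r.
    move=> g10; rewrite arc_evalM coefM2 arc_eval_lf arc_lin0 arc_lin1 h0 h1 g10.
    by rewrite mul0r mul1r mulr0 add0r addr0.
  have [g0|g0] := eqVneq (arc_eval e0 e1 e2 g)`_0 0; last first.
    have [a1 a2 a3 a4 a5] := mulh _ _ hg Z'g.
    have [b1 b2 b3 b4 b5] := mulh _ _ a1 a2.
    by exists t.+2, (lf h * (lf h * g)); split=> //; split; rewrite ?b4 ?b5 ?a4.
  have [g1|g1] := eqVneq (arc_eval e0 e1 e2 g)`_1 0; last first.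
    have [a1 a2 a3 a4 a5] := mulh _ _ hg Z'g.
    by exists t.+1, (lf h * g); split=> //; split; rewrite ?a4 ?a5.
  exists t, g; split=> //; split=> //; apply/eqP => g2; apply: nt.
  by apply/(hZ hg); apply: low0_3.
have [l' l'1] := exists_form_nz p; rewrite /pval in l'1.
apply: sideal_sat => i; exists t'.
set kap := (arc_eval e0 e1 e2 g')`_2 in g2.
have hX : ('X_i : {mpoly k[m.+1]}) ^+ t' \is t'.-homog.
  by apply: yX_homog; rewrite dhomogX; apply/eqP/mdeg1.
have hA := dhomogM hX (lf_homog l); have hB := dhomogM hg' (lf_homog l').
pose c := e0 0 i ^+ t' / kap.
rewrite -[_ * lf l](subrK (c *: (g' * lf l'))).
apply: sidealD; last first.
  by rewrite -mul_mpolyC; apply: sidealM; rewrite mulrC; apply: sidealM.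
apply: ZZ'; apply/(hZ (rpredB hA (rpredZ c hB))).
have X0 : (arc_eval e0 e1 e2 ('X_i ^+ t'))`_0 = e0 0 i ^+ t'.
  by rewrite arc_eval0 rmorphXn /= mevalXU.
have -> : arc_eval e0 e1 e2 ('X_i ^+ t' * lf l - c *: (g' * lf l')) =
  arc_eval e0 e1 e2 ('X_i ^+ t') * arc_lin e0 e1 e2 l -
  c%:P * (arc_eval e0 e1 e2 g' * arc_lin e0 e1 e2 l').
  rewrite /arc_eval mmapB -![mmap _ _ _]/(arc_eval _ _ _ _) arc_evalZ !arc_evalM.
  by rewrite !arc_eval_lf.
apply: low0_3; rewrite coefB coefCM.
- by rewrite !coef0M arc_lin0 l0 g0 mul0r !mulr0 subr0.
- by rewrite !coefM1 arc_lin0 arc_lin1 l0 l1 g0 g1 !mul0r !mulr0 !addr0 mulr0 subr0.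
rewrite !coefM2 !arc_lin0 !arc_lin1 arc_lin2 l0 l1 l2 g0 g1 X0 l'1 !mul0r !mulr0 !addr0 !add0r !mulr1.
by rewrite /c divfK // subrr.
Qed.

End ArcScheme.

(** * The decomposition theorem *)

Lemma pts_sch_homog (k : fieldType) (m : nat) (S : {fset proj_pt k m}) t f : f \is t.-homog ->
  (pts_sch S f <-> forall q, q \in S -> f.@[hcoord q 0] = 0).
Proof.
move=> hf; split=> [h q qS|h t' q qS].
  by have := h t q qS; rewrite (pihomog_homog _ hf) eqxx.
by rewrite (pihomog_homog _ hf); case: ifP; rewrite ?meval0 // => _; apply: h.
Qed.

(** A form killed by the three jet functionals and by the values at [S] lies in the ideal of
    the union; so the functionals of the span are combinations of these. *)
Lemma lspan_union_coef (k : fieldType) (m d : nat) (A1 : subscheme k m) (S : {fset proj_pt k m})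
  (p : proj_pt k m) (e1 e2 : 'rV[k]_m.+1) v :
  (forall t f, f \is t.-homog -> (A1 f <-> low0 3 (arc_eval (hcoord p) e1 e2 f))) ->
  v \in lspan (ver_sch d (sch_union A1 (pts_sch S))) ->
  exists a b c lam, v = union_vec d p e1 e2 S a b c lam.
Proof.
move=> hA1 /mem_lspan_ver hv.
pose J i := jet_vec d (hcoord p) e1 e2 i.
have : v \in (<[J 0%N]> + <[J 1%N]> + <[J 2%N]> + pspan (ver_set d S))%VS.
  apply: mem_of_pair => F hF hU; apply: hv => //; split.
    apply/(hA1 d) => // i; rewrite -(pair_jet _ _ _ _ hF).
    case: i => [|[|[|//]]] _; apply: hU; apply: (subvP (addvSl _ _)).
    - by rewrite memvE (subv_trans (addvSl <[J 0%N]> <[J 1%N]>) (addvSl _ _)).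
    - by rewrite memvE (subv_trans (addvSr <[J 0%N]> <[J 1%N]>) (addvSl _ _)).
    - by rewrite memvE addvSr.
  apply/(pts_sch_homog _ hF) => q qS; rewrite -(pair_ver _ hF); apply: hU.
  apply: (subvP (addvSr _ _)); rewrite memvE -pline_ver; apply: mem_pspan.
  by apply/imfsetP; exists q.
move=> /memv_addP[w1 /memv_addP[w2 /memv_addP[w3 /vlineP[a ->] [w4 /vlineP[b ->] ->]]
  [w5 /vlineP[c ->] ->]] [w6 /mem_pspan_ver[lam ->] ->]].
by exists a, b, c, lam.
Qed.

Theorem proposition4 (k : closedFieldType) (char0 : [pchar k] =i pred0)
  (s m d : nat) (hm : (s + 2 <= m)%N) (hd : (2 * m + 1 <= d)%N)
  (A1 : subscheme k m)
  (A1_connected : connected_sch A1)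
  (A1_curvilinear : curvilinear A1)
  (A1_degree : zero_dim_deg A1 3)
  (A1_span : pdim (lspan A1) = 2)
  (S : {fset proj_pt k m})
  (S_A1 : forall p, p \in S -> ~ supp A1 p)
  (S_card : #|` S| = s)
  (S_indep : lin_indep S)
  (S_span : (pspan S :&: lspan A1)%VS = 0%VS)
  (A : subscheme k m) (A_def : A = sch_union A1 (pts_sch S))
  (P : proj_pt k (vdim m d))
  (P_A : (pline P <= lspan (ver_sch d A))%VS)
  (P_min : forall A' : subscheme k m, proper_subsch A' A ->
     ~ (pline P <= lspan (ver_sch d A'))%VS) :
  exists P1 : proj_pt k (vdim m d),
    [/\ unique (fun Q : proj_pt k (vdim m d) =>
          (pline Q <= lspan (ver_sch d A1))%VS /\
          (pline P <= pspan (Q |` ver_set d S)%fset)%VS) P1,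
        forall A' : subscheme k m, proper_subsch A' A1 ->
          ~ (pline P1 <= lspan (ver_sch d A'))%VS,
        has_rank P (s + 2 * d - 1),
        forall B : {fset proj_pt k m}, rank_decomp P B ->
          exists B1 : {fset proj_pt k m},
            [/\ rank_decomp P1 B1, [disjoint B1 & S]%fset & B = (B1 `|` S)%fset]
      & forall B1 : {fset proj_pt k m}, rank_decomp P1 B1 ->
          [disjoint B1 & S]%fset /\ rank_decomp P (B1 `|` S)%fset].
Proof.
have [p [e1 [e2 [e1f hA1]]]] := arc_ideal A1_connected A1_curvilinear A1_degree.
set e0 := hcoord p in e1f hA1.
have spanE := lspan_arc hA1; rewrite -/e0 in spanE.
set W := (<[e0]> + <[e1]> + <[e2]>)%VS in spanE.
have dW : \dim W = 3%N by move: A1_span; rewrite /pdim spanE; move: (\dim W) => x; clear; lia.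
have dSp : \dim (pspan S) = s by move: S_indep; rewrite /lin_indep /pdim S_card; move: (\dim _) => x; clear; lia.
have WS : \dim (W + pspan S) = (3 + #|` S|)%N.
  by rewrite dimv_disjoint_sum ?dW ?dSp ?S_card // capvC -spanE.
have dS : (2 * #|` S| + 5 <= d)%N by rewrite S_card; move: hm hd; clear; lia.
have d4 : (4 <= d)%N by move: hm hd; clear; lia.
have e2f : e2 \notin (<[e0]> + <[e1]>)%VS.
  apply/negP => h; have := dim_t01 e0 e1.
  have : (W <= <[e0]> + <[e1]>)%VS by rewrite subv_add subvv -memvE h.
  by move/dimvS; rewrite dW; nat_lia.
have dimS q : q \in S -> hcoord q \notin (W + pspan (S `\ q)%fset)%VS.
  move=> qS; apply/negP => h.
  have : (W + pspan S <= W + pspan (S `\ q)%fset)%VS.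
    rewrite subv_add addvSl /pspan (big_fsetD1 q) //= subv_add addvSr andbT.
    by rewrite mem_pline h.
  move/dimvS; rewrite WS => h1.
  have h2 : (\dim (W + pspan (S `\ q)%fset) <= \dim W + \dim (pspan (S `\ q)%fset))%N :=
    dimv_add_leqif _ _.
  have h3 : (\dim (pspan (S `\ q)%fset) <= #|` (S `\ q)%fset|)%N := dim_span_pts _.
  have h4 : #|` S| = (#|` (S `\ q)%fset|).+1 by rewrite (cardfsD1 q S) qS.
  move: dW h1 h2 h3 h4; set x1 := dimv _; set x2 := dimv _; set x3 := dimv _.
  by move: x1 x2 x3 => x1 x2 x3; clear; lia.
have WS2 : e2 \notin (<[e0]> + <[e1]> + pspan S)%VS := e2_notin_span WS.
have [l2 [l2K l22]] := exists_form_sep WS2.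
have l2t u : u \in (<[e0]> + <[e1]>)%VS -> lval l2 u = 0.
  by move=> ut; apply: l2K; apply: (subvP (addvSl _ _)).
have l20 : lval l2 e0 = 0 by apply: l2t; apply: mem_t01_0.
have l21 : lval l2 e1 = 0 by apply: l2t; apply: mem_t01_1.
have l2S q : q \in S -> lval l2 (hcoord q) = 0.
  move=> qS; apply: l2K; apply: (subvP (addvSr _ _)); rewrite -mem_pline.
  exact: mem_pspan.
have [l0 l01] := exists_form_nz p; rewrite /pval -/e0 in l01.
(* The linear forms dual to the points of S and zero on the span of A1. *)
have /choice[ld hld] : forall q : proj_pt k m, exists l, q \in S ->
    [/\ lval l e0 = 0, lval l e1 = 0, lval l e2 = 0, lval l (hcoord q) = 1 &
        forall q', q' \in S -> q' != q -> lval l (hcoord q') = 0].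
  move=> q; case: (boolP (q \in S)) => [qS|_]; last by exists 0.
  have [l [lK lq]] := exists_form_sep (dimS q qS); exists l => _.
  have WK u : u \in W -> lval l u = 0 by move=> uW; apply: lK; apply: (subvP (addvSl _ _)).
  split=> //; [apply: WK|apply: WK|apply: WK|].
  - by apply: (subvP (addvSl _ _)); apply: mem_t01_0.
  - by apply: (subvP (addvSl _ _)); apply: mem_t01_1.
  - by rewrite memvE addvSr.
  move=> q' q'S ne; apply: lK; apply: (subvP (addvSr _ _)); rewrite -mem_pline.
  by apply: mem_pspan; rewrite in_fsetD1 ne.
have vA : hcoord P \in lspan (ver_sch d A) by rewrite -mem_pline.
rewrite A_def in vA; have [a [b [c [lam vE]]]] := lspan_union_coef hA1 vA.
set u := arc_vec d p e1 e2 a b c.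
have pairv F : F \is d.-homog -> pair (hcoord P) F =
    pair u F + \sum_(q <- S) lam q * F.@[hcoord q 0].
  move=> hF; rewrite vE /union_vec pairDl pair_suml; congr (_ + _).
  by apply: eq_bigr => q _; rewrite pairZl pair_ver.
have pairu F : F \is d.-homog -> pair u F = a * (arc_eval e0 e1 e2 F)`_0 +
    b * (arc_eval e0 e1 e2 F)`_1 + c * (arc_eval e0 e1 e2 F)`_2 by exact: pair_arc_vec.
(* Otherwise P lies in the span of S and the subscheme of length two of the arc. *)
have c0 : c != 0.
  apply/eqP => c0.
  have e00 : e0 != 0 by apply: hcoord_neq0.
  pose A' := sch_union (jet_sch e1 e2 2 e00) (pts_sch S).
  apply: (P_min A'); last first.
    rewrite mem_pline; apply/mem_lspan_ver => F hF [hF1 /(pts_sch_homog _ hF) hF2].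
    move/(jet_sch_homog _ _ _ _ hF): hF1 => hF1.
    rewrite pairv // pairu // c0 (hF1 0%N) // (hF1 1%N) // mul0r !mulr0 !addr0 add0r.
    by rewrite big_seq big1 // => q qS; rewrite hF2 ?mulr0.
  rewrite A_def; split=> [f [A1f Sf]|h].
    split=> // t i lt; have /(hA1 _ _ (pihomogP mdeg t f)) := sideal_homog t A1f.
    by apply; apply: leq_trans lt _.
  have hl : A' (lf l2).
    split; last by apply/(pts_sch_homog _ (lf_homog l2)) => q qS; rewrite lf_eval l2S.
    apply/(jet_sch_homog _ _ _ _ (lf_homog l2)); rewrite arc_eval_lf.
    by case=> [|[|//]] _; rewrite ?arc_lin0 ?arc_lin1 ?l20 ?l21.
  by have [/(lf_in_arc hA1)[_ _ /eqP]] := h _ hl; rewrite l22 oner_eq0.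
(* Otherwise q can be removed from A. *)
have lam0 q : q \in S -> lam q != 0.
  move=> qS; apply/eqP => lq0.
  pose A' := sch_union A1 (pts_sch (S `\ q)%fset).
  apply: (P_min A'); last first.
    rewrite mem_pline; apply/mem_lspan_ver => F hF [hF1 /(pts_sch_homog _ hF) hF2].
    move/(hA1 _ _ hF): hF1 => hF1.
    rewrite pairv // pairu // !hF1 // !mulr0 !addr0 add0r.
    rewrite big_seq big1 // => q' q'S; case: (eqVneq q' q) => [->|ne].
      by rewrite lq0 mul0r.
    by rewrite hF2 ?mulr0 // in_fsetD1 ne.
  have [d0 d1 d2 dq dS'] := hld q qS.
  rewrite A_def; split=> [f [A1f Sf]|h].
    by split=> // t q'; rewrite in_fsetD1 => /andP[_]; apply: Sf.
  have hl : A' (lf (ld q)).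
    split; first exact/(lf_in_arc hA1).
    apply/(pts_sch_homog _ (lf_homog _)) => q'; rewrite in_fsetD1 => /andP[ne q'S].
    by rewrite lf_eval dS'.
  have [_ /(pts_sch_homog _ (lf_homog (ld q)))/(_ q qS)/eqP] := h _ hl.
  by rewrite lf_eval dq oner_eq0.
(* A form of order exactly two along the arc: it reads off c. *)
pose F2 := lfs (l2 :: nseq d.-1 l0).
have hF2 : F2 \is d.-homog.
  by have := lfs_homog (l2 :: nseq d.-1 l0); rewrite /= size_nseq prednK //; apply: leq_trans d4.
have arcF2 : [/\ (arc_eval e0 e1 e2 F2)`_0 = 0, (arc_eval e0 e1 e2 F2)`_1 = 0 &
    (arc_eval e0 e1 e2 F2)`_2 = 1].
  rewrite arc_eval_lfs !arc_prod_coefE l20 l21 l22 !mul0r !addr0 add0r mul1r; split=> //.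
  by elim: (d.-1) => [|n IH] /=; rewrite ?arc_prod_coefE ?l01 ?IH ?mul1r // /arc_prod big_nil coef1.
have uF2 : pair u F2 = c by rewrite pairu //; case: arcF2 => -> -> ->; rewrite !mulr0 !add0r mulr1.
have u0 : u != 0.
  apply/eqP => u0; move: uF2; rewrite u0 /pair big1 => [/esym/eqP|i _]; last by rewrite mxE mul0r.
  by rewrite (negbTE c0).
have du : \dim <[u]>%VS == 1%N by rewrite dim_vline u0.
have [P1 P1E] : exists P1 : proj_pt k (vdim m d), pline P1 = <[u]>%VS.
  by exists (ProjPt du).
have u_lspan : u \in lspan (ver_sch d A1).
  by apply/mem_lspan_ver => F hF /(hA1 _ _ hF) h; rewrite pairu // !h // !mulr0 !addr0.
have decP B : decomposes P B <-> union_vec d p e1 e2 S a b c lam \in pspan (ver_set d B).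
  by rewrite /decomposes mem_pline vE.
have decP1 B : decomposes P1 B <-> u \in pspan (ver_set d B).
  by rewrite /decomposes P1E -memvE.
have [B0 cB0 hB0] := arc_upper char0 e0 e1 e2 a b c d4.
rewrite -[_ + _]/u in hB0.
have low B : decomposes P B -> (s + 2 * d - 1 <= #|` B|)%N /\
    ((#|` B| <= s + 2 * d - 1)%N -> (S `<=` B)%fset /\ decomposes P1 (B `\` S)%fset).
  move=> /decP hB; have [h1 h2] := union_lower e1f e2f c0 WS dS lam0 hB.
  rewrite -S_card; split=> // /h2[SB hu]; split=> //; exact/decP1.
have low1 B : decomposes P1 B -> (2 * d - 1 <= #|` B|)%N.
  by move=> /decP1; apply: (arc_lower_span e1f e2f c0); exact: ltnW.
have union_dec B : decomposes P1 B -> decomposes P (B `|` S)%fset.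
  move=> /decP1 uB; apply/decP; rewrite /union_vec; apply: memvD.
    by move: uB; apply/subvP/pspan_sub/ver_set_sub/fsubsetUl.
  rewrite big_seq; apply: rpred_sum => q qS; apply: memvZ.
  rewrite memvE -pline_ver; apply: mem_pspan; apply/imfsetP; exists q => //=.
  by rewrite in_fsetU qS orbT.
have card_union (B : {fset proj_pt k m}) :
    (#|` (B `|` S)%fset| + #|` (B `&` S)%fset| = #|` B| + s)%N.
  by rewrite -S_card cardfsUI.
have rk1 : has_rank P1 (2 * d - 1).
  split; last exact: low1.
  have dB0 : decomposes P1 B0 by apply/decP1.
  by exists B0 => //; apply/eqP; rewrite eqn_leq cB0 low1.
have rk : has_rank P (s + 2 * d - 1).
  split; last by move=> B /low[].
  have dB0 : decomposes P1 B0 by apply/decP1.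
  have dB := union_dec _ dB0; exists (B0 `|` S)%fset => //.
  have [h _] := low _ dB; have := card_union B0; move: h cB0 d4.
  by move: #|` _| #|` _| #|` _| => x y z; clear; lia.
have rank_unique (Q : proj_pt k (vdim m d)) r r' :
    has_rank Q r -> has_rank Q r' -> r = r'.
  move=> [[B dB <-] hB] [[B' dB' <-] hB'].
  by apply/eqP; rewrite eqn_leq hB // hB'.
exists P1; split=> //.
- split; first split.
  + by rewrite P1E -memvE.
  + rewrite mem_pline vE /union_vec; apply: memvD.
      by rewrite memvE -P1E; apply: mem_pspan; rewrite fset1U1.
    rewrite big_seq; apply: rpred_sum => q qS; apply: memvZ.
    rewrite memvE -pline_ver; apply: mem_pspan; rewrite in_fset1U; apply/orP; right.
    by apply/imfsetP; exists q.
  move=> Q [QA1 PQ]; rewrite mem_pline in QA1.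
  have : hcoord P \in (pline Q + pspan (ver_set d S))%VS.
    rewrite -mem_pline; apply: subv_trans PQ _.
    rewrite /pspan big_seq; elim/big_ind: _ => [|U1 U2 h1 h2|x]; rewrite ?sub0v ?subv_add ?h1 //.
    rewrite in_fset1U => /orP[/eqP -> |xS]; first exact: addvSl.
    by apply: subv_trans (addvSr _ _); apply: mem_pspan.
  rewrite plineE => /memv_addP[w /vlineP[al ->] [w' /mem_pspan_ver[kap ->] E]].
  (* The d-th power of the linear form dual to q lies in the ideal of A1, hence kills
     both Q and the arc part of P. *)
  have kapE q : q \in S -> kap q = lam q.
    move=> qS; have [d0 d1 d2 dq dS'] := hld q qS.
    pose F := lfs (nseq d (ld q)).
    have hF : F \is d.-homog by rewrite -[X in X.-homog](size_nseq d (ld q)); apply: lfs_homog.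
    have FA1 : A1 F.
      have -> : F = lfs (nseq d.-1 (ld q)) * lf (ld q).
        rewrite mulrC /F /lfs -[in LHS](@prednK d) ?big_cons //; last by apply: leq_trans d4.
      by apply: sidealM; apply/(lf_in_arc hA1).
    have Fq : F.@[hcoord q 0] = 1.
      by rewrite lfs_eval big_nseq iter_fix // dq mulr1.
    have Fq' q' : q' \in S -> q' != q -> F.@[hcoord q' 0] = 0.
      move=> q'S ne; rewrite lfs_eval -(@prednK d) ?big_cons ?dS' ?mul0r //.
      by apply: leq_trans d4.
    have evS (g : proj_pt k m -> k) : \sum_(x <- S) g x * F.@[hcoord x 0] = g q.
      rewrite (big_fsetD1 q) //= Fq mulr1 big_seq big1 ?addr0 // => x.
      by rewrite in_fsetD1 => /andP[ne xS]; rewrite Fq' ?mulr0.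
    have := pairv F hF; rewrite evS.
    rewrite (proj1 (mem_lspan_ver _ _) u_lspan F hF FA1) add0r E pairDl pairZl.
    rewrite (proj1 (mem_lspan_ver _ _) QA1 F hF FA1) mulr0 add0r pair_suml.
    under eq_bigr do rewrite pairZl pair_ver //.
    by rewrite evS.
  have uE : u = al *: hcoord Q.
    have := E; rewrite vE /union_vec -/u.
    have -> : \sum_(q <- S) kap q *: ver_vec d (hcoord q) =
      \sum_(q <- S) lam q *: ver_vec d (hcoord q).
      by rewrite big_seq [RHS]big_seq; apply: eq_bigr => q /kapE ->.
    exact: addIr.
  apply/esym/hcoord_inj; rewrite -[<[_]>%VS]plineE P1E.
  have al0 : al != 0 by apply: contraNneq u0 => al0; rewrite uE al0 scale0r.
  by rewrite -[hcoord Q]scale1r -(mulVf al0) -scalerA -uE memvZ ?memv_line.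
- move=> A' pA'; rewrite P1E -memvE => /mem_lspan_ver h.
  have A'2 := proper_sub_arc e1f hA1 pA' l20 l21 l22.
  have := h F2 hF2 _; rewrite uF2 => h'; case/negP: c0; apply/eqP/h'.
  by rewrite /F2 /lfs big_cons mulrC; apply: sidealM.
- move=> B [dB rB].
  have cB := rank_unique _ _ _ rB rk.
  have [_ /(_ _)[|SB dB1]] := low B dB; first by rewrite cB.
  have BE : B = ((B `\` S) `|` S)%fset.
    by apply/fsetP => q; rewrite in_fsetU in_fsetD; case: (boolP (q \in S)) => [/(fsubsetP SB) ->|_]; rewrite ?orbF ?orbT.
  exists (B `\` S)%fset; split=> //; last first.
    by apply/fdisjointP => q; rewrite in_fsetD => /andP[].
  split=> //.
  have -> : #|` (B `\` S)%fset| = (2 * d - 1)%N; last exact: rk1.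
  have := cardfsID S B; rewrite (fsetIidPr SB) S_card cB; move: d4.
  by move: #|` _| => x; clear; lia.
move=> B1 [dB1 rB1].
have cB1 := rank_unique _ _ _ rB1 rk1.
have dB := union_dec _ dB1.
have [h _] := low _ dB; have hc := card_union B1.
have [c1 c2] : #|` (B1 `&` S)%fset| = 0%N /\ #|` (B1 `|` S)%fset| = (s + 2 * d - 1)%N.
  move: h hc; rewrite cB1; move: d4; clear.
  by move: #|` _| #|` _| => x y; lia.
split; last by split=> //; rewrite c2.
by rewrite -fsetI_eq0 -cardfs_eq0 c1.
Qed.
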